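(* Let $\mathcal B$ be a nondegenerate braided fusion category, and let $\mathcal C$ be an indecomposable multi-fusion category equipped with a $\mathbb C$-linear additive braided monoidal functor $\psi:\bar{\mathcal B}\to Z(\mathcal C)$, where $\bar{\mathcal B}$ is the monoidal category $\mathcal B$ with the braiding $\bar c_{x,y}=c_{y,x}^{-1}$ and $Z(\mathcal C)$ is the ordinary Drinfeld center of $\mathcal C$. Let $\mathcal C^\sharp$ be the monoidal category enriched over $\mathcal B$ obtained by the canonical construction from $(\mathcal B,\mathcal C,\psi)$, with $\mathcal C^\sharp(x,y)=[x,y]$ the internal hom in $\mathcal B$. Then $Z(\mathcal C^\sharp)\simeq\bar{\mathcal B}'$ as braided monoidal categories enriched over $\mathcal B$, where $\bar{\mathcal B}'$ is the centralizer of $\bar{\mathcal B}$ in $Z(\mathcal C)$, regarded as a braided monoidal category enriched over $\mathcal B$ with hom objects $\bar{\mathcal B}'(x,y)\,\mathbf 1$.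
   Context: Enriched categories. Let $(\mathcal B,\otimes,\mathbf 1)$ be a monoidal category (its associativity and unit isomorphisms are suppressed; $1$ denotes identity morphisms). A category $\mathcal C^\sharp$ enriched over $\mathcal B$ has a set of objects, hom objects $\mathcal C^\sharp(x,y)\in\mathcal B$, identities $\mathrm{id}_x:\mathbf 1\to\mathcal C^\sharp(x,x)$ and compositions $\circ:\mathcal C^\sharp(y,z)\otimes\mathcal C^\sharp(x,y)\to\mathcal C^\sharp(x,z)$ satisfying the usual unit and associativity axioms. Its underlying category has the same objects and morphism sets $\mathcal B(\mathbf 1,\mathcal C^\sharp(x,y))$. For a morphism $f:x\to y$ in the underlying category, $f\circ-:\mathcal C^\sharp(w,x)\to\mathcal C^\sharp(w,y)$ and $-\circ f:\mathcal C^\sharp(y,w)\to\mathcal C^\sharp(x,w)$ denote composition with $f$. An enriched functor $F$ is a map on objects with morphisms $F:\mathcal C^\sharp(x,y)\to\mathcal D^\sharp(F(x),F(y))$ in $\mathcal B$ compatible with identities and compositions. An enriched natural transformation $\xi:F\to G$ is a natural transformation between the underlying functors such that $(\xi_y\circ-)\circ F=(-\circ\xi_x)\circ G$ as morphisms $\mathcal C^\sharp(x,y)\to\mathcal D^\sharp(F(x),G(y))$ for all $x,y$. Products. Let $\mathcal B$ be braided with braiding $c_{x,y}:x\otimes y\to y\otimes x$. $\mathcal C^\sharp\times\mathcal D^\sharp$ has objects $Ob(\mathcal C^\sharp)\times Ob(\mathcal D^\sharp)$, hom objects $(\mathcal C^\sharp\times\mathcal D^\sharp)((x,y),(x',y'))=\mathcal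 C^\sharp(x,x')\otimes\mathcal D^\sharp(y,y')$, identities $\mathrm{id}_x\otimes\mathrm{id}_y$, and composition $\mathcal C^\sharp(x',x'')\otimes\mathcal D^\sharp(y',y'')\otimes\mathcal C^\sharp(x,x')\otimes\mathcal D^\sharp(y,y')\xrightarrow{1\otimes c^{-1}\otimes1}\mathcal C^\sharp(x',x'')\otimes\mathcal C^\sharp(x,x')\otimes\mathcal D^\sharp(y',y'')\otimes\mathcal D^\sharp(y,y')\xrightarrow{\circ\otimes\circ}\mathcal C^\sharp(x,x'')\otimes\mathcal D^\sharp(y,y'')$, where $c^{-1}$ is the inverse of $c_{\mathcal C^\sharp(x,x'),\mathcal D^\sharp(y',y'')}$. Enriched monoidal categories. A monoidal category enriched over $\mathcal B$ is a category $\mathcal C^\sharp$ enriched over $\mathcal B$ with an object $\mathbf 1_{\mathcal C^\sharp}$, an enriched functor $\otimes:\mathcal C^\sharp\times\mathcal C^\sharp\to\mathcal C^\sharp$ and enriched natural isomorphisms $\lambda:\mathbf 1_{\mathcal C^\sharp}\otimes-\to\mathrm{Id}$, $\rho:-\otimes\mathbf 1_{\mathcal C^\sharp}\to\mathrm{Id}$, $\alpha:(-\otimes-)\otimes-\to-\otimes(-\otimes-)$ such that the underlying data define an ordinary monoidal category. An enriched monoidal functor is an enriched functor $F:\mathcal C^\sharp\to\mathcal D^\sharp$ with an isomorphism $\mu:F(\mathbf 1_{\mathcal C^\sharp})\to\mathbf 1_{\mathcal D^\sharp}$ and an enriched natural isomorphism $\nu:F(-)\otimes F(-)\to F(-\otimes-)$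 such that the underlying data define an ordinary monoidal functor. Enriched braided monoidal categories. An enriched functor $F:\mathcal C^\sharp\times\mathcal D^\sharp\to\mathcal E^\sharp$ is commutative if $F\circ c^2=F$ on every $\mathcal C^\sharp(x,x')\otimes\mathcal D^\sharp(y,y')$, where $c^2$ is the double braiding. Then $F^{\mathrm{rev}}(y,x)=F(x,y)$ together with $\mathcal D^\sharp(y,y')\otimes\mathcal C^\sharp(x,x')\xrightarrow{c}\mathcal C^\sharp(x,x')\otimes\mathcal D^\sharp(y,y')\xrightarrow{F}\mathcal E^\sharp(F(x,y),F(x',y'))$ defines an enriched functor $F^{\mathrm{rev}}$. An enriched braided monoidal category is an enriched monoidal category with commutative $\otimes$ and an enriched natural isomorphism $\beta:\otimes\to\otimes^{\mathrm{rev}}$ which defines a braiding for the underlying monoidal category. An enriched braided monoidal functor is an enriched monoidal functor whose underlying monoidal functor is braided. An equivalence of braided monoidal categories enriched over $\mathcal B$ is an enriched braided monoidal functor that is an isomorphism on all hom objects and essentially surjective on underlying categories. Drinfeld center. A half-braiding for $x\in\mathcal C^\sharp$ is an enriched natural isomorphism $b_x:x\otimes-\to-\otimes x$ (components $b_{x,z}:x\otimes z\to z\otimes x$) between enriched endofunctors of $\mathcal C^\sharp$ that defines a half-braiding in the underlying ordinary monoidal category. Assume $\mathcal B$ has equalizers and arbitrary intersections of subobjects of any object (true for braided fusion categories). The Drinfeld center $Z(\mathcal C^\sharp)$ is the monoidal category enriched over $\mathcal B$ whose objects are pairs $(x,b_x)$ with $b_x$ a half-braiding for $x$; whose hom object $Z(\mathcal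 C^\sharp)((x,b_x),(y,b_y))$ is the intersection over all $z\in\mathcal C^\sharp$ of the equalizers of the two morphisms $\mathcal C^\sharp(x,y)\rightrightarrows\mathcal C^\sharp(x\otimes z,z\otimes y)$ given by $\mathcal C^\sharp(x,y)\xrightarrow{\otimes\circ(\mathrm{id}_z\otimes1)}\mathcal C^\sharp(z\otimes x,z\otimes y)\xrightarrow{-\circ b_{x,z}}\mathcal C^\sharp(x\otimes z,z\otimes y)$ and $\mathcal C^\sharp(x,y)\xrightarrow{\otimes\circ(1\otimes\mathrm{id}_z)}\mathcal C^\sharp(x\otimes z,y\otimes z)\xrightarrow{b_{y,z}\circ-}\mathcal C^\sharp(x\otimes z,z\otimes y)$; and whose identities, composition and enriched monoidal structure are induced from those of $\mathcal C^\sharp$ (on objects as in the ordinary Drinfeld center). It is an enriched braided monoidal category with braiding $b_{x,y}:x\otimes y\to y\otimes x$. The ordinary Drinfeld center $Z(\mathcal C)$ likewise consists of pairs $(x,b_x)$ with half-braidings $b_{x,z}:x\otimes z\to z\otimes x$, and has braiding $b_{x,y}$. Canonical construction. Let $\phi:\bar{\mathcal B}\xrightarrow{\psi}Z(\mathcal C)\to\mathcal C$ be the composition of $\psi$ with the forgetful functor, and for $w\in\mathcal B$ let $b_{\phi(w),-}$ be the half-braiding of $\psi(w)$. For $x\in\mathcal C$ let $[x,-]:\mathcal C\to\mathcal B$ be the right adjoint of $\phi(-)\otimes x:\mathcal B\to\mathcal C$ (it exists for $\mathcal B,\mathcal C$ as in the claim), with counit $v_y:\phi[x,y]\otimes x\to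 y$. Then $\mathcal C^\sharp$ has the same objects as $\mathcal C$ and $\mathcal C^\sharp(x,y)=[x,y]$; composition $[y,z]\otimes[x,y]\to[x,z]$ is adjoint to $\phi([y,z]\otimes[x,y])\otimes x\to\phi[y,z]\otimes\phi[x,y]\otimes x\xrightarrow{1\otimes v_y}\phi[y,z]\otimes y\xrightarrow{v_z}z$; $\mathrm{id}_x:\mathbf 1\to[x,x]$ is adjoint to $\phi(\mathbf 1)\otimes x\to x$; the tensor product is that of $\mathcal C$ on objects and on hom objects is the morphism $[x,x']\otimes[y,y']\to[x\otimes y,x'\otimes y']$ adjoint to $\phi([x,x']\otimes[y,y'])\otimes x\otimes y\to\phi[x,x']\otimes\phi[y,y']\otimes x\otimes y\xrightarrow{1\otimes b_{\phi[y,y'],x}\otimes1}\phi[x,x']\otimes x\otimes\phi[y,y']\otimes y\xrightarrow{v_{x'}\otimes v_{y'}}x'\otimes y'$. The underlying monoidal category of $\mathcal C^\sharp$ is $\mathcal C$. Centralizer. The centralizer of $\bar{\mathcal B}$ in $Z(\mathcal C)$ is the full subcategory of $Z(\mathcal C)$ of those objects whose double braidings with all objects in the essential image of $\psi$ are trivial. Fusion categories. A multi-fusion category is a rigid semisimple $\mathbb C$-linear monoidal category with finitely many (isomorphism classes of) simple objects and finite-dimensional hom spaces; it is a fusion category if the tensor unit is simple. A nonzero multi-fusion category is indecomposable if it is not a direct sum of two nonzero multi-fusion categories. A braided fusion category is nondegenerate if its tensor unit is the unique (up to isomorphism) simple object $x$ that is transparent, i.e. $c_{y,x}\circ c_{x,y}=1$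 for all $y$. For a finite-dimensional vector space $V$, $V\,\mathbf 1$ denotes the direct sum of $\dim V$ copies of $\mathbf 1\in\mathcal B$, i.e. the image of $V$ under the canonical embedding of finite-dimensional vector spaces into $\mathcal B$; any $\mathbb C$-linear braided monoidal category with finite-dimensional hom spaces is enriched over $\mathcal B$ in this way. *)

(* Defs.v *)
From HB Require Import structures.
From mathcomp Require Import all_boot all_order all_algebra.
From mathcomp Require Import boolp reals complex.
Set Implicit Arguments.
Unset Strict Implicit.
Unset Printing Implicit Defensive.
Import GRing.Theory.

(* Categorical structures are split into operations ([*_data]) and laws
   ([is_*]), so that a construction can be written down before its laws are
   proved.  Nothing is strict: all associativity and unit isomorphisms are
   explicit.  Structural isomorphisms are stored together with their inverses,
   named with a final [V]. *)

Declare Scope cat_scope.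
Delimit Scope cat_scope with cat.
Local Open Scope cat_scope.

Record cat_data := CatData {
  ob :> Type;
  hom : ob -> ob -> Type;
  idm : forall x, hom x x;
  comp : forall x y z, hom y z -> hom x y -> hom x z }.
Arguments hom {c} x y.
Arguments idm {c} x.
Arguments comp {c x y z} g f.
Notation "g ∘ f" := (comp g f) (at level 41, right associativity) : cat_scope.

Record is_cat (C : cat_data) : Prop := IsCat {
  compA : forall (x y z w : C) (h : hom z w) (g : hom y z) (f : hom x y),
    (h ∘ g) ∘ f = h ∘ g ∘ f;
  comp1m : forall (x y : C) (f : hom x y), idm y ∘ f = f;
  compm1 : forall (x y : C) (f : hom x y), f ∘ idm x = f }.

Definition inverses (C : cat_data) (x y : C) (f : hom x y) (g : hom y x) :=
  g ∘ f = idm x /\ f ∘ g = idm y.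
Definition is_iso (C : cat_data) (x y : C) (f : hom x y) :=
  exists g, inverses f g.
Definition isomorphic (C : cat_data) (x y : C) := exists f : hom x y, is_iso f.

Record mon_data := MonData {
  mon_cat :> cat_data;
  one : mon_cat;
  tens : mon_cat -> mon_cat -> mon_cat;
  tensm : forall x x' y y', hom x x' -> hom y y' -> hom (tens x y) (tens x' y');
  assoc : forall x y z, hom (tens (tens x y) z) (tens x (tens y z));
  assocV : forall x y z, hom (tens x (tens y z)) (tens (tens x y) z);
  lun : forall x, hom (tens one x) x;
  lunV : forall x, hom x (tens one x);
  run : forall x, hom (tens x one) x;
  runV : forall x, hom x (tens x one) }.
Arguments one {m}.
Arguments tens {m} x y.
Arguments tensm {m x x' y y'} f g.
Arguments assoc {m} x y z.
Arguments assocV {m} x y z.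
Arguments lun {m} x.
Arguments lunV {m} x.
Arguments run {m} x.
Arguments runV {m} x.
Notation "x ⊗ y" := (tens x y) (at level 35, right associativity) : cat_scope.
Notation "f ⊠ g" := (tensm f g) (at level 35, right associativity) : cat_scope.

Record is_monoidal (M : mon_data) : Prop := IsMonoidal {
  mon_is_cat : is_cat M;
  tensm1 : forall x y : M, idm x ⊠ idm y = idm (x ⊗ y);
  tensmM : forall (x x' x'' y y' y'' : M) (f' : hom x' x'') (f : hom x x')
      (g' : hom y' y'') (g : hom y y'),
    (f' ∘ f) ⊠ (g' ∘ g) = (f' ⊠ g') ∘ (f ⊠ g);
  assocI : forall x y z : M, inverses (assoc x y z) (assocV x y z);
  lunI : forall x : M, inverses (lun x) (lunV x);
  runI : forall x : M, inverses (run x) (runV x);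
  assoc_nat : forall (x x' y y' z z' : M) (f : hom x x') (g : hom y y')
      (h : hom z z'),
    assoc x' y' z' ∘ ((f ⊠ g) ⊠ h) = (f ⊠ (g ⊠ h)) ∘ assoc x y z;
  lun_nat : forall (x y : M) (f : hom x y), lun y ∘ (idm one ⊠ f) = f ∘ lun x;
  run_nat : forall (x y : M) (f : hom x y), run y ∘ (f ⊠ idm one) = f ∘ run x;
  pentagon : forall x y z w : M,
    (idm x ⊠ assoc y z w) ∘ assoc x (y ⊗ z) w ∘ (assoc x y z ⊠ idm w)
    = assoc x y (z ⊗ w) ∘ assoc (x ⊗ y) z w;
  triangle : forall x y : M,
    (idm x ⊠ lun y) ∘ assoc x one y = run x ⊠ idm y }.

Record braiding (M : mon_data) := Braiding {
  braid : forall x y : M, hom (x ⊗ y) (y ⊗ x);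
  braidV : forall x y : M, hom (y ⊗ x) (x ⊗ y) }.
Arguments braid {M} b x y.
Arguments braidV {M} b x y.

Record is_braiding (M : mon_data) (c : braiding M) : Prop := IsBraiding {
  braidI : forall x y, inverses (braid c x y) (braidV c x y);
  braid_nat : forall (x x' y y' : M) (f : hom x x') (g : hom y y'),
    braid c x' y' ∘ (f ⊠ g) = (g ⊠ f) ∘ braid c x y;
  hexagon1 : forall x y z : M,
    assoc y z x ∘ braid c x (y ⊗ z) ∘ assoc x y z
    = (idm y ⊠ braid c x z) ∘ assoc y x z ∘ (braid c x y ⊠ idm z);
  hexagon2 : forall x y z : M,
    assocV z x y ∘ braid c (x ⊗ y) z ∘ assocV x y z
    = (braid c x z ⊠ idm y) ∘ assocV x z y ∘ (idm x ⊠ braid c y z) }.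

Definition rev_braiding (M : mon_data) (c : braiding M) : braiding M :=
  Braiding (fun x y => braidV c y x) (fun x y => braid c y x).

(* compatibility with the unit is a consequence, see [hb_unit] *)
Record is_half_braiding (M : mon_data) (x : M)
    (b : forall z, hom (x ⊗ z) (z ⊗ x)) (bV : forall z, hom (z ⊗ x) (x ⊗ z)) :
    Prop := IsHalfBraiding {
  hbI : forall z, inverses (b z) (bV z);
  hb_nat : forall (z w : M) (f : hom z w),
    b w ∘ (idm x ⊠ f) = (f ⊠ idm x) ∘ b z;
  hb_hexagon : forall z w : M,
    assoc z w x ∘ b (z ⊗ w) ∘ assoc x z w
    = (idm z ⊠ b w) ∘ assoc z x w ∘ (b z ⊠ idm w) }.

Arguments is_half_braiding {M x} b bV.

Definition hb_one (M : mon_data) (z : M) : hom (one ⊗ z) (z ⊗ one) :=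
  runV z ∘ lun z.
Definition hb_oneV (M : mon_data) (z : M) : hom (z ⊗ one) (one ⊗ z) :=
  lunV z ∘ run z.
Definition hb_tens (M : mon_data) (x y : M)
    (b : forall z, hom (x ⊗ z) (z ⊗ x)) (d : forall z, hom (y ⊗ z) (z ⊗ y))
    (z : M) : hom ((x ⊗ y) ⊗ z) (z ⊗ (x ⊗ y)) :=
  assoc z x y ∘ (b z ⊠ idm y) ∘ assocV x z y ∘ (idm x ⊠ d z) ∘ assoc x y z.
Definition hb_tensV (M : mon_data) (x y : M)
    (bV : forall z, hom (z ⊗ x) (x ⊗ z)) (dV : forall z, hom (z ⊗ y) (y ⊗ z))
    (z : M) : hom (z ⊗ (x ⊗ y)) ((x ⊗ y) ⊗ z) :=
  assocV x y z ∘ (idm x ⊠ dV z) ∘ assoc x z y ∘ (bV z ⊠ idm y) ∘ assocV z x y.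
Arguments hb_one {M} z.
Arguments hb_oneV {M} z.

Definition central (M : mon_data) (x y : M) (b : forall z, hom (x ⊗ z) (z ⊗ x))
    (d : forall z, hom (y ⊗ z) (z ⊗ y)) (f : hom x y) :=
  forall z, (idm z ⊠ f) ∘ b z = d z ∘ (f ⊠ idm z).

Section CatTheory.
Context (C : cat_data) (hC : is_cat C).
Lemma compL (x y z w : C) (a : hom y z) (b : hom x y) (c : hom x z)
  (k : hom w x) : a ∘ b = c -> a ∘ b ∘ k = c ∘ k.
Proof. by move=> <-; rewrite (compA hC). Qed.
Lemma compL3 (x y z v w : C) (a : hom y z) (b : hom x y) (b' : hom v x)
  (c : hom v z) (k : hom w v) : a ∘ b ∘ b' = c -> a ∘ b ∘ b' ∘ k = c ∘ k.
Proof. by move=> <-; rewrite !(compA hC). Qed.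
Lemma compL4 (x y z v u w : C) (a : hom y z) (b : hom x y) (b' : hom v x)
  (b'' : hom u v) (c : hom u z) (k : hom w u) :
  a ∘ b ∘ b' ∘ b'' = c -> a ∘ b ∘ b' ∘ b'' ∘ k = c ∘ k.
Proof. by move=> <-; rewrite !(compA hC). Qed.
Lemma compKL (x y w : C) (a : hom y x) (b : hom x y) (k : hom w x) :
  a ∘ b = idm x -> a ∘ b ∘ k = k.
Proof. by move=> e; rewrite (compL _ e) (comp1m hC). Qed.
Lemma cancelL (x y z : C) (a : hom y z) (aV : hom z y) (f g : hom x y) :
  aV ∘ a = idm y -> a ∘ f = a ∘ g -> f = g.
Proof. by move=> e /(congr1 (comp aV)); rewrite !(compKL _ e). Qed.
Lemma cancelR (x y z : C) (a : hom x y) (aV : hom y x) (f g : hom y z) :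
  a ∘ aV = idm y -> f ∘ a = g ∘ a -> f = g.
Proof.
move=> e /(congr1 (fun k => comp k aV)).
by rewrite !(compA hC) e !(compm1 hC).
Qed.
Lemma invs_sym (x y : C) (f : hom x y) g : inverses f g -> inverses g f.
Proof. by case. Qed.
Lemma invs_uniq (x y : C) (f : hom x y) g g' :
  inverses f g -> inverses f g' -> g = g'.
Proof.
move=> [gf _] [_ fg']; rewrite -(compm1 hC g) -fg' -(compA hC) gf.
exact: (comp1m hC).
Qed.
Lemma invs_comp (x y z : C) (f : hom x y) g (f' : hom y z) g' :
  inverses f g -> inverses f' g' -> inverses (f' ∘ f) (g ∘ g').
Proof.
move=> [a b] [a' b']; split; rewrite !(compA hC).
  by rewrite (compKL _ a').
by rewrite (compKL _ b).
Qed.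
End CatTheory.

Section MonTheory.
Context (M : mon_data) (hM : is_monoidal M).
Local Notation hC := (mon_is_cat hM).
Implicit Types x y z w : M.

Let cA := compA hC.
Let c1 := comp1m hC.
Let c2 := compm1 hC.
Lemma assocK x y z : assocV x y z ∘ assoc x y z = idm _.
Proof. exact: (assocI hM x y z).1. Qed.
Lemma assocVK x y z : assoc x y z ∘ assocV x y z = idm _.
Proof. exact: (assocI hM x y z).2. Qed.
Lemma lunK x : lunV x ∘ lun x = idm _.
Proof. exact: (lunI hM x).1. Qed.
Lemma lunVK x : lun x ∘ lunV x = idm _.
Proof. exact: (lunI hM x).2. Qed.
Lemma runK x : runV x ∘ run x = idm _.
Proof. exact: (runI hM x).1. Qed.
Lemma runVK x : run x ∘ runV x = idm _.
Proof. exact: (runI hM x).2. Qed.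

Lemma tensml x y y' y'' (g : hom y' y'') (f : hom y y') :
  idm x ⊠ (g ∘ f) = (idm x ⊠ g) ∘ (idm x ⊠ f).
Proof. by rewrite -(tensmM hM) c1. Qed.
Lemma tensmr x y y' y'' (g : hom y' y'') (f : hom y y') :
  (g ∘ f) ⊠ idm x = (g ⊠ idm x) ∘ (f ⊠ idm x).
Proof. by rewrite -(tensmM hM) c1. Qed.
Lemma tensm_lr x x' y y' (f : hom x x') (g : hom y y') :
  f ⊠ g = (f ⊠ idm y') ∘ (idm x ⊠ g).
Proof. by rewrite -(tensmM hM) c1 c2. Qed.
Lemma tensm_rl x x' y y' (f : hom x x') (g : hom y y') :
  f ⊠ g = (idm x' ⊠ g) ∘ (f ⊠ idm y).
Proof. by rewrite -(tensmM hM) c1 c2. Qed.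
Lemma tensmlK x y y' (g : hom y' y) (f : hom y y') :
  g ∘ f = idm y -> (idm x ⊠ g) ∘ (idm x ⊠ f) = idm _.
Proof. by move=> e; rewrite -tensml e (tensm1 hM). Qed.
Lemma tensmrK x y y' (g : hom y' y) (f : hom y y') :
  g ∘ f = idm y -> (g ⊠ idm x) ∘ (f ⊠ idm x) = idm _.
Proof. by move=> e; rewrite -tensmr e (tensm1 hM). Qed.

Lemma invs_tens x x' y y' (f : hom x x') g (f' : hom y y') g' :
  inverses f g -> inverses f' g' -> inverses (f ⊠ f') (g ⊠ g').
Proof.
by move=> [a b] [a' b']; split; rewrite -(tensmM hM) ?a ?b ?a' ?b' (tensm1 hM).
Qed.
Lemma invs1 x : inverses (idm x) (idm x).
Proof. by split; rewrite c1. Qed.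

Lemma assocV_nat x x' y y' z z' (f : hom x x') (g : hom y y') (h : hom z z') :
  ((f ⊠ g) ⊠ h) ∘ assocV x y z = assocV x' y' z' ∘ (f ⊠ (g ⊠ h)).
Proof.
apply: (cancelL hC (assocK x' y' z')).
by rewrite (compL hC _ (assoc_nat hM _ _ _)) cA assocVK c2 (compKL hC _ (assocVK _ _ _)).
Qed.
Lemma assoc_natr x x' y z (f : hom x x') :
  assoc x' y z ∘ ((f ⊠ idm y) ⊠ idm z) = (f ⊠ idm (y ⊗ z)) ∘ assoc x y z.
Proof. by rewrite (assoc_nat hM) (tensm1 hM). Qed.
Lemma assoc_natl x y z z' (h : hom z z') :
  assoc x y z' ∘ (idm (x ⊗ y) ⊠ h) = (idm x ⊠ (idm y ⊠ h)) ∘ assoc x y z.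
Proof. by rewrite -(assoc_nat hM) (tensm1 hM). Qed.
Lemma assocV_natr x x' y z (f : hom x x') :
  ((f ⊠ idm y) ⊠ idm z) ∘ assocV x y z = assocV x' y z ∘ (f ⊠ idm (y ⊗ z)).
Proof. by rewrite assocV_nat (tensm1 hM). Qed.
Lemma assocV_natl x y z z' (h : hom z z') :
  (idm (x ⊗ y) ⊠ h) ∘ assocV x y z = assocV x y z' ∘ (idm x ⊠ (idm y ⊠ h)).
Proof. by rewrite -assocV_nat (tensm1 hM). Qed.
Lemma lunV_nat x y (f : hom x y) : (idm one ⊠ f) ∘ lunV x = lunV y ∘ f.
Proof.
apply: (cancelL hC (lunK y)).
by rewrite (compL hC _ (lun_nat hM _)) cA lunVK c2 (compKL hC _ (lunVK _)).
Qed.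
Lemma runV_nat x y (f : hom x y) : (f ⊠ idm one) ∘ runV x = runV y ∘ f.
Proof.
apply: (cancelL hC (runK y)).
by rewrite (compL hC _ (run_nat hM _)) cA runVK c2 (compKL hC _ (runVK _)).
Qed.

Lemma tensr_inj x y (f g : hom x y) : f ⊠ idm one = g ⊠ idm one -> f = g.
Proof.
move=> e; apply: (cancelR hC (runVK x)).
by rewrite -!(run_nat hM) e.
Qed.
Lemma tensl_inj x y (f g : hom x y) : idm one ⊠ f = idm one ⊠ g -> f = g.
Proof.
move=> e; apply: (cancelR hC (lunVK x)).
by rewrite -!(lun_nat hM) e.
Qed.

Lemma pent1 x y z w :
  (idm x ⊠ assoc y z w) ∘ assoc x (y ⊗ z) w
  = assoc x y (z ⊗ w) ∘ assoc (x ⊗ y) z w ∘ (assocV x y z ⊠ idm w).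
Proof.
apply: (cancelR hC (tensmrK w (assocVK x y z))).
by rewrite !cA (pentagon hM) (tensmrK w (assocK x y z)) c2.
Qed.
Lemma pent2 x y z w :
  assoc x (y ⊗ z) w ∘ (assoc x y z ⊠ idm w)
  = (idm x ⊠ assocV y z w) ∘ assoc x y (z ⊗ w) ∘ assoc (x ⊗ y) z w.
Proof.
by rewrite -(pentagon hM) (compKL hC _ (tensmlK x (assocK y z w))).
Qed.
Lemma pent3 x y z w :
  assoc (x ⊗ y) z w ∘ (assocV x y z ⊠ idm w)
  = assocV x y (z ⊗ w) ∘ (idm x ⊠ assoc y z w) ∘ assoc x (y ⊗ z) w.
Proof. by rewrite pent1 (compKL hC _ (assocK _ _ _)). Qed.
Lemma pent4 x y z w :
  (idm x ⊠ assocV y z w) ∘ assoc x y (z ⊗ w)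
  = assoc x (y ⊗ z) w ∘ (assoc x y z ⊠ idm w) ∘ assocV (x ⊗ y) z w.
Proof.
apply: (cancelR hC (assocVK (x ⊗ y) z w)).
by rewrite !cA assocK c2 -pent2.
Qed.
Lemma pent5 x y z w :
  (assoc x y z ⊠ idm w) ∘ assocV (x ⊗ y) z w ∘ assocV x y (z ⊗ w)
  = assocV x (y ⊗ z) w ∘ (idm x ⊠ assocV y z w).
Proof.
apply: (cancelL hC (assocK x (y ⊗ z) w)).
rewrite (compL hC _ (pent2 _ _ _ _)) !cA (compKL hC _ (assocVK _ _ _)).
by rewrite assocVK c2 (compKL hC _ (assocVK _ _ _)).
Qed.
Lemma pent6 x y z w :
  (assoc x y z ⊠ idm w) ∘ assocV (x ⊗ y) z w
  = assocV x (y ⊗ z) w ∘ (idm x ⊠ assocV y z w) ∘ assoc x y (z ⊗ w).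
Proof.
have /(congr1 (fun k => k ∘ assoc x y (z ⊗ w))) := pent5 x y z w.
by rewrite !cA assocK c2.
Qed.

Lemma triangleV x y : (run x ⊠ idm y) ∘ assocV x one y = idm x ⊠ lun y.
Proof. by rewrite -(triangle hM) cA assocVK c2. Qed.
Lemma lun_tens x y : lun (x ⊗ y) ∘ assoc one x y = lun x ⊠ idm y.
Proof.
apply: tensl_inj.
apply: (cancelR hC (assocVK one (one ⊗ x) y)).
apply: (cancelR hC (tensmrK y (assocVK one one x))).
rewrite tensml !cA (pentagon hM) (compL hC _ (triangle hM _ _)) -assoc_natr.
rewrite (compL hC _ (esym (assoc_nat hM _ _ _))) !cA -tensmr.
by rewrite (triangle hM).
Qed.
Lemma run_tens x y : (idm x ⊠ run y) ∘ assoc x y one = run (x ⊗ y).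
Proof.
apply: tensr_inj.
apply: (cancelL hC (assocK x y one)).
rewrite tensmr (compL hC _ (assoc_nat hM _ _ _)) -(triangle hM y) tensml !cA.
rewrite (pentagon hM) (compL hC _ (esym (assoc_natl _ _ _))) !cA.
by rewrite (triangle hM).
Qed.
Lemma lun_tensV x y : (lun x ⊠ idm y) ∘ assocV one x y = lun (x ⊗ y).
Proof. by rewrite -lun_tens cA assocVK c2. Qed.
Lemma run_tensV x y : run (x ⊗ y) ∘ assocV x y one = idm x ⊠ run y.
Proof. by rewrite -run_tens cA assocVK c2. Qed.
Lemma lun_lun x : idm one ⊠ lun x = lun (one ⊗ x).
Proof. by apply: (cancelL hC (lunK x)); rewrite (lun_nat hM). Qed.
Lemma run_run x : run x ⊠ idm one = run (x ⊗ one).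
Proof. by apply: (cancelL hC (runK x)); rewrite (run_nat hM). Qed.
Lemma lun_run : lun one = run (one : M).
Proof.
apply: tensr_inj; apply: (cancelR hC (assocK one one one)).
by rewrite lun_tensV -lun_lun triangleV.
Qed.
Lemma lunV_runV : lunV one = runV (one : M).
Proof.
by apply: (cancelL hC (lunK one)); rewrite lunVK lun_run runVK.
Qed.
Lemma lunV_tens x y : assoc one x y ∘ (lunV x ⊠ idm y) = lunV (x ⊗ y).
Proof.
apply: (cancelL hC (lunK _)).
by rewrite lunVK (compL hC _ (lun_tens _ _)) (tensmrK _ (lunVK x)).
Qed.
Lemma runV_tens x y : assoc x y one ∘ runV (x ⊗ y) = idm x ⊠ runV y.
Proof.
apply: (cancelL hC (tensmlK x (runK y))).
by rewrite (compL hC _ (run_tens _ _)) runVK (tensmlK _ (runVK y)).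
Qed.

Lemma assoc_runV x y : assoc x one y ∘ (runV x ⊠ idm y) = idm x ⊠ lunV y.
Proof.
apply: (cancelL hC (tensmlK x (lunK y))).
by rewrite (tensmlK _ (lunVK _)) (compL hC _ (triangle hM _ _)) (tensmrK _ (runVK _)).
Qed.

Lemma hb_oneP : is_half_braiding (@hb_one M) hb_oneV.
Proof.
split=> [z|z w f|z w]; rewrite /hb_one /hb_oneV.
- split; rewrite !cA.
    by rewrite (compKL hC _ (runVK _)) lunK.
  by rewrite (compKL hC _ (lunVK _)) runK.
- by rewrite !cA (lun_nat hM) (compL hC _ (runV_nat _)) !cA.
- rewrite !cA lun_tens (compL hC _ (runV_tens _ _)) tensml tensmr !cA.
  by rewrite (compL hC _ (triangle hM _ _)) (compKL hC _ (tensmrK _ (runVK _))).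
Qed.

Section HbTens.
Context (x y : M).
Context (b : forall z, hom (x ⊗ z) (z ⊗ x)) (bV : forall z, hom (z ⊗ x) (x ⊗ z)).
Context (d : forall z, hom (y ⊗ z) (z ⊗ y)) (dV : forall z, hom (z ⊗ y) (y ⊗ z)).
Context (hb : is_half_braiding b bV) (hd : is_half_braiding d dV).
Lemma hb_hex_r z w :
  assocV z w x ∘ (idm z ⊠ b w) ∘ assoc z x w ∘ (b z ⊠ idm w)
  = b (z ⊗ w) ∘ assoc x z w.
Proof. by rewrite -(hb_hexagon hb) (compKL hC _ (assocK _ _ _)). Qed.
Lemma hb_tensP : is_half_braiding (hb_tens b d) (hb_tensV bV dV).
Proof.
split=> [z|z w f|z w]; rewrite /hb_tens /hb_tensV.
- have [b1 b2] := hbI hb z; have [d1 d2] := hbI hd z; split; rewrite !cA.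
    rewrite (compKL hC _ (assocK _ _ _)) (compKL hC _ (tensmrK _ b1)).
    rewrite (compKL hC _ (assocVK _ _ _)) (compKL hC _ (tensmlK _ d1)).
    exact: assocK.
  rewrite (compKL hC _ (assocVK _ _ _)) (compKL hC _ (tensmlK _ d2)).
  rewrite (compKL hC _ (assocK _ _ _)) (compKL hC _ (tensmrK _ b2)).
  exact: assocVK.
- rewrite !cA assoc_natl (compL hC _ (esym (tensml _ _ _))) (hb_nat hd) tensml !cA.
  rewrite (compL hC _ (esym (assocV_nat _ _ _))) !cA.
  rewrite (compL hC _ (esym (tensmr _ _ _))) (hb_nat hb) tensmr !cA.
  by rewrite (compL hC _ (assoc_natr _ _ _)) !cA.
- have swap : (idm (z ⊗ x) ⊠ d w) ∘ (b z ⊠ idm (y ⊗ w))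
             = (b z ⊠ idm (w ⊗ y)) ∘ (idm (x ⊗ z) ⊠ d w).
    by rewrite -tensm_rl -tensm_lr.
  have ed : (idm x ⊠ (idm z ⊠ d w)) ∘ (idm x ⊠ assoc z y w)
              ∘ (idm x ⊠ (d z ⊠ idm w))
            = idm x ⊠ (assoc z w y ∘ d (z ⊗ w) ∘ assoc y z w).
    by rewrite -!tensml (hb_hexagon hd).
  have eb : (assocV z w x ⊠ idm y) ∘ ((idm z ⊠ b w) ⊠ idm y)
              ∘ (assoc z x w ⊠ idm y) ∘ ((b z ⊠ idm w) ⊠ idm y)
            = (b (z ⊗ w) ∘ assoc x z w) ⊠ idm y.
    by rewrite -!tensmr hb_hex_r.
  symmetry; rewrite !tensmr !tensml !cA.
  rewrite (compL hC _ (pent1 z x y w)) !cA.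
  rewrite (compKL hC _ (tensmrK w (assocK z x y))).
  rewrite (compL hC _ (assoc_natr _ _ (b z))) !cA.
  rewrite (compL hC _ (pent3 x z y w)) !cA.
  rewrite (compL hC _ (assoc_nat hM (idm x) (d z) (idm w))) !cA.
  rewrite (compL hC _ (esym (assoc_natl z x (d w)))) !cA.
  rewrite (compL hC _ swap) !cA (compL hC _ (assocV_natl x z (d w))) !cA.
  rewrite (compL3 hC _ ed) !tensml !cA (pentagon hM).
  rewrite (compL hC _ (pent4 z x w y)) !cA.
  rewrite (compL hC _ (esym (assocV_natr w y (b z)))) !cA.
  rewrite (compL hC _ (esym (assoc_nat hM (idm z) (b w) (idm y)))) !cA.
  rewrite (compL hC _ (pent1 z w x y)) !cA.
  rewrite (compL4 hC _ eb) tensmr !cA.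
  rewrite (compL3 hC _ (pent5 x z w y)) !cA.
  by rewrite (compKL hC _ (tensmlK x (assocK z w y))).
Qed.
End HbTens.

Lemma hb_unit x (b : forall z, hom (x ⊗ z) (z ⊗ x)) bV :
  is_half_braiding b bV -> lun x ∘ b one = run x.
Proof.
move=> hb; apply: tensr_inj.
apply: (cancelL hC (hbI hb one).1).
rewrite -(triangle hM) (compL hC _ (hb_nat hb (lun one))) !cA.
rewrite -lun_tens !cA (hb_hexagon hb).
rewrite (compL hC _ (lun_nat hM (b one))) !cA.
by rewrite (compL hC _ (lun_tens _ _)) -tensmr.
Qed.

Section Central.
Context (x y z : M).
Context (b : forall z, hom (x ⊗ z) (z ⊗ x)) (bV : forall z, hom (z ⊗ x) (x ⊗ z)).
Context (d : forall z, hom (y ⊗ z) (z ⊗ y)) (dV : forall z, hom (z ⊗ y) (y ⊗ z)).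
Context (e : forall w, hom (z ⊗ w) (w ⊗ z)) (eV : forall w, hom (w ⊗ z) (z ⊗ w)).
Context (hb : is_half_braiding b bV) (hd : is_half_braiding d dV).

Lemma central_idm : central b b (idm x).
Proof. by move=> w; rewrite !(tensm1 hM) c1 c2. Qed.
Lemma central_comp f g : central b d f -> central d e g -> central b e (g ∘ f).
Proof.
move=> cf cg w; rewrite tensml tensmr cA cf.
by rewrite (compL hC _ (cg w)) !cA.
Qed.
Lemma central_inv f g : inverses f g -> central b d f -> central d b g.
Proof.
move=> [fK gK] cf w; apply: (cancelL hC (tensmlK w fK)).
rewrite (compL hC _ (cf w)) !cA (compKL hC _ (tensmlK w gK)).
by rewrite (tensmrK w gK) c2.
Qed.
Lemma central_assoc :
  central (hb_tens (hb_tens b d) e) (hb_tens b (hb_tens d e)) (assoc x y z).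
Proof.
move=> w; rewrite /hb_tens; rewrite !tensmr !tensml !cA.
rewrite (compL hC _ (pent1 w x y z)) !cA.
rewrite (compKL hC _ (tensmrK z (assocK w x y))).
rewrite (compL hC _ (assoc_natr _ _ (b w))) !cA.
rewrite (compL hC _ (pent3 x w y z)) !cA.
rewrite (compL hC _ (assoc_nat hM (idm x) (d w) (idm z))) !cA.
rewrite (compL hC _ (pent6 x y w z)) !cA.
rewrite (compKL hC _ (assocVK _ _ _)).
rewrite (compL hC _ (assoc_natl x y (e w))) !cA.
by rewrite (pentagon hM).
Qed.
Lemma central_lun : central (hb_tens hb_one b) b (lun x).
Proof.
move=> w; rewrite /hb_tens /hb_one tensmr !cA (compL hC _ (triangle hM w x)).
rewrite (compKL hC _ (tensmrK x (runVK w))) (compL hC _ (lun_tensV w x)).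
by rewrite (compL hC _ (lun_nat hM (b w))) !cA lun_tens.
Qed.
Lemma central_run : central (hb_tens b hb_one) b (run x).
Proof.
move=> w; rewrite /hb_tens /hb_one tensml !cA (compL hC _ (run_tens w x)).
rewrite (compL hC _ (run_nat hM (b w))) !cA (compL hC _ (run_tensV x w)).
by rewrite (compKL hC _ (tensmlK x (runVK w))) (triangle hM).
Qed.
Lemma central_braid : central (hb_tens b d) (hb_tens d b) (b y).
Proof.
move=> w; rewrite /hb_tens.
rewrite (compL3 hC _ (esym (hb_hexagon hb w y))) !cA -(hb_hexagon hb y w).
rewrite (compKL hC _ (assocVK _ _ _)) (compKL hC _ (assocK _ _ _)).
by rewrite (compL hC _ (hb_nat hb (d w))) !cA.
Qed.
End Central.

Lemma central_tensm x x' y y'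
    (b : forall z, hom (x ⊗ z) (z ⊗ x)) (b' : forall z, hom (x' ⊗ z) (z ⊗ x'))
    (d : forall z, hom (y ⊗ z) (z ⊗ y)) (d' : forall z, hom (y' ⊗ z) (z ⊗ y'))
    f g : central b b' f -> central d d' g ->
  central (hb_tens b d) (hb_tens b' d') (f ⊠ g).
Proof.
move=> cf cg w; rewrite /hb_tens !cA.
rewrite (compL hC _ (esym (assoc_nat hM (idm w) f g))) !cA.
have e1 : ((idm w ⊠ f) ⊠ g) ∘ (b w ⊠ idm y) = (b' w ⊠ idm y') ∘ ((f ⊠ idm w) ⊠ g).
  by rewrite -!(tensmM hM) cf c1 c2.
rewrite (compL hC _ e1) !cA (compL hC _ (assocV_nat f (idm w) g)) !cA.
have e2 : (f ⊠ (idm w ⊠ g)) ∘ (idm x ⊠ d w) = (idm x' ⊠ d' w) ∘ (f ⊠ (g ⊠ idm w)).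
  by rewrite -!(tensmM hM) cg c1 c2.
by rewrite (compL hC _ e2) !cA -(assoc_nat hM).
Qed.
End MonTheory.

Section BraidTheory.
Context (M : mon_data) (hM : is_monoidal M) (c : braiding M) (hc : is_braiding c).
Local Notation hC := (mon_is_cat hM).
Let cA := compA hC.
Let c1 := comp1m hC.
Let c2 := compm1 hC.

Lemma braid_hb (x : M) : is_half_braiding (braid c x) (braidV c x).
Proof.
split=> [z|z w f|z w]; first exact: (braidI hc).
- exact: (braid_nat hc).
- exact: (hexagon1 hc).
Qed.
Lemma braidK (x y : M) : braidV c x y ∘ braid c x y = idm _.
Proof. exact: (braidI hc x y).1. Qed.
Lemma braidVK (x y : M) : braid c x y ∘ braidV c x y = idm _.
Proof. exact: (braidI hc x y).2. Qed.
Lemma braid_tens (x y z : M) : braid c (x ⊗ y) z = hb_tens (braid c x) (braid c y) z.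
Proof.
apply: (cancelL hC (assocVK hM z x y)); rewrite /hb_tens.
rewrite (compKL hC _ (assocK hM _ _ _)).
apply: (cancelR hC (assocK hM x y z)).
by rewrite !cA (assocVK hM) c2 (hexagon2 hc).
Qed.

Lemma rev_braidingP : is_braiding (rev_braiding c).
Proof.
split=> [x y|x x' y y' f g|x y z|x y z] /=.
- by split; [exact: braidVK|exact: braidK].
- apply: (cancelL hC (braidK _ _)).
  rewrite (compKL hC _ (braidVK _ _)) (compL hC _ (braid_nat hc g f)) !cA.
  by rewrite braidVK c2.
- apply: (invs_uniq hC (f := assocV x y z ∘ braid c (y ⊗ z) x ∘ assocV y z x)).
    rewrite -(cA (assoc y z x)).
    do 2?[apply: (invs_comp hC)]; do ?[exact: (braidI hc)];
      exact: invs_sym (assocI hM _ _ _).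
  rewrite (hexagon2 hc) -(cA (idm y ⊠ _)).
  do 2?[apply: (invs_comp hC)]; do ?[exact: invs_sym (assocI hM _ _ _)];
    apply: (invs_tens hM); do ?[exact: (braidI hc)]; exact: (invs1 hM).
- apply: (invs_uniq hC (f := assoc x y z ∘ braid c z (x ⊗ y) ∘ assoc z x y)).
    rewrite -(cA (assocV z x y)).
    do 2?[apply: (invs_comp hC)]; do ?[exact: (braidI hc)];
      exact: (assocI hM _ _ _).
  rewrite (hexagon1 hc) -(cA (_ ⊠ idm y)).
  do 2?[apply: (invs_comp hC)]; do ?[exact: (assocI hM _ _ _)];
    apply: (invs_tens hM); do ?[exact: (braidI hc)]; exact: (invs1 hM).
Qed.

Lemma braid_one_r (x : M) : lun x ∘ braid c x one = run x.
Proof. exact: (hb_unit hM (braid_hb x)). Qed.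
End BraidTheory.

Section BraidTheory2.
Context (M : mon_data) (hM : is_monoidal M) (c : braiding M) (hc : is_braiding c).
Local Notation hC := (mon_is_cat hM).
Let cA := compA hC.
Let c1 := comp1m hC.
Let c2 := compm1 hC.

Lemma braid_one_l (x : M) : run x ∘ braid c one x = lun x.
Proof.
rewrite -(braid_one_r hM (rev_braidingP hM hc) x) /= cA (braidK hc).
by rewrite c2.
Qed.
Lemma braid_oneE_l (x : M) : braid c one x = runV x ∘ lun x.
Proof. by rewrite -braid_one_l (compKL hC _ (runK hM _)). Qed.
Lemma braid_oneE_r (x : M) : braid c x one = lunV x ∘ run x.
Proof. by rewrite -(braid_one_r hM hc) (compKL hC _ (lunK hM _)). Qed.

Definition double_braiding_trivial (x y : M) :=
  braid c y x ∘ braid c x y = idm (x ⊗ y).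

Lemma double_braiding_one (y : M) : double_braiding_trivial one y.
Proof.
rewrite /double_braiding_trivial braid_oneE_l braid_oneE_r !cA.
by rewrite (compKL hC _ (runVK hM _)) (lunK hM).
Qed.
Lemma double_braiding_tens (x x' y : M) :
  double_braiding_trivial x y -> double_braiding_trivial x' y ->
  double_braiding_trivial (x ⊗ x') y.
Proof.
rewrite /double_braiding_trivial => ex ex'.
rewrite (braid_tens hM hc) /hb_tens.
have h := hexagon1 hc y x x'.
have -> : braid c y (x ⊗ x') = assocV x x' y ∘ (idm x ⊠ braid c y x')
    ∘ assoc x y x' ∘ (braid c y x ⊠ idm x') ∘ assocV y x x'.
  rewrite (compL3 hC _ (esym h)) !cA (compKL hC _ (assocK hM _ _ _)).
  by rewrite (assocVK hM) c2.
rewrite !cA (compKL hC _ (assocK hM _ _ _)).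
rewrite (compKL hC _ (tensmrK hM _ ex)) (compKL hC _ (assocVK hM _ _ _)).
by rewrite (compKL hC _ (tensmlK hM _ ex')) (assocK hM).
Qed.
End BraidTheory2.

Record functor_data (C D : cat_data) := FunctorData {
  fob :> C -> D;
  fmap : forall x y : C, hom x y -> hom (fob x) (fob y) }.
Arguments fmap {C D} f {x y} g.

Record is_functor (C D : cat_data) (F : functor_data C D) : Prop := IsFunctor {
  fmap1 : forall x : C, fmap F (idm x) = idm (F x);
  fmapM : forall (x y z : C) (g : hom y z) (f : hom x y),
    fmap F (g ∘ f) = fmap F g ∘ fmap F f }.

Definition fully_faithful (C D : cat_data) (F : functor_data C D) :=
  forall x y : C, bijective (@fmap C D F x y).
Definition essentially_surjective (C D : cat_data) (F : functor_data C D) :=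
  forall y : D, exists x : C, isomorphic (F x) y.
Definition natural (C D : cat_data) (F G : functor_data C D)
    (xi : forall x : C, hom (F x) (G x)) :=
  forall (x y : C) (f : hom x y), xi y ∘ fmap F f = fmap G f ∘ xi x.

Record monfunctor_data (C D : mon_data) := MonFunctorData {
  mf_functor :> functor_data C D;
  mu : hom (mf_functor one) one;
  muV : hom one (mf_functor one);
  nu : forall x y : C,
    hom (mf_functor x ⊗ mf_functor y) (mf_functor (x ⊗ y));
  nuV : forall x y : C,
    hom (mf_functor (x ⊗ y)) (mf_functor x ⊗ mf_functor y) }.
Arguments mu {C D} m.
Arguments muV {C D} m.
Arguments nu {C D} m x y.
Arguments nuV {C D} m x y.

Record is_monfunctor (C D : mon_data) (F : monfunctor_data C D) : Prop :=
    IsMonFunctor {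
  mf_is_functor : is_functor F;
  muI : inverses (mu F) (muV F);
  nuI : forall x y : C, inverses (nu F x y) (nuV F x y);
  nu_nat : forall (x x' y y' : C) (f : hom x x') (g : hom y y'),
    nu F x' y' ∘ (fmap F f ⊠ fmap F g) = fmap F (f ⊠ g) ∘ nu F x y;
  nu_assoc : forall x y z : C,
    fmap F (assoc x y z) ∘ nu F (x ⊗ y) z ∘ (nu F x y ⊠ idm (F z))
    = nu F x (y ⊗ z) ∘ (idm (F x) ⊠ nu F y z) ∘ assoc (F x) (F y) (F z);
  nu_lun : forall x : C,
    fmap F (lun x) ∘ nu F one x = lun (F x) ∘ (mu F ⊠ idm (F x));
  nu_run : forall x : C,
    fmap F (run x) ∘ nu F x one = run (F x) ∘ (idm (F x) ⊠ mu F) }.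

Definition preserves_braiding (C D : mon_data) (c : braiding C) (d : braiding D)
    (F : monfunctor_data C D) :=
  forall x y : C, fmap F (braid c x y) ∘ nu F x y = nu F y x ∘ braid d (F x) (F y).

Record ecat_data (V : mon_data) := ECatData {
  eob :> Type;
  ehom : eob -> eob -> V;
  eid : forall x, hom one (ehom x x);
  ecomp : forall x y z, hom (ehom y z ⊗ ehom x y) (ehom x z) }.
Arguments ehom {V e} x y.
Arguments eid {V e} x.
Arguments ecomp {V e} x y z.

Record is_ecat (V : mon_data) (E : ecat_data V) : Prop := IsECat {
  ecompA : forall x y z w : E,
    ecomp x y w ∘ (ecomp y z w ⊠ idm (ehom x y))
    = ecomp x z w ∘ (idm (ehom z w) ⊠ ecomp x y z) ∘ assoc _ _ _;
  ecomp1m : forall x y : E, ecomp x y y ∘ (eid y ⊠ idm (ehom x y)) = lun _;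
  ecompm1 : forall x y : E, ecomp x x y ∘ (idm (ehom x y) ⊠ eid x) = run _ }.

Definition underlying (V : mon_data) (E : ecat_data V) : cat_data :=
  @CatData E (fun x y => hom one (ehom x y)) eid
    (fun x y z g f => ecomp x y z ∘ (g ⊠ f) ∘ lunV one).

(* [f ∘ -] and [- ∘ f] on hom objects, for [f] in the underlying category *)
Definition post (V : mon_data) (E : ecat_data V) (w x y : E)
    (f : hom one (ehom x y)) : hom (ehom w x) (ehom w y) :=
  ecomp w x y ∘ (f ⊠ idm _) ∘ lunV _.
Definition pre (V : mon_data) (E : ecat_data V) (w x y : E)
    (f : hom one (ehom x y)) : hom (ehom y w) (ehom x w) :=
  ecomp x y w ∘ (idm _ ⊠ f) ∘ runV _.
Arguments post {V E} w {x y} f.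
Arguments pre {V E} w {x y} f.

Record efunctor_data (V : mon_data) (D E : ecat_data V) := EFunctorData {
  efob :> D -> E;
  efhom : forall x y, hom (ehom x y) (ehom (efob x) (efob y)) }.
Arguments efhom {V D E} e x y.

Record is_efunctor (V : mon_data) (D E : ecat_data V) (F : efunctor_data D E) :
    Prop := IsEFunctor {
  efhom1 : forall x : D, efhom F x x ∘ eid x = eid (F x);
  efhomM : forall x y z : D, efhom F x z ∘ ecomp x y z
    = ecomp (F x) (F y) (F z) ∘ (efhom F y z ⊠ efhom F x y) }.

Definition underlying_functor (V : mon_data) (D E : ecat_data V)
    (F : efunctor_data D E) : functor_data (underlying D) (underlying E) :=
  @FunctorData (underlying D) (underlying E) F (fun x y f => efhom F x y ∘ f).

Definition eid_functor (V : mon_data) (E : ecat_data V) : efunctor_data E E :=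
  @EFunctorData V E E id (fun x y => idm _).
Definition ecomp_functor (V : mon_data) (C D E : ecat_data V)
    (G : efunctor_data D E) (F : efunctor_data C D) : efunctor_data C E :=
  @EFunctorData V C E (fun x => G (F x))
    (fun x y => efhom G (F x) (F y) ∘ efhom F x y).

Definition is_enatural (V : mon_data) (D E : ecat_data V)
    (F G : efunctor_data D E) (xi : forall x : D, hom one (ehom (F x) (G x))) :=
  @natural (underlying D) (underlying E)
    (underlying_functor F) (underlying_functor G) xi /\
  forall x y : D, post (F x) (xi y) ∘ efhom F x y = pre (G y) (xi x) ∘ efhom G x y.

(* exchange of the two middle factors by means of [s] *)
Definition middle (V : mon_data) (a b b' d : V) (s : hom (b ⊗ b') (b' ⊗ b)) :
    hom ((a ⊗ b) ⊗ (b' ⊗ d)) ((a ⊗ b') ⊗ (b ⊗ d)) :=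
  assocV a b' (b ⊗ d) ∘ (idm a ⊠ (assoc b' b d ∘ (s ⊠ idm d) ∘ assocV b b' d))
  ∘ assoc a b (b' ⊗ d).
Arguments middle {V} a {b b'} d s.

Section Products.
Context (V : mon_data) (c : braiding V).

(* [braidV c u v : v ⊗ u -> u ⊗ v] is the inverse of [braid c u v] *)
Definition eprod (C D : ecat_data V) : ecat_data V :=
  @ECatData V (C * D)%type
    (fun x y => ehom x.1 y.1 ⊗ ehom x.2 y.2)
    (fun x => (eid x.1 ⊠ eid x.2) ∘ lunV one)
    (fun x y z => (ecomp x.1 y.1 z.1 ⊠ ecomp x.2 y.2 z.2)
       ∘ middle _ _ (braidV c (ehom x.1 y.1) (ehom y.2 z.2))).

Definition eprod_functor (C C' D D' : ecat_data V)
    (F : efunctor_data C C') (G : efunctor_data D D') :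
    efunctor_data (eprod C D) (eprod C' D') :=
  @EFunctorData V (eprod C D) (eprod C' D') (fun x => (F x.1, G x.2))
    (fun x y => efhom F x.1 y.1 ⊠ efhom G x.2 y.2).
End Products.

Record emon_data (V : mon_data) := EMonData {
  em_cat :> ecat_data V;
  eone : em_cat;
  etens : em_cat -> em_cat -> em_cat;
  etensh : forall x x' y y' : em_cat,
    hom (ehom x x' ⊗ ehom y y') (ehom (etens x y) (etens x' y'));
  eassoc : forall x y z : em_cat,
    hom one (ehom (etens (etens x y) z) (etens x (etens y z)));
  eassocV : forall x y z : em_cat,
    hom one (ehom (etens x (etens y z)) (etens (etens x y) z));
  elun : forall x : em_cat, hom one (ehom (etens eone x) x);
  elunV : forall x : em_cat, hom one (ehom x (etens eone x));
  erun : forall x : em_cat, hom one (ehom (etens x eone) x);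
  erunV : forall x : em_cat, hom one (ehom x (etens x eone)) }.
Arguments eone {V e}.
Arguments etens {V e} x y.
Arguments etensh {V e} x x' y y'.
Arguments eassoc {V e} x y z.
Arguments eassocV {V e} x y z.
Arguments elun {V e} x.
Arguments elunV {V e} x.
Arguments erun {V e} x.
Arguments erunV {V e} x.

Section EMon.
Context (V : mon_data) (c : braiding V) (E : emon_data V).

Definition etens_functor : efunctor_data (eprod c E E) E :=
  @EFunctorData V (eprod c E E) E (fun p => etens p.1 p.2)
    (fun p q => etensh p.1 q.1 p.2 q.2).
(* [(- ⊗ -) ⊗ -] and [- ⊗ (- ⊗ -)] *)
Definition etens3l : efunctor_data (eprod c (eprod c E E) E) E :=
  @EFunctorData V (eprod c (eprod c E E) E) E
    (fun p => etens (etens p.1.1 p.1.2) p.2)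
    (fun p q => etensh _ _ _ _ ∘ (etensh p.1.1 q.1.1 p.1.2 q.1.2 ⊠ idm _)).
Definition etens3r : efunctor_data (eprod c (eprod c E E) E) E :=
  @EFunctorData V (eprod c (eprod c E E) E) E
    (fun p => etens p.1.1 (etens p.1.2 p.2))
    (fun p q => etensh _ _ _ _ ∘ (idm _ ⊠ etensh p.1.2 q.1.2 p.2 q.2)
       ∘ assoc _ _ _).

(* the enriched endofunctors [x ⊗ -] and [- ⊗ x] *)
Definition ltens (x : E) : efunctor_data E E :=
  @EFunctorData V E E (etens x)
    (fun z w => etensh x x z w ∘ (eid x ⊠ idm _) ∘ lunV _).
Definition rtens (x : E) : efunctor_data E E :=
  @EFunctorData V E E (etens^~ x)
    (fun z w => etensh z w x x ∘ (idm _ ⊠ eid x) ∘ runV _).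

Definition underlying_mon : mon_data :=
  @MonData (underlying E) eone etens
    (fun x x' y y' f g => etensh x x' y y' ∘ (f ⊠ g) ∘ lunV one)
    eassoc eassocV elun elunV erun erunV.

Record is_emonoidal : Prop := IsEMonoidal {
  em_is_ecat : is_ecat E;
  etens_is_efunctor : is_efunctor etens_functor;
  elun_nat : is_enatural (F := ltens eone) (G := eid_functor E) elun;
  erun_nat : is_enatural (F := rtens eone) (G := eid_functor E) erun;
  eassoc_nat : is_enatural (F := etens3l) (G := etens3r)
    (fun p => eassoc p.1.1 p.1.2 p.2);
  underlying_monoidal : is_monoidal underlying_mon }.
End EMon.

Record is_ehalf_braiding (V : mon_data) (E : emon_data V)
    (x : E) (b : forall z, hom one (ehom (etens x z) (etens z x)))
    (bV : forall z, hom one (ehom (etens z x) (etens x z))) : Prop :=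
    IsEHalfBraiding {
  ehb_nat : is_enatural (F := ltens x) (G := rtens x) b;
  ehb_underlying : @is_half_braiding (underlying_mon E) x b bV }.

Section EHalfBraiding.
Context (V : mon_data) (hV : is_monoidal V) (c : braiding V) (hc : is_braiding c).
Context (E : emon_data V) (hE : is_emonoidal c E).
Local Notation hC := (mon_is_cat hV).
Let cA := compA hC.
Let c1 := comp1m hC.
Let c2 := compm1 hC.
Let hEc := em_is_ecat hE.
Implicit Types x y z w : E.

Lemma lunV_lunV (a : V) : lunV (one ⊗ a) ∘ lunV a = (idm one ⊠ lunV a) ∘ lunV a.
Proof. by rewrite (lunV_nat hV). Qed.
Lemma runV_runV (a : V) : runV (a ⊗ one) ∘ runV a = (runV a ⊠ idm one) ∘ runV a.
Proof. by rewrite (runV_nat hV). Qed.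

Lemma tensML (a a' a'' b b' b'' k : V) (f' : hom a' a'') (f : hom a a')
    (g' : hom b' b'') (g : hom b b') (h : hom k (a ⊗ b)) :
  (f' ⊠ g') ∘ (f ⊠ g) ∘ h = ((f' ∘ f) ⊠ (g' ∘ g)) ∘ h.
Proof. by rewrite (compL hC _ (esym (tensmM hV _ _ _ _))). Qed.

Lemma postE (a : V) w x y (g : hom one (ehom x y)) (h : hom a (ehom w x)) :
  post w g ∘ h = ecomp w x y ∘ (g ⊠ h) ∘ lunV a.
Proof. by rewrite /post !cA -(lunV_nat hV) tensML c2 c1. Qed.
Lemma preE (a : V) w x y (f : hom one (ehom x y)) (h : hom a (ehom y w)) :
  pre w f ∘ h = ecomp x y w ∘ (h ⊠ f) ∘ runV a.
Proof. by rewrite /pre !cA -(runV_nat hV) tensML c2 c1. Qed.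

Lemma post_comp w x y z (g : hom one (ehom y z)) (f : hom one (ehom x y)) :
  post w (@comp (underlying E) _ _ _ g f) = post w g ∘ post w f.
Proof.
rewrite postE /post /= !(tensmr hV) !cA (compL hC _ (ecompA hEc w x y z)) !cA.
rewrite (compL hC _ (assoc_nat hV _ _ _)) !cA.
rewrite (compL hC _ (lunV_tens hV one (ehom w x))).
by rewrite lunV_lunV !tensML ?c1 ?c2 !cA.
Qed.
Lemma pre_comp w x y z (g : hom one (ehom y z)) (f : hom one (ehom x y)) :
  pre w (@comp (underlying E) _ _ _ g f) = pre w f ∘ pre w g.
Proof.
rewrite preE /pre /= (lunV_runV hV) !(tensml hV) !cA.
rewrite -(runV_tens hV) !cA (compL hC _ (esym (assoc_nat hV _ _ _))) !cA.
rewrite (compL3 hC _ (esym (ecompA hEc x y z w))) !cA runV_runV.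
by rewrite !tensML ?c1 ?c2 ?cA.
Qed.
Lemma post_pre x y w w' (g : hom one (ehom w w')) (f : hom one (ehom x y)) :
  post x g ∘ pre w f = pre w' f ∘ post y g.
Proof.
rewrite postE preE /pre /post.
have -> : (ecomp y w w' ∘ (g ⊠ idm _) ∘ lunV _) ⊠ f
   = (ecomp y w w' ⊠ idm _) ∘ ((g ⊠ idm _) ⊠ f) ∘ (lunV _ ⊠ idm one).
  by rewrite -!(tensmM hV) c1 c2.
rewrite !cA (compL hC _ (ecompA hEc x y w w')) !cA.
rewrite (compL hC _ (assoc_nat hV _ _ _)) !cA.
rewrite (compL hC _ (lunV_tens hV (ehom y w) one)) -(lunV_nat hV).
by rewrite !tensML ?c1 ?c2 ?cA.
Qed.
Lemma post1 w x : post w (eid x) = idm _.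
Proof. by rewrite /post (compL hC _ (ecomp1m hEc w x)) (lunVK hV). Qed.
Lemma pre1 w x : pre w (eid x) = idm _.
Proof. by rewrite /pre (compL hC _ (ecompm1 hEc x w)) (runVK hV). Qed.

Let enat (F G : efunctor_data E E) (xi : forall x, hom one (ehom (F x) (G x))) :=
  forall x y, post (F x) (xi y) ∘ efhom F x y = pre (G y) (xi x) ∘ efhom G x y.

Lemma enat_comp (F G H : efunctor_data E E) xi eta :
  enat (F := F) (G := G) xi -> enat (F := G) (G := H) eta ->
  enat (F := F) (G := H) (fun x => @comp (underlying E) _ _ _ (eta x) (xi x)).
Proof.
move=> nx ne x y; rewrite post_comp pre_comp (cA (post _ _)) (cA (pre _ _)) nx.
by rewrite (compL hC _ (post_pre _ _)) (cA (pre _ _)) ne.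
Qed.
Lemma enat_ext (F G : efunctor_data E E) xi eta :
  (forall x, xi x = eta x) -> enat (F := F) (G := G) xi ->
  enat (F := F) (G := G) eta.
Proof. by move=> e n x y; rewrite -!e. Qed.
Lemma enat_inv (F G : efunctor_data E E) xi eta :
  enat (F := F) (G := G) xi ->
  (forall x, @inverses (underlying E) _ _ (xi x) (eta x)) ->
  enat (F := G) (G := F) eta.
Proof.
move=> nx inv x y.
have h1 : pre (G y) (eta x) ∘ pre (G y) (xi x) = idm _.
  by rewrite -pre_comp (inv x).2 pre1.
have h2 : post (F x) (eta y) ∘ post (F x) (xi y) = idm _.
  by rewrite -post_comp (inv y).1 post1.
rewrite -{1}(compKL hC (efhom G x y) h1) -nx (compL hC _ (post_pre _ _)).
by rewrite (cA (pre _ _)) (compKL hC _ h2).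
Qed.

Let emulM (F : efunctor_data E E) := forall x y z, efhom F x z ∘ ecomp x y z
  = ecomp (F x) (F y) (F z) ∘ (efhom F y z ⊠ efhom F x y).
Lemma efhom_post F w x y (g : hom one (ehom x y)) : emulM F ->
  efhom F w y ∘ post w g = post (F w) (efhom F x y ∘ g) ∘ efhom F w x.
Proof.
move=> hF; rewrite postE /post (compL hC _ (hF w x y)) !cA.
by rewrite !tensML c2.
Qed.
Lemma efhom_pre F w x y (f : hom one (ehom x y)) : emulM F ->
  efhom F x w ∘ pre w f = pre (F w) (efhom F x y ∘ f) ∘ efhom F y w.
Proof.
move=> hF; rewrite preE /pre (compL hC _ (hF x y w)) !cA.
by rewrite !tensML c2.
Qed.
Lemma enat_whisker (H F G : efunctor_data E E) xi : emulM H ->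
  enat (F := F) (G := G) xi ->
  enat (F := ecomp_functor H F) (G := ecomp_functor H G)
    (fun x => efhom H _ _ ∘ xi x).
Proof.
move=> hH nx x y /=; rewrite (compL hC _ (esym (efhom_post _ _ hH))) (cA (efhom _ _ _)) nx.
by rewrite (compL hC _ (efhom_pre _ _ hH)) (cA (pre _ _)).
Qed.

Lemma middle_nat (a a' b b' d d' e e' : V) (f : hom a a') (g : hom b b')
    (h : hom d d') (k : hom e e') :
  middle a' e' (braidV c d' b') ∘ ((f ⊠ g) ⊠ (h ⊠ k))
  = ((f ⊠ h) ⊠ (g ⊠ k)) ∘ middle a e (braidV c d b).
Proof.
have bn := braid_nat (rev_braidingP hV hc) g h; rewrite /= in bn.
rewrite /middle !cA (assoc_nat hV) (compL hC _ (assocV_nat hV f h (g ⊠ k))).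
rewrite !cA !tensML c1 c2; congr (_ ∘ (_ ⊠ _) ∘ _).
rewrite !cA -(assocV_nat hV g h k) (compL hC _ (esym (assoc_nat hV h g k))) !cA.
by rewrite !tensML bn c1 c2.
Qed.
Lemma middle_one_l (b d e : V) (s : hom (b ⊗ d) (d ⊗ b)) :
  (lun d ⊠ idm _) ∘ middle one e s
  = assoc d b e ∘ (s ⊠ idm e) ∘ assocV b d e ∘ (lun b ⊠ idm _).
Proof.
rewrite /middle (compL hC _ (lun_tensV hV _ _)) (compL hC _ (lun_nat hV _)) !cA.
by rewrite (lun_tens hV).
Qed.
Lemma middle_one_r (a b d : V) (s : hom (b ⊗ d) (d ⊗ b)) :
  (idm _ ⊠ run b) ∘ middle a one s
  = assocV a d b ∘ (idm a ⊠ s) ∘ assoc a b d ∘ (idm _ ⊠ run d).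
Proof.
rewrite /middle (compL hC _ (assocV_natl hV _ _ _)) !cA tensML c1.
rewrite (compL hC _ (run_tens hV _ _)) (compL hC _ (run_nat hV _)) !cA.
by rewrite (run_tensV hV) (tensml hV) !cA (assoc_natl hV).
Qed.

Let rc := rev_braidingP hV hc.
Lemma eid_eid x : ecomp x x x ∘ (eid x ⊠ eid x) = eid x ∘ lun one.
Proof.
by rewrite (tensm_lr hV) (compL hC _ (ecomp1m hEc x x)) (lun_nat hV).
Qed.
Lemma etensh_comp x x' x'' y y' y'' :
  etensh x x'' y y'' ∘ (ecomp x x' x'' ⊠ ecomp y y' y'')
    ∘ middle _ _ (braidV c (ehom x x') (ehom y' y''))
  = ecomp _ _ _ ∘ (etensh x' x'' y' y'' ⊠ etensh x x' y y').
Proof.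
exact: (efhomM (etens_is_efunctor hE) (x, y) (x', y') (x'', y'')).
Qed.
Lemma etensh_id x y : etensh x x y y ∘ (eid x ⊠ eid y) ∘ lunV one = eid (etens x y).
Proof. exact: (efhom1 (etens_is_efunctor hE) (x, y)). Qed.

Lemma ltensM x : emulM (ltens x).
Proof.
move=> y z w /=; rewrite !cA -(lunV_nat hV) !tensML c1 c2.
have -> : (etensh x x z w ∘ (eid x ⊠ idm _) ∘ lunV (ehom z w))
    ⊠ (etensh x x y z ∘ (eid x ⊠ idm _) ∘ lunV (ehom y z))
  = (etensh x x z w ⊠ etensh x x y z) ∘ ((eid x ⊠ idm _) ⊠ (eid x ⊠ idm _))
    ∘ (lunV (ehom z w) ⊠ lunV (ehom y z)) by rewrite !(tensmM hV).
rewrite (compL hC _ (esym (etensh_comp x x x y z w))).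
rewrite (cA (etensh _ _ _ _)) (cA (_ ⊠ _)) (compL hC _ (middle_nat _ _ _ _)).
rewrite (cA (_ ⊠ _)) tensML eid_eid (tensm1 hV) c2.
have -> : (eid x ∘ lun one) ⊠ ecomp y z w
        = (eid x ⊠ ecomp y z w) ∘ (lun one ⊠ idm _) by rewrite -(tensmM hV) c2.
rewrite (cA (_ ⊠ _)) (compL hC _ (middle_one_l _ _)) !cA.
have := braid_oneE_r hV rc (ehom z w); rewrite /= => ->.
rewrite -(tensmM hV) (lunVK hV) c1 (tensmr hV) !cA.
rewrite -(assoc_runV hV) (compKL hC _ (assocK hV _ _ _)) (tensmrK hV _ (runVK hV _)) c2.
by rewrite (lunV_tens hV).
Qed.

Lemma rtensM x : emulM (rtens x).
Proof.
move=> y z w /=; rewrite !cA -(runV_nat hV) !tensML c1 c2.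
have -> : (etensh z w x x ∘ (idm _ ⊠ eid x) ∘ runV (ehom z w))
    ⊠ (etensh y z x x ∘ (idm _ ⊠ eid x) ∘ runV (ehom y z))
  = (etensh z w x x ⊠ etensh y z x x) ∘ ((idm _ ⊠ eid x) ⊠ (idm _ ⊠ eid x))
    ∘ (runV (ehom z w) ⊠ runV (ehom y z)) by rewrite !(tensmM hV).
rewrite (compL hC _ (esym (etensh_comp y z w x x x))).
rewrite (cA (etensh _ _ _ _)) (cA (_ ⊠ _)) (compL hC _ (middle_nat _ _ _ _)).
rewrite (cA (_ ⊠ _)) tensML eid_eid (tensm1 hV) c2 (lun_run hV).
have -> : ecomp y z w ⊠ (eid x ∘ run one)
        = (ecomp y z w ⊠ eid x) ∘ (idm _ ⊠ run one) by rewrite -(tensmM hV) c2.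
rewrite (cA (_ ⊠ _)) (compL hC _ (middle_one_r _ _)) !cA.
have := braid_oneE_l hV rc (ehom y z); rewrite /= => ->.
rewrite -(tensmM hV) (runVK hV) c1 (tensml hV) !cA.
rewrite (compL hC _ (triangle hV (ehom z w) (ehom y z))).
rewrite (tensmrK hV _ (runVK hV _)) c2.
by rewrite -(runV_tens hV) (compKL hC _ (assocK hV _ _ _)).
Qed.

Let eassoc_e p q := (eassoc_nat hE).2 p q.
Lemma plug_assoc p q (a : V)
    (k : hom a ((ehom p.1.1 q.1.1 ⊗ ehom p.1.2 q.1.2) ⊗ ehom p.2 q.2)) L R :
  L = efhom (etens3l c E) p q ∘ k -> R = efhom (etens3r c E) p q ∘ k ->
  post _ (eassoc q.1.1 q.1.2 q.2) ∘ L = pre _ (eassoc p.1.1 p.1.2 p.2) ∘ R.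
Proof.
move=> -> ->; rewrite -[LHS](cA (post _ _)) -[RHS](cA (pre _ _)).
by congr (_ ∘ _); exact: (eassoc_e p q).
Qed.

Lemma enat_assoc1 y z : enat
  (F := ecomp_functor (rtens z) (rtens y)) (G := rtens (etens y z))
  (fun x => eassoc x y z).
Proof.
move=> x x'; apply: (@plug_assoc (x, y, z) (x', y, z) _
  ((((idm _ ⊠ eid y) ∘ runV _) ⊠ eid z) ∘ runV _)); rewrite /= !cA.
  by rewrite -(runV_nat hV) !tensML ?c1 ?c2 ?cA.
have -> : ((idm (ehom x x') ⊠ eid y) ∘ runV (ehom x x')) ⊠ eid z
  = ((idm _ ⊠ eid y) ⊠ eid z) ∘ (runV _ ⊠ idm one) by rewrite -(tensmM hV) c2.
rewrite !cA (compL hC _ (assoc_nat hV _ _ _)) !cA.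
rewrite (compL hC _ (assoc_runV hV _ _)) !tensML ?c1 !cA.
by rewrite etensh_id.
Qed.
Lemma enat_assoc2 x z : enat
  (F := ecomp_functor (rtens z) (ltens x)) (G := ecomp_functor (ltens x) (rtens z))
  (fun y => eassoc x y z).
Proof.
move=> y y'; apply: (@plug_assoc (x, y, z) (x, y', z) _
  ((((eid x ⊠ idm _) ∘ lunV _) ⊠ eid z) ∘ runV _)); rewrite /= !cA.
  by rewrite -(runV_nat hV) !tensML ?c1 ?c2 ?cA.
have -> : ((eid x ⊠ idm (ehom y y')) ∘ lunV (ehom y y')) ⊠ eid z
  = ((eid x ⊠ idm _) ⊠ eid z) ∘ (lunV _ ⊠ idm one) by rewrite -(tensmM hV) c2.
rewrite !cA (compL hC _ (assoc_nat hV _ _ _)) !cA.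
rewrite (compL hC _ (lunV_tens hV _ _)) -!(lunV_nat hV) !tensML.
by rewrite ?c1 ?c2 ?cA.
Qed.
Lemma enat_assoc3 x y : enat
  (F := ltens (etens x y)) (G := ecomp_functor (ltens x) (ltens y))
  (fun z => eassoc x y z).
Proof.
move=> z z'; apply: (@plug_assoc (x, y, z) (x, y, z') _
  ((((eid x ⊠ eid y) ∘ lunV _) ⊠ idm _) ∘ lunV _)); rewrite /= !cA.
  by rewrite tensML c1 etensh_id.
have -> : ((eid x ⊠ eid y) ∘ lunV one) ⊠ idm (ehom z z')
  = ((eid x ⊠ eid y) ⊠ idm _) ∘ (lunV _ ⊠ idm _) by rewrite -(tensmM hV) c2.
rewrite !cA (compL hC _ (assoc_nat hV _ _ _)) !cA.
rewrite (compL hC _ (lunV_tens hV _ _)) -!(lunV_nat hV) !tensML.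
by rewrite ?c1 ?c2 ?cA.
Qed.

Let hU := underlying_monoidal hE.
Local Notation U := (underlying_mon E).
Lemma fmap_ltens x (z w : U) (f : hom z w) :
  efhom (ltens x) z w ∘ f = (@idm U x) ⊠ f.
Proof. by rewrite /= !cA -(lunV_nat hV) tensML c1 c2. Qed.
Lemma fmap_rtens x (z w : U) (f : hom z w) :
  efhom (rtens x) z w ∘ f = f ⊠ (@idm U x).
Proof. by rewrite /= !cA -(runV_nat hV) tensML c1 c2 (lunV_runV hV). Qed.

Lemma ehb_intro x (b : forall z, hom one (ehom (etens x z) (etens z x)))
    (bV : forall z, hom one (ehom (etens z x) (etens x z))) :
  enat (F := ltens x) (G := rtens x) b -> @is_half_braiding U x b bV ->
  is_ehalf_braiding b bV.
Proof.
move=> eb hb; split=> //; split=> [z w f|]; last exact: eb.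
have := @hb_nat U x b bV hb z w f; rewrite -fmap_ltens -fmap_rtens.
exact.
Qed.

Lemma ehb_oneP :
  is_ehalf_braiding (@hb_one (underlying_mon E)) (@hb_oneV (underlying_mon E)).
Proof.
apply: (ehb_intro _ (hb_oneP hU)).
apply: (enat_comp (F := ltens eone) (G := eid_functor E) (H := rtens eone)).
  exact: (elun_nat hE).2.
apply: (enat_inv (F := rtens eone) (G := eid_functor E) (xi := erun)).
  exact: (erun_nat hE).2.
by move=> x; exact: (runI hU x).
Qed.

Lemma ehb_tensP x y b bV d dV :
  @is_ehalf_braiding V E x b bV -> @is_ehalf_braiding V E y d dV ->
  is_ehalf_braiding (@hb_tens (underlying_mon E) x y b d)
    (@hb_tensV (underlying_mon E) x y bV dV).
Proof.
move=> hb hd; apply: (ehb_intro _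
  (hb_tensP hU (ehb_underlying hb) (ehb_underlying hd))).
pose F1 := ecomp_functor (ltens x) (ltens y).
pose F2 := ecomp_functor (ltens x) (rtens y).
pose F3 := ecomp_functor (rtens y) (ltens x).
pose F4 := ecomp_functor (rtens y) (rtens x).
apply: (enat_comp (F := ltens (etens x y)) (G := F4) (H := rtens (etens x y)) _
  (enat_assoc1 x y)).
apply: (enat_comp (F := ltens (etens x y)) (G := F3) (H := F4)); last first.
  apply: (enat_ext (F := F3) (G := F4) _ (enat_whisker (@rtensM y) (ehb_nat hb).2)).
  by move=> z; exact: fmap_rtens.
apply: (enat_comp (F := ltens (etens x y)) (G := F2) (H := F3)); last first.
  apply: (enat_inv (F := F3) (G := F2) (enat_assoc2 x y)).
  by move=> z; exact: (assocI hU).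
apply: (enat_comp (F := ltens (etens x y)) (G := F1) (H := F2)); last first.
  apply: (enat_ext (F := F1) (G := F2) _ (enat_whisker (@ltensM x) (ehb_nat hd).2)).
  by move=> z; exact: fmap_ltens.
exact: enat_assoc3.
Qed.
End EHalfBraiding.

Record emonfunctor_data (V : mon_data) (D E : emon_data V) := EMonFunctorData {
  emf_functor :> efunctor_data D E;
  emu : hom one (ehom (emf_functor eone) eone);
  emuV : hom one (ehom eone (emf_functor eone));
  enu : forall x y : D, hom one
    (ehom (etens (emf_functor x) (emf_functor y)) (emf_functor (etens x y)));
  enuV : forall x y : D, hom one
    (ehom (emf_functor (etens x y)) (etens (emf_functor x) (emf_functor y))) }.

Definition underlying_monfunctor (V : mon_data) (D E : emon_data V)
    (F : emonfunctor_data D E) :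
    monfunctor_data (underlying_mon D) (underlying_mon E) :=
  @MonFunctorData (underlying_mon D) (underlying_mon E) (underlying_functor F)
    (emu F) (emuV F) (enu F) (enuV F).

Record is_emonfunctor (V : mon_data) (c : braiding V) (D E : emon_data V)
    (F : emonfunctor_data D E) : Prop := IsEMonFunctor {
  emf_is_efunctor : is_efunctor F;
  enu_nat : is_enatural (F := ecomp_functor (etens_functor c E) (eprod_functor c F F))
    (G := ecomp_functor F (etens_functor c D)) (fun p => enu F p.1 p.2);
  underlying_is_monfunctor : is_monfunctor (underlying_monfunctor F) }.

Definition ecommutative (V : mon_data) (c : braiding V) (C D E : ecat_data V)
    (F : efunctor_data (eprod c C D) E) :=
  forall p q : eprod c C D,
    efhom F p q ∘ braid c (ehom p.2 q.2) (ehom p.1 q.1)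
      ∘ braid c (ehom p.1 q.1) (ehom p.2 q.2) = efhom F p q.
Definition erev (V : mon_data) (c : braiding V) (C D E : ecat_data V)
    (F : efunctor_data (eprod c C D) E) : efunctor_data (eprod c D C) E :=
  @EFunctorData V (eprod c D C) E (fun p => F (p.2, p.1))
    (fun p q => efhom F (p.2, p.1) (q.2, q.1)
       ∘ braid c (ehom p.1 q.1) (ehom p.2 q.2)).

Record ebraided_data (V : mon_data) := EBraidedData {
  ebr_mon :> emon_data V;
  ebraid : forall x y : ebr_mon, hom one (ehom (etens x y) (etens y x));
  ebraidV : forall x y : ebr_mon, hom one (ehom (etens y x) (etens x y)) }.

Definition underlying_braiding (V : mon_data) (E : ebraided_data V) :
    braiding (underlying_mon E) :=
  @Braiding (underlying_mon E) (@ebraid V E) (@ebraidV V E).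

Record is_ebraided (V : mon_data) (c : braiding V) (E : ebraided_data V) : Prop :=
    IsEBraided {
  ebr_is_emonoidal : is_emonoidal c E;
  etens_commutative : ecommutative (etens_functor c E);
  ebraid_nat : is_enatural (F := etens_functor c E)
    (G := erev (etens_functor c E)) (fun p => ebraid p.1 p.2);
  underlying_is_braiding : is_braiding (underlying_braiding E) }.

Definition ebraided_equivalent (V : mon_data) (c : braiding V)
    (D E : ebraided_data V) : Prop :=
  [/\ is_ebraided c D, is_ebraided c E &
    exists F : emonfunctor_data D E,
      [/\ is_emonfunctor c F,
          preserves_braiding (underlying_braiding D) (underlying_braiding E)
            (underlying_monfunctor F),
          (forall x y : D, is_iso (efhom F x y)) &
          essentially_surjective (underlying_functor F)]].

Local Open Scope ring_scope.
Local Open Scope cat_scope.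

(* [Vector.axioms_ K] is the class of [vectType K]: the hom spaces are
   finite-dimensional vector spaces over [K] *)
Record linear_mon_data (K : fieldType) := LinearMonData {
  lmd_mon :> mon_data;
  lmd_vect : forall x y : lmd_mon, Vector.axioms_ K (hom x y) }.

HB.instance Definition _ (K : fieldType) (L : linear_mon_data K) (x y : L) :=
  Vector.copy (hom x y) (Vector.Pack (lmd_vect x y)).

Record is_linear (K : fieldType) (L : linear_mon_data K) : Prop := IsLinear {
  comp_linl : forall (x y z : L) (f : hom x y) (a : K) (g g' : hom y z),
    (a *: g + g') ∘ f = a *: (g ∘ f) + g' ∘ f;
  comp_linr : forall (x y z : L) (g : hom y z) (a : K) (f f' : hom x y),
    g ∘ (a *: f + f') = a *: (g ∘ f) + g ∘ f';
  tensm_linl : forall (x x' y y' : L) (g : hom y y') (a : K) (f f' : hom x x'),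
    (a *: f + f') ⊠ g = a *: (f ⊠ g) + f' ⊠ g;
  tensm_linr : forall (x x' y y' : L) (f : hom x x') (a : K) (g g' : hom y y'),
    f ⊠ (a *: g + g') = a *: (f ⊠ g) + f ⊠ g' }.

Record linear_monoidal (K : fieldType) := LinearMonoidal {
  lm_data :> linear_mon_data K;
  lm_monoidal : is_monoidal lm_data;
  lm_linear : is_linear lm_data }.

Record linear_braided (K : fieldType) := LinearBraided {
  lb_mon :> linear_monoidal K;
  lb_braiding : braiding lb_mon;
  lb_braidingP : is_braiding lb_braiding }.

Definition rev_linear_braided (K : fieldType) (B : linear_braided K) :
    linear_braided K :=
  @LinearBraided K B (rev_braiding (lb_braiding B))
    (rev_braidingP (lm_monoidal B) (lb_braidingP B)).

Definition is_linear_functor (K : fieldType) (C D : linear_mon_data K)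
    (F : functor_data C D) :=
  forall (x y : C) (a : K) (f g : hom x y),
    fmap F (a *: f + g) = a *: fmap F f + fmap F g.

Section DirectSum.
Context (K : fieldType) (C D : linear_monoidal K).
Definition dsum_mon : mon_data :=
  @MonData (@CatData (C * D)%type
      (fun x y => (hom x.1 y.1 * hom x.2 y.2)%type)
      (fun x => (idm x.1, idm x.2))
      (fun x y z g f => (g.1 ∘ f.1, g.2 ∘ f.2)))
    (one, one) (fun x y => (x.1 ⊗ y.1, x.2 ⊗ y.2))
    (fun x x' y y' f g => (f.1 ⊠ g.1, f.2 ⊠ g.2))
    (fun x y z => (assoc x.1 y.1 z.1, assoc x.2 y.2 z.2))
    (fun x y z => (assocV x.1 y.1 z.1, assocV x.2 y.2 z.2))
    (fun x => (lun x.1, lun x.2)) (fun x => (lunV x.1, lunV x.2))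
    (fun x => (run x.1, run x.2)) (fun x => (runV x.1, runV x.2)).
Definition dsum_data : linear_mon_data K :=
  @LinearMonData K dsum_mon
    (fun x y => Vector.class (hom x.1 y.1 * hom x.2 y.2)%type).
Lemma dsum_monoidal : is_monoidal dsum_data.
Proof.
have hC := lm_monoidal C; have hD := lm_monoidal D.
have hC' := mon_is_cat hC; have hD' := mon_is_cat hD.
have pE (X Y : Type) (p q : X * Y) : p.1 = q.1 -> p.2 = q.2 -> p = q.
  by case: p q => [? ?] [? ?] /= -> ->.
split; first split; move=> *; rewrite /inverses; try split; apply: pE.
all: try solve [exact: (compA hC')|exact: (compA hD')|exact: (comp1m hC')
  |exact: (comp1m hD')|exact: (compm1 hC')|exact: (compm1 hD')].
all: try solve [exact: (tensm1 hC)|exact: (tensm1 hD)|exact: (tensmM hC)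
  |exact: (tensmM hD)|exact: (assoc_nat hC)|exact: (assoc_nat hD)
  |exact: (lun_nat hC)|exact: (lun_nat hD)|exact: (run_nat hC)|exact: (run_nat hD)
  |exact: (pentagon hC)|exact: (pentagon hD)|exact: (triangle hC)
  |exact: (triangle hD)].
all: solve [exact: (assocI hC _ _ _).1|exact: (assocI hC _ _ _).2
  |exact: (assocI hD _ _ _).1|exact: (assocI hD _ _ _).2
  |exact: (lunI hC _).1|exact: (lunI hC _).2|exact: (lunI hD _).1|exact: (lunI hD _).2
  |exact: (runI hC _).1|exact: (runI hC _).2|exact: (runI hD _).1|exact: (runI hD _).2].
Qed.
Lemma dsum_linear : is_linear dsum_data.
Proof.
have pE (X Y : Type) (p q : X * Y) : p.1 = q.1 -> p.2 = q.2 -> p = q.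
  by case: p q => [? ?] [? ?] /= -> ->.
have hC := lm_linear C; have hD := lm_linear D.
split=> *; apply: pE.
all: solve [exact: (comp_linl hC)|exact: (comp_linl hD)|exact: (comp_linr hC)
  |exact: (comp_linr hD)|exact: (tensm_linl hC)|exact: (tensm_linl hD)
  |exact: (tensm_linr hC)|exact: (tensm_linr hD)].
Qed.
Definition dsum : linear_monoidal K := LinearMonoidal dsum_monoidal dsum_linear.
End DirectSum.

Section Fusion.
Context (K : fieldType) (L : linear_monoidal K).

Definition is_mono (x y : L) (m : hom x y) :=
  forall (w : L) (f g : hom w x), m ∘ f = m ∘ g -> f = g.
Definition is_epi (x y : L) (e : hom x y) :=
  forall (w : L) (f g : hom y w), f ∘ e = g ∘ e -> f = g.
Definition is_kernel (x y k : L) (f : hom x y) (m : hom k x) :=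
  f ∘ m = 0 /\
  forall (w : L) (h : hom w x), f ∘ h = 0 -> exists! u, m ∘ u = h.
Definition is_cokernel (x y q : L) (f : hom x y) (e : hom y q) :=
  e ∘ f = 0 /\
  forall (w : L) (h : hom y w), h ∘ f = 0 -> exists! u, u ∘ e = h.
Definition is_zero (x : L) := idm x = 0.

Definition is_direct_sum (n : nat) (x : 'I_n -> L) (s : L)
    (i : forall k, hom (x k) s) (p : forall k, hom s (x k)) :=
  [/\ forall k, p k ∘ i k = idm (x k),
      forall k l, k <> l -> p k ∘ i l = 0 &
      \sum_(k < n) (i k ∘ p k) = idm s].

(* the empty direct sum is a zero object *)
Record is_abelian : Prop := IsAbelian {
  ab_sums : forall (n : nat) (x : 'I_n -> L),
    exists s i p, @is_direct_sum n x s i p;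
  ab_kernel : forall (x y : L) (f : hom x y), exists k m, @is_kernel x y k f m;
  ab_cokernel : forall (x y : L) (f : hom x y), exists q e, @is_cokernel x y q f e;
  ab_mono : forall (x y : L) (m : hom x y), is_mono m ->
    exists z (f : hom y z), is_kernel f m;
  ab_epi : forall (x y : L) (e : hom x y), is_epi e ->
    exists z (f : hom z x), is_cokernel f e }.

Definition is_simple (x : L) :=
  ~ is_zero x /\
  forall (y : L) (m : hom y x), is_mono m -> is_zero y \/ is_iso m.

Definition is_semisimple :=
  is_abelian /\
  forall x : L, exists n (s : 'I_n -> L) i p,
    (forall k, is_simple (s k)) /\ @is_direct_sum n s x i p.

Definition finitely_many_simples :=
  exists n (s : 'I_n -> L),
    forall x, is_simple x -> exists k, isomorphic x (s k).

(* [y] is a left dual of [x] *)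
Definition is_dual (x y : L) (ev : hom (y ⊗ x) one) (coev : hom one (x ⊗ y)) :=
  run x ∘ (idm x ⊠ ev) ∘ assoc x y x ∘ (coev ⊠ idm x) ∘ lunV x = idm x /\
  lun y ∘ (ev ⊠ idm y) ∘ assocV y x y ∘ (idm y ⊠ coev) ∘ runV y = idm y.
Definition is_rigid :=
  forall x : L, (exists y ev coev, @is_dual x y ev coev) /\
                (exists y ev coev, @is_dual y x ev coev).

Record is_multifusion : Prop := IsMultifusion {
  mfc_rigid : is_rigid;
  mfc_semisimple : is_semisimple;
  mfc_finite : finitely_many_simples }.

Definition is_fusion := is_multifusion /\ is_simple one.

Definition is_nonzero := exists x : L, ~ is_zero x.
End Fusion.

Definition linear_monoidal_equivalent (K : fieldType) (C D : linear_monoidal K) :=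
  exists F : monfunctor_data C D,
    [/\ is_monfunctor F, is_linear_functor F, fully_faithful F &
        essentially_surjective F].

(* a direct sum of [C1] and [C2] is a category equivalent to [dsum C1 C2] *)
Definition is_indecomposable (K : fieldType) (C : linear_monoidal K) :=
  is_nonzero C /\
  ~ exists C1 C2 : linear_monoidal K,
      [/\ is_multifusion C1 /\ is_nonzero C1, is_multifusion C2 /\ is_nonzero C2 &
          linear_monoidal_equivalent C (dsum C1 C2)].

Definition is_transparent (K : fieldType) (B : linear_braided K) (x : B) :=
  forall y : B, double_braiding_trivial (lb_braiding B) x y.
Definition is_nondegenerate (K : fieldType) (B : linear_braided K) :=
  (is_simple (one : B) /\ is_transparent (one : B)) /\
  forall x : B, is_simple x -> is_transparent x -> isomorphic x one.

Record half_braiding (M : mon_data) := HalfBraiding {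
  hb_ob : M;
  hb : forall z, hom (hb_ob ⊗ z) (z ⊗ hb_ob);
  hbV : forall z, hom (z ⊗ hb_ob) (hb_ob ⊗ z);
  hbP : is_half_braiding hb hbV }.
Arguments hb {M} h z.
Arguments hbV {M} h z.

Lemma vspace_of_pred (K : fieldType) (W : vectType K) (P : W -> Prop) :
  P 0 -> (forall a u v, P u -> P v -> P (a *: u + v)) ->
  exists U : {vspace W}, forall v, v \in U <-> P v.
Proof.
move=> P0 PL.
pose S n := `[< exists2 U : {vspace W}, \dim U = n & forall v, v \in U -> P v >].
have exS : exists n, S n.
  exists 0%N; apply/asboolP; exists 0%VS; first by rewrite dimv0.
  by move=> v; rewrite memv0 => /eqP ->.
have ubS n : S n -> (n <= \dim {:W})%N.
  by move=> /asboolP[U <- _]; exact: dimvS (subvf U).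
case: (ex_maxnP exS ubS) => n /asboolP[U dU PU] maxn.
exists U => v; split=> [/PU //|Pv].
have : S (\dim (U + <[v]>)).
  apply/asboolP; exists (U + <[v]>)%VS => // w /memv_addP[u uU [t /vlineP[a ->] ->]].
  by rewrite addrC; apply: PL => //; exact: PU.
move=> /maxn; rewrite -dU => le.
have /eqP -> : U == (U + <[v]>)%VS by rewrite eqEdim addvSl.
exact: subvP (addvSr _ _) _ (memv_line v).
Qed.

Section Center.
Context (K : fieldType) (C : linear_monoidal K).
Local Notation hC := (lm_monoidal C).

Lemma central_space_subproof (X Y : half_braiding C) :
  exists U : {vspace hom (hb_ob X) (hb_ob Y)},
    forall f, f \in U <-> central (hb X) (hb Y) f.
Proof.
have hL := lm_linear C.
apply: vspace_of_pred => [z|a u v cu cv z].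
  have e : (0 : hom (hb_ob X) (hb_ob Y)) = (-1) *: 0 + 0 by rewrite scaler0 addr0.
  have z1 : idm z ⊠ (0 : hom (hb_ob X) (hb_ob Y)) = 0.
    by have := tensm_linr hL (idm z) (-1) (0 : hom (hb_ob X) (hb_ob Y)) 0;
      rewrite -e scaleN1r addNr.
  have z2 : (0 : hom (hb_ob X) (hb_ob Y)) ⊠ idm z = 0.
    by have := tensm_linl hL (idm z) (-1) (0 : hom (hb_ob X) (hb_ob Y)) 0;
      rewrite -e scaleN1r addNr.
  rewrite z1 z2.
  have := comp_linl hL (hb X z) (-1) (0 : hom (z ⊗ hb_ob X) (z ⊗ hb_ob Y)) 0.
  rewrite scaleN1r oppr0 addr0 scaleN1r addNr => ->.
  have := comp_linr hL (hb Y z) (-1) (0 : hom (hb_ob X ⊗ z) (hb_ob Y ⊗ z)) 0.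
  by rewrite scaleN1r oppr0 addr0 scaleN1r addNr => ->.
rewrite (tensm_linr hL) (comp_linl hL) (tensm_linl hL) (comp_linr hL).
by rewrite cu cv.
Qed.
Definition central_space (X Y : half_braiding C) :
    {vspace hom (hb_ob X) (hb_ob Y)} := sval (cid (central_space_subproof X Y)).
Lemma central_spaceP X Y f :
  f \in central_space X Y <-> central (hb X) (hb Y) f.
Proof. by rewrite /central_space; case: cid. Qed.

Definition chom (X Y : half_braiding C) f (cf : central (hb X) (hb Y) f) :
  subvs_of (central_space X Y) := Subvs (proj2 (@central_spaceP X Y f) cf).
Lemma chomP (X Y : half_braiding C) (f : subvs_of (central_space X Y)) :
  central (hb X) (hb Y) (vsval f).
Proof. exact: proj1 (@central_spaceP X Y _) (subvsP f). Qed.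

Definition hb_unit_ob : half_braiding C := HalfBraiding (hb_oneP hC).
Definition hb_tens_ob (X Y : half_braiding C) : half_braiding C :=
  HalfBraiding (hb_tensP hC (hbP X) (hbP Y)).

Definition center_mon : mon_data :=
  @MonData (@CatData (half_braiding C)
      (fun X Y => subvs_of (central_space X Y))
      (fun X => chom (central_idm hC (hb X)))
      (fun X Y Z g f => chom (central_comp hC (chomP f) (chomP g))))
    hb_unit_ob hb_tens_ob
    (fun X X' Y Y' f g => chom (X := hb_tens_ob X Y) (Y := hb_tens_ob X' Y')
       (central_tensm hC (chomP f) (chomP g)))
    (fun X Y Z => chom (X := hb_tens_ob (hb_tens_ob X Y) Z)
       (Y := hb_tens_ob X (hb_tens_ob Y Z)) (central_assoc hC (hb X) (hb Y) (hb Z)))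
    (fun X Y Z => chom (X := hb_tens_ob X (hb_tens_ob Y Z))
       (Y := hb_tens_ob (hb_tens_ob X Y) Z)
       (central_inv hC (assocI hC _ _ _) (central_assoc hC (hb X) (hb Y) (hb Z))))
    (fun X => chom (X := hb_tens_ob hb_unit_ob X) (central_lun hC (hb X)))
    (fun X => chom (Y := hb_tens_ob hb_unit_ob X)
       (central_inv hC (lunI hC _) (central_lun hC (hb X))))
    (fun X => chom (X := hb_tens_ob X hb_unit_ob) (central_run hC (hb X)))
    (fun X => chom (Y := hb_tens_ob X hb_unit_ob)
       (central_inv hC (runI hC _) (central_run hC (hb X)))).
Definition center_data : linear_mon_data K :=
  @LinearMonData K center_mon (fun X Y => Vector.class (subvs_of (central_space X Y))).

Lemma center_monoidal : is_monoidal center_data.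
Proof.
have hC' := mon_is_cat hC.
split; first split.
- by move=> *; apply: val_inj; exact: (compA hC').
- by move=> *; apply: val_inj; exact: (comp1m hC').
- by move=> *; apply: val_inj; exact: (compm1 hC').
- by move=> *; apply: val_inj; exact: (tensm1 hC).
- by move=> *; apply: val_inj; exact: (tensmM hC).
- by split; apply: val_inj; [exact: (assocI hC _ _ _).1|exact: (assocI hC _ _ _).2].
- by split; apply: val_inj; [exact: (lunI hC _).1|exact: (lunI hC _).2].
- by split; apply: val_inj; [exact: (runI hC _).1|exact: (runI hC _).2].
- by move=> *; apply: val_inj; exact: (assoc_nat hC).
- by move=> *; apply: val_inj; exact: (lun_nat hC).
- by move=> *; apply: val_inj; exact: (run_nat hC).
- by move=> *; apply: val_inj; exact: (pentagon hC).
- by move=> *; apply: val_inj; exact: (triangle hC).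
Qed.
Lemma center_linear : is_linear center_data.
Proof.
have hL := lm_linear C.
split=> *; apply: val_inj.
- exact: (comp_linl hL).
- exact: (comp_linr hL).
- exact: (tensm_linl hL).
- exact: (tensm_linr hL).
Qed.

Definition center_braiding : braiding center_data :=
  @Braiding center_data
    (fun X Y => chom (X := hb_tens_ob X Y) (Y := hb_tens_ob Y X)
       (central_braid hC (hb Y) (hbP X)))
    (fun X Y => chom (X := hb_tens_ob Y X) (Y := hb_tens_ob X Y)
       (central_inv hC (hbI (hbP X) (hb_ob Y)) (central_braid hC (hb Y) (hbP X)))).
Lemma center_braidingP : is_braiding center_braiding.
Proof.
split=> [X Y|X X' Y Y' f g|X Y Z|X Y Z].
- by split; apply: val_inj; [exact: (hbI (hbP X) _).1|exact: (hbI (hbP X) _).2].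
- apply: val_inj => /=.
  have hC' := mon_is_cat hC; have cf := chomP f (hb_ob Y').
  rewrite (tensm_lr hC (vsval f)) (compL hC' _ (esym cf)) (compA hC').
  by rewrite (hb_nat (hbP X)) -(compA hC') -(tensm_rl hC).
- by apply: val_inj; exact: (hb_hexagon (hbP X)).
- apply: val_inj => /=; have hC' := mon_is_cat hC.
  rewrite /hb_tens !(compA hC') (compKL hC' _ (assocK hC _ _ _)) (assocVK hC).
  by rewrite (compm1 hC').
Qed.
Definition center : linear_braided K :=
  @LinearBraided K (LinearMonoidal center_monoidal center_linear)
    center_braiding center_braidingP.
End Center.

Section FullSub.
Context (K : fieldType) (D : linear_braided K) (P : D -> Prop).
Context (P1 : P one) (Pt : forall x y, P x -> P y -> P (x ⊗ y)).
Definition fullsub_mon : mon_data :=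
  @MonData (@CatData {x : D | P x} (fun x y => hom (sval x) (sval y))
      (fun x => idm (sval x)) (fun x y z g f => g ∘ f))
    (exist _ one P1)
    (fun x y => exist _ (sval x ⊗ sval y) (Pt (svalP x) (svalP y)))
    (fun x x' y y' f g => f ⊠ g)
    (fun x y z => assoc (sval x) (sval y) (sval z))
    (fun x y z => assocV (sval x) (sval y) (sval z))
    (fun x => lun (sval x)) (fun x => lunV (sval x))
    (fun x => run (sval x)) (fun x => runV (sval x)).
Definition fullsub_data : linear_mon_data K :=
  @LinearMonData K fullsub_mon (fun x y => lmd_vect (sval x) (sval y)).
Lemma fullsub_monoidal : is_monoidal fullsub_data.
Proof.
have hD := lm_monoidal D; have hD' := mon_is_cat hD.
split; first split; move=> *.
- exact: (compA hD').
- exact: (comp1m hD').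
- exact: (compm1 hD').
- exact: (tensm1 hD).
- exact: (tensmM hD).
- exact: (assocI hD).
- exact: (lunI hD).
- exact: (runI hD).
- exact: (assoc_nat hD).
- exact: (lun_nat hD).
- exact: (run_nat hD).
- exact: (pentagon hD).
- exact: (triangle hD).
Qed.
Lemma fullsub_linear : is_linear fullsub_data.
Proof.
have hL := lm_linear D; split=> *.
- exact: (comp_linl hL).
- exact: (comp_linr hL).
- exact: (tensm_linl hL).
- exact: (tensm_linr hL).
Qed.
Definition fullsub_braiding : braiding fullsub_data :=
  @Braiding fullsub_data (fun x y => braid (lb_braiding D) (sval x) (sval y))
    (fun x y => braidV (lb_braiding D) (sval x) (sval y)).
Lemma fullsub_braidingP : is_braiding fullsub_braiding.
Proof.
have hB := lb_braidingP D; split=> *.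
- exact: (braidI hB).
- exact: (braid_nat hB).
- exact: (hexagon1 hB).
- exact: (hexagon2 hB).
Qed.
Definition fullsub : linear_braided K :=
  @LinearBraided K (LinearMonoidal fullsub_monoidal fullsub_linear)
    fullsub_braiding fullsub_braidingP.
End FullSub.

Section Centralizer.
Context (K : fieldType) (B : cat_data) (D : linear_braided K).
Context (F : functor_data B D).
Definition in_essential_image (y : D) := exists w : B, isomorphic (F w) y.
Definition centralizes (x : D) :=
  forall y : D, in_essential_image y -> double_braiding_trivial (lb_braiding D) x y.
Lemma centralizes_one : centralizes one.
Proof.
by move=> y _; exact: (double_braiding_one (lm_monoidal D) (lb_braidingP D)).
Qed.
Lemma centralizes_tens x y : centralizes x -> centralizes y -> centralizes (x ⊗ y).
Proof.
move=> hx hy z hz.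
apply: (double_braiding_tens (lm_monoidal D) (lb_braidingP D)); first exact: hx.
exact: hy.
Qed.
Definition centralizer : linear_braided K := fullsub centralizes_one centralizes_tens.
End Centralizer.

(* Used to pick objects and morphisms given by a universal property: the default
   [x0] is irrelevant when such an object exists. *)
Definition choose (T : Type) (x0 : T) (P : T -> Prop) : T :=
  if pselect (exists x, P x) is left h then sval (cid h) else x0.

Section VectEnriched.
Context (K : fieldType) (B : linear_braided K).

Definition copies_data (n : nat) : Type :=
  {s : B & (('I_n -> hom one s) * ('I_n -> hom s one))%type}.
Definition copies (n : nat) : copies_data n :=
  choose (existT _ one (fun=> 0, fun=> 0) : copies_data n)
    (fun s => @is_direct_sum K B n (fun=> one) (projT1 s) (projT2 s).1 (projT2 s).2).

Section Copower.
Context (U : vectType K).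
(* [U 1], the direct sum of [\dim U] copies of the unit, indexed by a basis *)
Definition copower : B := projT1 (copies (\dim {:U})).
Definition cop_in (k : 'I_(\dim {:U})) : hom one copower := (projT2 (copies _)).1 k.
Definition cop_out (k : 'I_(\dim {:U})) : hom copower one := (projT2 (copies _)).2 k.
Definition cop_elt (u : U) : hom one copower :=
  \sum_k coord (vbasis {:U}) k u *: cop_in k.
End Copower.

(* the morphism [U 1 ⊗ W 1 -> T 1] induced by a bilinear map [U -> W -> T] *)
Definition cop_bilin (U W T : vectType K) (m : U -> W -> T) :
    hom (copower U ⊗ copower W) (copower T) :=
  \sum_(k < \dim {:U}) \sum_(l < \dim {:W})
    (cop_elt (m (vbasis {:U})`_k (vbasis {:W})`_l)
                 ∘ lun one ∘ (cop_out k ⊠ cop_out l)).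

Context (D : linear_braided K).
Definition vect_ecat : ecat_data B :=
  @ECatData B D (fun x y => copower (hom x y)) (fun x => cop_elt (idm x))
    (fun x y z => @cop_bilin (hom y z) (hom x y) (hom x z) (fun g f => g ∘ f)).
Definition vect_emon : emon_data B :=
  @EMonData B vect_ecat (one : D) (fun x y : D => x ⊗ y)
    (fun x x' y y' => @cop_bilin (hom x x') (hom y y') (hom (x ⊗ y) (x' ⊗ y'))
       (fun f g => f ⊠ g))
    (fun x y z => cop_elt (assoc (x : D) y z))
    (fun x y z => cop_elt (assocV (x : D) y z))
    (fun x => cop_elt (lun (x : D))) (fun x => cop_elt (lunV (x : D)))
    (fun x => cop_elt (run (x : D))) (fun x => cop_elt (runV (x : D))).
Definition vect_enriched : ebraided_data B :=
  @EBraidedData B vect_emon (fun x y => cop_elt (braid (lb_braiding D) x y))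
    (fun x y => cop_elt (braidV (lb_braiding D) x y)).
End VectEnriched.

Section Canonical.
Context (K : fieldType) (B : linear_braided K) (C : linear_monoidal K).
Context (psi : monfunctor_data (rev_linear_braided B) (center C)).

Definition chom_val (X Y : center C) (f : hom X Y) : hom (hb_ob X) (hb_ob Y) :=
  vsval f.

(* the composition [phi] of [psi] with the forgetful functor *)
Definition phi (w : B) : C := hb_ob (psi w).
Definition phim (w w' : B) (f : hom w w') : hom (phi w) (phi w') :=
  chom_val (@fmap _ _ psi w w' f).
Definition phi_mu : hom (phi one) one := chom_val (mu psi).
Definition phi_nuV (w w' : B) : hom (phi (w ⊗ w')) (phi w ⊗ phi w') :=
  chom_val (nuV psi w w').

Section InternalHom.
Context (x y : C).
(* a right adjoint of [w |-> phi w ⊗ x] at [y]: an object with a universal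
   morphism, the counit *)
Definition ihom_data : Type := {h : B & hom (phi h ⊗ x) y}.
Definition is_ihom (h : ihom_data) :=
  forall (w : B) (f : hom (phi w ⊗ x) y),
    exists! g : hom w (projT1 h), projT2 h ∘ (phim g ⊠ idm x) = f.
Definition ihom_choice : ihom_data :=
  choose (Tagged (fun h : B => hom (phi h ⊗ x) y)
      (0 : hom (phi one ⊗ x) y)) is_ihom.
Definition ihom : B := projT1 ihom_choice.
Definition ihom_ev : hom (phi ihom ⊗ x) y := projT2 ihom_choice.
Definition ihom_adj (w : B) (f : hom (phi w ⊗ x) y) : hom w ihom :=
  choose 0 (fun g : hom w ihom => ihom_ev ∘ (phim g ⊠ idm x) = f).
End InternalHom.

(* the structure morphisms of the canonical construction are the adjoints of the
   given morphisms out of [phi w ⊗ x] *)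
Definition canonical_ecat : ecat_data B :=
  @ECatData B C ihom (fun x => ihom_adj (lun x ∘ (phi_mu ⊠ idm x)))
    (fun x y z => ihom_adj
       (ihom_ev y z ∘ (idm _ ⊠ ihom_ev x y) ∘ assoc _ _ _ ∘ (phi_nuV _ _ ⊠ idm x))).

(* the morphism of the underlying category of the construction given by [f] *)
Definition canonical_name (x y : C) (f : hom x y) : hom one (ihom x y) :=
  ihom_adj (f ∘ lun x ∘ (phi_mu ⊠ idm x)).

Definition canonical : emon_data B :=
  @EMonData B canonical_ecat (one : C) (fun x y : C => x ⊗ y)
    (fun x x' y y' : C => ihom_adj
       ((ihom_ev x x' ⊠ ihom_ev y y')
          ∘ middle (phi (ihom x x')) y (hb (psi (ihom y y')) x)
          ∘ (phi_nuV _ _ ⊠ idm (x ⊗ y))))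
    (fun x y z : C => canonical_name (assoc x y z))
    (fun x y z : C => canonical_name (assocV x y z))
    (fun x : C => canonical_name (lun x)) (fun x : C => canonical_name (lunV x))
    (fun x : C => canonical_name (run x)) (fun x : C => canonical_name (runV x)).
End Canonical.

Definition is_equalizer (V : cat_data) (a b k : V) (f g : hom a b) (e : hom k a) :=
  f ∘ e = g ∘ e /\
  forall (w : V) (h : hom w a), f ∘ h = g ∘ h -> exists! u, e ∘ u = h.
Definition is_intersection (V : cat_data) (I : Type) (a : V) (k : I -> V)
    (s : forall i, hom (k i) a) (q : V) (m : hom q a) :=
  (forall i, exists u, s i ∘ u = m) /\
  forall (w : V) (h : hom w a), (forall i, exists u, s i ∘ u = h) ->
    exists! u, m ∘ u = h.

Record ehalf_braiding (V : mon_data) (E : emon_data V) := EHalfBraidingOb {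
  ehb_ob : E;
  ehb : forall z, hom one (ehom (etens ehb_ob z) (etens z ehb_ob));
  ehbV : forall z, hom one (ehom (etens z ehb_ob) (etens ehb_ob z));
  ehbP : is_ehalf_braiding ehb ehbV }.
Arguments ehb {V E} e z.
Arguments ehbV {V E} e z.

Section EnrichedCenter.
Context (K : fieldType) (B : linear_braided K) (E : emon_data B).
Context (hE : is_emonoidal (lb_braiding B) E).

Section CenterHom.
Context (X Y : ehalf_braiding E).
Local Notation x := (ehb_ob X).
Local Notation y := (ehb_ob Y).
Definition center_left (z : E) : hom (ehom x y) (ehom (etens x z) (etens z y)) :=
  pre (etens z y) (ehb X z) ∘ efhom (ltens z) x y.
Definition center_right (z : E) : hom (ehom x y) (ehom (etens x z) (etens z y)) :=
  post (etens x z) (ehb Y z) ∘ efhom (rtens z) x y.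
Definition subobject : Type := {k : B & hom k (ehom x y)}.
Definition is_center_hom (q : subobject) :=
  exists (k : E -> B) (s : forall z, hom (k z) (ehom x y)),
    (forall z, is_equalizer (center_left z) (center_right z) (s z)) /\
    is_intersection s (projT2 q).
Definition center_hom_choice : subobject :=
  choose (Tagged (fun k : B => hom k (ehom x y)) (0 : hom one (ehom x y)))
      is_center_hom.
Definition center_hom : B := projT1 center_hom_choice.
Definition center_incl : hom center_hom (ehom x y) := projT2 center_hom_choice.
Definition center_lift (w : B) (h : hom w (ehom x y)) : hom w center_hom :=
  choose 0 (fun u : hom w center_hom => center_incl ∘ u = h).
End CenterHom.

(* every structure morphism is the factorization, through the hom subobjects, of
   the corresponding one of [E] *)
Definition ecenter_ecat : ecat_data B :=
  @ECatData B (ehalf_braiding E) center_hom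
    (fun X => center_lift (X := X) (Y := X) (eid (ehb_ob X)))
    (fun X Y Z => center_lift (X := X) (Y := Z)
       (ecomp _ _ _ ∘ (center_incl Y Z ⊠ center_incl X Y))).

Definition ehb_one_ob : ehalf_braiding E :=
  EHalfBraidingOb (ehb_oneP (lm_monoidal B) hE).
Definition ehb_tens_ob (X Y : ehalf_braiding E) : ehalf_braiding E :=
  EHalfBraidingOb
    (ehb_tensP (lm_monoidal B) (lb_braidingP B) hE (ehbP X) (ehbP Y)).

Definition ecenter_emon : emon_data B :=
  @EMonData B ecenter_ecat ehb_one_ob ehb_tens_ob
    (fun X X' Y Y' => center_lift (X := ehb_tens_ob X Y) (Y := ehb_tens_ob X' Y')
       (etensh _ _ _ _ ∘ (center_incl X X' ⊠ center_incl Y Y')))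
    (fun X Y Z => center_lift (X := ehb_tens_ob (ehb_tens_ob X Y) Z)
       (Y := ehb_tens_ob X (ehb_tens_ob Y Z)) (eassoc _ _ _))
    (fun X Y Z => center_lift (X := ehb_tens_ob X (ehb_tens_ob Y Z))
       (Y := ehb_tens_ob (ehb_tens_ob X Y) Z) (eassocV _ _ _))
    (fun X => center_lift (X := ehb_tens_ob ehb_one_ob X) (Y := X) (elun _))
    (fun X => center_lift (X := X) (Y := ehb_tens_ob ehb_one_ob X) (elunV _))
    (fun X => center_lift (X := ehb_tens_ob X ehb_one_ob) (Y := X) (erun _))
    (fun X => center_lift (X := X) (Y := ehb_tens_ob X ehb_one_ob) (erunV _)).
Definition ecenter : ebraided_data B :=
  @EBraidedData B ecenter_emon
    (fun X Y => center_lift (X := ehb_tens_ob X Y) (Y := ehb_tens_ob Y X)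
       (ehb X (ehb_ob Y)))
    (fun X Y => center_lift (X := ehb_tens_ob Y X) (Y := ehb_tens_ob X Y)
       (ehbV X (ehb_ob Y))).
End EnrichedCenter.

(* Main.v *)
(** A morphism [w -> [x, y]] is the same as a morphism [phi w ⊗ x -> y] of [C],
    so the enriched identities in the canonical construction are identities between
    such morphisms with parameter.  In these terms an enriched half-braiding on [x]
    is an ordinary half-braiding [b] with [b (phi w) ∘ hb (psi w) x = 1] for all
    [w], that is, an object of the centralizer, and the hom object from [X] to [Y]
    of the enriched center represents [w |-> Hom (psi w ⊗ X, Y)], with [Hom] taken
    in the ordinary center.

    Let [h] be this hom object and [f : psi h ⊗ X -> Y] the universal morphism.
    Since [X] and [Y] centralize [psi], naturality of the double braiding shows that
    [psi v ⊗ f] absorbs the double braiding of [psi v] with [psi h]; contracting [v]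
    against its dual, universality of [f] shows that the double braiding of [v] with
    [h] is trivial.  As [B] is nondegenerate, [h] is a sum of copies of the unit.

    A morphism out of a sum of copies of the unit is determined by its composites
    with the morphisms out of the unit.  Hence the enriched laws follow from those of
    the underlying category, and the theorem reduces to the equivalence between the
    underlying category of the enriched center and the centralizer.

    The internal homs, equalizers and intersections exist since, by Schur's lemma,
    every linear functor from [B^op] to finite-dimensional vector spaces is
    representable. *)

Require Import Defs.
From mathcomp Require Import all_boot all_order all_algebra.
From mathcomp Require Import reals complex.
From HB Require Import structures.
From mathcomp Require Import boolp.
(* imported again: [hom] is also defined in mathcomp *)
Require Import Defs.
Set Implicit Arguments.
Unset Strict Implicit.
Unset Printing Implicit Defensive.
Import GRing.Theory.
Local Open Scope ring_scope.

Local Open Scope cat_scope.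

Notation "x ◁ f" := (idm x ⊠ f) (at level 35, right associativity) : cat_scope.
Notation "f ▷ x" := (f ⊠ idm x) (at level 35, only parsing) : cat_scope.

(* a monoidal functor that factors through the center of [M], braided for the reverse
   of the braiding [c] *)
Record central_functor (V M : mon_data) (c : braiding V) := CentralFunctor {
  cf_fun :> monfunctor_data V M;
  cf_hb : forall (w : V) (z : M), hom (cf_fun w ⊗ z) (z ⊗ cf_fun w);
  cf_hbV : forall (w : V) (z : M), hom (z ⊗ cf_fun w) (cf_fun w ⊗ z);
  cf_monfunctor : is_monfunctor cf_fun;
  cf_hbP : forall w, is_half_braiding (cf_hb w) (cf_hbV w);
  cf_central : forall (w w' : V) (f : hom w w'),
    central (cf_hb w) (cf_hb w') (fmap cf_fun f);
  cf_central_mu : central (cf_hb one) hb_one (mu cf_fun);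
  cf_central_nuV : forall w w' : V,
    central (cf_hb (w ⊗ w')) (hb_tens (cf_hb w) (cf_hb w')) (nuV cf_fun w w');
  cf_braid : forall w w' : V,
    fmap cf_fun (braidV c w' w) ∘ nu cf_fun w w' = nu cf_fun w' w ∘ cf_hb w (cf_fun w') }.

(** * Morphisms with parameter *)

Section Whiskering.
Context (M : mon_data) (hM : is_monoidal M).
Local Notation hC := (mon_is_cat hM).
Let cA := compA hC.
Let c1 := comp1m hC.
Let c2 := compm1 hC.

Lemma wl3 (z x y v u : M) (a : hom y x) (b : hom v y) (d : hom u v) (r : hom u x) :
  a ∘ b ∘ d = r -> (z ◁ a) ∘ (z ◁ b) ∘ (z ◁ d) = z ◁ r.
Proof. by move=> <-; rewrite !(tensml hM). Qed.
Lemma slide (x x' u u' : M) (k : hom x x') (t : hom u u') :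
  (k ▷ u') ∘ (x ◁ t) = (x' ◁ t) ∘ (k ▷ u).
Proof. by rewrite -(tensm_lr hM) -(tensm_rl hM). Qed.

(* [hat f u], and below [nuh v w u] and [bh w x u], are [f], [nuV] and the
   half-braiding tensored with [u], between objects bracketed to the right, so that
   no associativity isomorphism shows up in calculations.  They are locked because
   rewriting with [compA] would unfold them. *)
Definition hat (a x y : M) (f : hom (a ⊗ x) y) (u : M) : hom (a ⊗ x ⊗ u) (y ⊗ u) :=
  locked ((f ▷ u) ∘ assocV a x u).
Lemma hatE (a x y : M) (f : hom (a ⊗ x) y) u : hat f u = (f ▷ u) ∘ assocV a x u.
Proof. by rewrite /hat -lock. Qed.
Lemma hat_nat (a x y : M) (f : hom (a ⊗ x) y) u u' (t : hom u u') :
  hat f u' ∘ (a ◁ x ◁ t) = (y ◁ t) ∘ hat f u.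
Proof.
by rewrite !hatE !cA -(assocV_natl hM) (compL hC _ (slide _ _)) !cA.
Qed.
Lemma hat_assoc (a x y : M) (f : hom (a ⊗ x) y) u v :
  assoc y u v ∘ (hat f u ▷ v)
  = hat f (u ⊗ v) ∘ (a ◁ assoc x u v) ∘ assoc a (x ⊗ u) v.
Proof.
rewrite !hatE !(tensmr hM) !cA (compL hC _ (assoc_natr hM _ _ _)) !cA.
by rewrite (pent3 hM).
Qed.
End Whiskering.
Arguments hat {M a x y} f u.

(** * Monoidal functors through the inverse structure isomorphisms [nuV] *)

Section MonoidalFunctor.
Context (V M : mon_data) (hM : is_monoidal M) (F : monfunctor_data V M) (hF : is_monfunctor F).
Local Notation hC := (mon_is_cat hM).
Let cA := compA hC.
Let c1 := comp1m hC.
Let c2 := compm1 hC.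
Implicit Types (v w : V).

Lemma monf_nuV_nat v v' w w' (f : hom v v') (g : hom w w') :
  (fmap F f ⊠ fmap F g) ∘ nuV F v w = nuV F v' w' ∘ fmap F (f ⊠ g).
Proof.
apply: (cancelL hC (nuI hF v' w').1).
rewrite (compL hC _ (nu_nat hF f g)) !cA (nuI hF v w).2 c2.
by rewrite (compKL hC _ (nuI hF v' w').2).
Qed.
Lemma monf_nuV_assoc v w (z : V) :
  (F v ◁ nuV F w z) ∘ nuV F v (w ⊗ z) ∘ fmap F (assoc v w z)
  = assoc _ _ _ ∘ (nuV F v w ▷ F z) ∘ nuV F (v ⊗ w) z.
Proof.
apply: (cancelL hC (tensmlK hM (F v) (nuI hF w z).1)).
apply: (cancelL hC (nuI hF v (w ⊗ z)).1).
rewrite (compKL hC _ (tensmlK hM _ (nuI hF w z).2)) (compKL hC _ (nuI hF v (w ⊗ z)).2).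
rewrite (compL3 hC _ (esym (nu_assoc hF v w z))) !cA.
rewrite (compKL hC _ (tensmrK hM _ (nuI hF v w).2)) (nuI hF (v ⊗ w) z).2.
by rewrite c2.
Qed.
Lemma monf_nuV_lun w : lun (F w) ∘ (mu F ▷ F w) ∘ nuV F one w = fmap F (lun w).
Proof. by rewrite (compL hC _ (esym (nu_lun hF w))) !cA (nuI hF _ _).2 c2. Qed.
Lemma monf_nuV_run w : run (F w) ∘ (F w ◁ mu F) ∘ nuV F w one = fmap F (run w).
Proof. by rewrite (compL hC _ (esym (nu_run hF w))) !cA (nuI hF _ _).2 c2. Qed.
End MonoidalFunctor.

(** * Central functors and the calculus of morphisms with parameter *)

Section CentralFunctor.
Context (V M : mon_data) (hV : is_monoidal V) (hM : is_monoidal M).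
Context (c : braiding V) (hc : is_braiding c) (F : central_functor M c).
Local Notation hC := (mon_is_cat hM).
Let cA := compA hC.
Let c1 := comp1m hC.
Let c2 := compm1 hC.
Let hF := cf_monfunctor F.
Implicit Types (v w : V) (x y u : M).

Definition nuh v w u : hom (F (v ⊗ w) ⊗ u) (F v ⊗ F w ⊗ u) :=
  locked (assoc _ _ u ∘ (nuV F v w ▷ u)).
Definition bh w x u : hom (F w ⊗ x ⊗ u) (x ⊗ F w ⊗ u) :=
  locked (assoc _ _ u ∘ (cf_hb F w x ▷ u) ∘ assocV _ _ u).

Lemma nuhE v w u : nuh v w u = assoc _ _ u ∘ (nuV F v w ▷ u).
Proof. by rewrite /nuh -lock. Qed.
Lemma bhE w x u : bh w x u = assoc _ _ u ∘ (cf_hb F w x ▷ u) ∘ assocV _ _ u.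
Proof. by rewrite /bh -lock. Qed.
Let nuV_nat := monf_nuV_nat hM hF.
Let nuV_assoc := monf_nuV_assoc hM hF.
Let nuV_lun := monf_nuV_lun hM hF.
Let nuV_run := monf_nuV_run hM hF.
Lemma cfM v w (z : V) (g : hom w z) (f : hom v w) : fmap F (g ∘ f) = fmap F g ∘ fmap F f.
Proof. exact: (fmapM (mf_is_functor hF)). Qed.
Lemma cf1 w : fmap F (idm w) = idm (F w).
Proof. exact: (fmap1 (mf_is_functor hF)). Qed.
(** The axiom [cf_braid] rephrased with [nuV]. Through [nuh_braid] it lets [nuh_middle] turn the
    braiding in the composition of a product into a half-braiding of [M]. *)
Lemma nuV_braid v w :
  nuV F v w ∘ fmap F (braidV c v w) = cf_hb F w (F v) ∘ nuV F w v.
Proof.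
apply: (cancelR hC (nuI hF w v).2); rewrite !cA cf_braid (nuI hF w v).1 c2.
by rewrite (compKL hC _ (nuI hF v w).1).
Qed.

Lemma nuh_nat v w u u' (t : hom u u') :
  nuh v w u' ∘ (F (v ⊗ w) ◁ t) = (F v ◁ F w ◁ t) ∘ nuh v w u.
Proof. by rewrite !nuhE !cA (slide hM) (compL hC _ (assoc_natl hM _ _ _)) !cA. Qed.
Lemma bh_nat w x u u' (t : hom u u') :
  bh w x u' ∘ (F w ◁ x ◁ t) = (x ◁ F w ◁ t) ∘ bh w x u.
Proof.
rewrite !bhE !cA -(assocV_natl hM) (compL hC _ (slide hM _ _)) !cA.
by rewrite (compL hC _ (assoc_natl hM _ _ _)) !cA.
Qed.
Lemma bh_natx w x x' u (k : hom x x') :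
  bh w x' u ∘ (F w ◁ (k ▷ u)) = (k ▷ (F w ⊗ u)) ∘ bh w x u.
Proof.
rewrite !bhE !cA -(assocV_nat hM) (compL hC _ (esym (tensmr hM _ _ _))).
rewrite (hb_nat (cf_hbP F w)) (tensmr hM) !cA.
by rewrite (compL hC _ (assoc_natr hM _ _ _)) !cA.
Qed.
Lemma bh_hex w x y u :
  assoc x y (F w ⊗ u) ∘ bh w (x ⊗ y) u
  = (x ◁ bh w y u) ∘ bh w x (y ⊗ u) ∘ (F w ◁ assoc x y u).
Proof.
have e := hb_hex_r hM (cf_hbP F w) x y.
have e2 : cf_hb F w (x ⊗ y) = assocV x y (F w) ∘ (x ◁ cf_hb F w y) ∘ assoc x (F w) y
    ∘ (cf_hb F w x ▷ y) ∘ assocV (F w) x y.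
  by rewrite (compL4 hC _ e) !cA (assocVK hM) c2.
rewrite !bhE e2 !(tensmr hM) !(tensml hM) !cA.
rewrite (compL hC _ (esym (pentagon hM _ _ _ _))) !cA.
rewrite (compKL hC _ (tensmrK hM _ (assocVK hM _ _ _))).
rewrite (compL hC _ (assoc_nat hM (idm x) (cf_hb F w y) (idm u))) !cA.
rewrite (compL hC _ (pent2 hM _ _ _ _)) !cA.
rewrite (compL hC _ (assoc_natr hM _ _ (cf_hb F w x))) !cA.
rewrite (compL hC _ (pent3 hM _ _ _ _)) !cA.
by rewrite (assocVK hM) c2.
Qed.
(** By [bh_hex], crossing [a] and then [x] amounts to crossing [a ⊗ x], so naturality of the
    half-braiding carries [f] across. *)
Lemma bh_hat w (a x y : M) (f : hom (a ⊗ x) y) u :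
  hat f (F w ⊗ u) ∘ (a ◁ bh w x u) ∘ bh w a (x ⊗ u) = bh w y u ∘ (F w ◁ hat f u).
Proof.
rewrite !hatE !cA (tensml hM (F w)) (compL hC _ (bh_natx _ _ _)) !cA; congr (_ ∘ _).
apply: (cancelL hC (assocK hM a x (F w ⊗ u))).
rewrite (compKL hC _ (assocVK hM _ _ _)) (compL hC _ (bh_hex _ _ _ _)) !cA.
by rewrite (tensmlK hM _ (assocVK hM _ _ _)) c2.
Qed.
Lemma bh_tens v w x u :
  (x ◁ nuh v w u) ∘ bh (v ⊗ w) x u
  = bh v x (F w ⊗ u) ∘ (F v ◁ bh w x u) ∘ nuh v w (x ⊗ u).
Proof.
have e : (x ◁ nuV F v w) ∘ cf_hb F (v ⊗ w) x
   = assoc _ _ _ ∘ (cf_hb F v x ▷ F w) ∘ assocV _ _ _ ∘ (F v ◁ cf_hb F w x)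
    ∘ assoc _ _ _ ∘ (nuV F v w ▷ x).
  by rewrite (cf_central_nuV F v w x) /hb_tens !cA.
rewrite !nuhE !bhE !(tensml hM) !cA.
rewrite (compL hC _ (esym (assoc_nat hM (idm x) (nuV F v w) (idm u)))) !cA.
rewrite (compL hC _ (esym (tensmr hM _ _ _))) e !(tensmr hM) !cA.
rewrite (compL hC _ (pent1 hM _ _ _ _)) !cA.
rewrite (compKL hC _ (tensmrK hM _ (assocK hM _ _ _))).
rewrite (compL hC _ (assoc_natr hM _ _ (cf_hb F v x))) !cA.
rewrite (compL hC _ (pent3 hM _ _ _ _)) !cA.
rewrite (compL hC _ (assoc_nat hM (idm _) (cf_hb F w x) (idm u))) !cA.
do 5 congr (_ ∘ _).
by rewrite (assocV_natr hM) (compL hC _ (pent2 hM _ _ _ _)) !cA (compKL hC _ (assocVK hM _ _ _)).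
Qed.
Lemma nuh_braid v w u :
  nuh v w u ∘ (fmap F (braidV c v w) ▷ u) = bh w (F v) u ∘ nuh w v u.
Proof.
rewrite !nuhE !bhE !cA (compKL hC _ (assocK hM _ _ _)).
by rewrite -!(tensmr hM) nuV_braid.
Qed.
Lemma nuh_assoc v w (z : V) u :
  (F v ◁ nuh w z u) ∘ nuh v (w ⊗ z) u ∘ (fmap F (assoc v w z) ▷ u)
  = nuh v w (F z ⊗ u) ∘ nuh (v ⊗ w) z u.
Proof.
rewrite !nuhE !(tensml hM) !cA.
rewrite (compL hC _ (esym (assoc_nat hM (idm _) (nuV F w z) (idm u)))) !cA -!(tensmr hM).
rewrite nuV_assoc !(tensmr hM) (compL3 hC _ (pentagon hM _ _ _ _)) !cA.
by rewrite (compL hC _ (assoc_natr hM _ _ _)) !cA.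
Qed.
Lemma nuh_nat2 v v' w w' u (f : hom v v') (g : hom w w') :
  nuh v' w' u ∘ (fmap F (f ⊠ g) ▷ u)
  = (fmap F f ▷ _) ∘ (F v ◁ (fmap F g ▷ u)) ∘ nuh v w u.
Proof.
rewrite !nuhE !cA -(tensmr hM) -nuV_nat (tensmr hM).
by rewrite (compL hC _ (assoc_nat hM _ _ _)) !cA (tensm_lr hM (fmap F f) (_ ▷ u)) !cA.
Qed.
Lemma nuh_lun w u : lun (F w ⊗ u) ∘ (mu F ▷ _) ∘ nuh one w u = fmap F (lun w) ▷ u.
Proof.
rewrite nuhE (compL hC _ (esym (assoc_natr hM _ _ (mu F)))) !cA.
by rewrite (compL hC _ (lun_tens hM _ _)) -!(tensmr hM) nuV_lun.
Qed.
Lemma nuh_run w u : (F w ◁ (lun u ∘ (mu F ▷ u))) ∘ nuh w one u = fmap F (run w) ▷ u.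
Proof.
rewrite nuhE -nuV_run (tensml hM) !(tensmr hM) !cA.
by rewrite (compL hC _ (esym (assoc_nat hM _ _ _))) !cA (compL hC _ (triangle hM _ _)).
Qed.
Lemma bh_one w u : lun (F w ⊗ u) ∘ bh w one u = F w ◁ lun u.
Proof.
rewrite bhE (compL hC _ (lun_tens hM _ _)) (compL hC _ (esym (tensmr hM _ _ _))).
by rewrite (hb_unit hM (cf_hbP F w)) (triangleV hM).
Qed.
Lemma bh_mu x u : (x ◁ (lun u ∘ (mu F ▷ u))) ∘ bh one x u = lun (x ⊗ u) ∘ (mu F ▷ (x ⊗ u)).
Proof.
rewrite bhE (tensml hM) !cA.
rewrite (compL hC _ (esym (assoc_nat hM _ _ _))) !cA (compL hC _ (triangle hM _ _)).
do 2!rewrite (compL hC _ (esym (tensmr hM _ _ _))) ?cA.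
rewrite (cf_central_mu F x) /hb_one.
rewrite !(tensmr hM) !cA (compKL hC _ (tensmrK hM _ (runVK hM _))).
by rewrite (assocV_natr hM) (compL hC _ (lun_tensV hM _ _)).
Qed.

(* A morphism [F w ⊗ x -> y] is a morphism from [x] to [y] with parameter in [w]:
   it corresponds to a morphism from [w] to the internal hom of [x] and [y]. *)
Definition pcomp w v x y (z : M) (g : hom (F w ⊗ y) z) (f : hom (F v ⊗ x) y) :
    hom (F (w ⊗ v) ⊗ x) z :=
  g ∘ (F w ◁ f) ∘ nuh w v x.
Definition punit x y (k : hom x y) : hom (F one ⊗ x) y := k ∘ lun x ∘ (mu F ▷ x).
(** This is the formula of the canonical construction for the tensor product on hom objects, with
    all brackets to the right; [ptens_middle] gives back the form with [middle]. *)
Definition ptens v w x x' y y' (f : hom (F v ⊗ x) x') (g : hom (F w ⊗ y) y') :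
    hom (F (v ⊗ w) ⊗ x ⊗ y) (x' ⊗ y') :=
  hat f y' ∘ (F v ◁ ((x ◁ g) ∘ bh w x y)) ∘ nuh v w (x ⊗ y).

Lemma bh_natw w w' x u (f : hom w w') :
  bh w' x u ∘ (fmap F f ▷ (x ⊗ u)) = (x ◁ (fmap F f ▷ u)) ∘ bh w x u.
Proof.
rewrite !bhE !cA -(assocV_natr hM) (compL hC _ (esym (tensmr hM _ _ _))).
rewrite -(cf_central F f x) (tensmr hM) !cA.
by rewrite (compL hC _ (assoc_nat hM _ _ _)) !cA.
Qed.
Lemma pcomp_nat w w' v v' x y (z : M) (a : hom w w') (b : hom v v')
    (g : hom (F w' ⊗ y) z) (f : hom (F v' ⊗ x) y) :
  pcomp (g ∘ (fmap F a ▷ y)) (f ∘ (fmap F b ▷ x)) = pcomp g f ∘ (fmap F (a ⊠ b) ▷ x).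
Proof.
rewrite /pcomp !cA nuh_nat2 (tensml hM) !cA.
by rewrite (compL hC _ (slide hM (fmap F a) f)) !cA.
Qed.
Lemma ptens_nat w w' v v' x x' y y' (a : hom v v') (b : hom w w')
    (f : hom (F v' ⊗ x) x') (g : hom (F w' ⊗ y) y') :
  ptens (f ∘ (fmap F a ▷ x)) (g ∘ (fmap F b ▷ y)) = ptens f g ∘ (fmap F (a ⊠ b) ▷ (x ⊗ y)).
Proof.
rewrite /ptens !cA nuh_nat2 !(tensml hM) !cA.
have e : hat (f ∘ (fmap F a ▷ x)) y' = hat f y' ∘ (fmap F a ▷ _).
  by rewrite !hatE (tensmr hM) !cA (assocV_natr hM).
rewrite e !cA (compL hC _ (slide hM (fmap F a) _)) !cA.
rewrite (compL hC _ (esym (slide hM (fmap F a) (bh w' x y)))) !cA.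
by rewrite (compL hC _ (esym (tensml hM (F v) (bh w' x y) _))) bh_natw (tensml hM (F v)) !cA.
Qed.
Lemma ptens_middle v w x x' y y' (f : hom (F v ⊗ x) x') (g : hom (F w ⊗ y) y') :
  ptens f g = (f ⊠ g) ∘ middle (F v) y (cf_hb F w x) ∘ (nuV F v w ▷ (x ⊗ y)).
Proof.
rewrite /ptens /middle hatE nuhE bhE !(tensml hM) !cA.
by rewrite (compL hC _ (esym (assocV_natl hM (F v) x g))) !cA (compL hC _ (esym (tensm_lr hM f g))).
Qed.

Lemma pcompA w v t x y y' z (h : hom (F w ⊗ y') z) (g : hom (F v ⊗ y) y')
    (f : hom (F t ⊗ x) y) :
  pcomp (pcomp h g) f = pcomp h (pcomp g f) ∘ (fmap F (assoc w v t) ▷ x).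
Proof.
rewrite /pcomp !cA !(tensml hM) !cA nuh_assoc.
by rewrite (compL hC _ (nuh_nat _ _ _)) !cA.
Qed.
Lemma pcomp_unitl w x y z (k : hom y z) (f : hom (F w ⊗ x) y) :
  pcomp (punit k) f = k ∘ f ∘ (fmap F (lun w) ▷ x).
Proof.
rewrite /pcomp /punit !cA (compL hC _ (slide hM _ _)) !cA.
by rewrite (compL hC _ (lun_nat hM _)) !cA nuh_lun.
Qed.
Lemma pcomp_unitr w x y z (f : hom (F w ⊗ y) z) (k : hom x y) :
  pcomp f (punit k) = f ∘ (F w ◁ k) ∘ (fmap F (run w) ▷ x).
Proof. by rewrite /pcomp /punit (tensml hM) !cA nuh_run. Qed.
(** Only the parameter of the second factor has to cross an object: a half-braiding [bh] remains
    here, and none in [ptens_unitr]. *)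
Lemma ptens_unitl w x x' y y' (k : hom x x') (g : hom (F w ⊗ y) y') :
  ptens (punit k) g = (k ⊠ g) ∘ bh w x y ∘ (fmap F (lun w) ▷ (x ⊗ y)).
Proof.
rewrite /ptens /punit hatE !(tensmr hM) !cA (compL hC _ (assocV_natr hM _ _ _)) !cA.
rewrite (compL hC _ (lun_tensV hM _ _)) (compL hC _ (slide hM _ _)).
rewrite !cA (compL hC _ (lun_nat hM _)) !cA nuh_lun.
by rewrite (tensm_lr hM k g) !cA.
Qed.
Lemma ptens_unitr v x x' y y' (f : hom (F v ⊗ x) x') (l : hom y y') :
  ptens f (punit l) = hat f y' ∘ (F v ◁ x ◁ l) ∘ (fmap F (run v) ▷ (x ⊗ y)).
Proof.
rewrite /ptens /punit (tensml hM x) cA bh_mu (tensml hM (F v) (x ◁ l)) !cA.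
by rewrite nuh_run.
Qed.
Lemma nuh_hat v w x u :
  (nuh v w x ▷ u) ∘ assocV _ x u
  = assocV _ _ u ∘ (F v ◁ assocV _ x u) ∘ nuh v w (x ⊗ u).
Proof.
rewrite !nuhE !(tensmr hM) !cA (assocV_natr hM).
by rewrite (compL hC _ (pent6 hM _ _ _ _)) !cA.
Qed.
Lemma bh_hatr w x y u :
  (bh w x y ▷ u) ∘ assocV _ _ u ∘ (F w ◁ assocV x y u)
  = assocV _ _ u ∘ (x ◁ assocV _ _ u) ∘ bh w x (y ⊗ u).
Proof.
rewrite !bhE !(tensmr hM) !cA -(pent5 hM) (compKL hC _ (tensmrK hM _ (assocK hM _ _ _))).
rewrite (compL hC _ (assocV_natr hM _ _ _)) !cA.
by rewrite (compL hC _ (pent6 hM _ _ _ _)) !cA.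
Qed.
Lemma hat_pcomp w v x y z (g : hom (F w ⊗ y) z) (f : hom (F v ⊗ x) y) u :
  hat (pcomp g f) u = hat g u ∘ (F w ◁ hat f u) ∘ nuh w v (x ⊗ u).
Proof.
rewrite /pcomp !hatE !(tensmr hM) !cA nuh_hat (tensml hM) !cA.
by rewrite (compL hC _ (assocV_nat hM (idm _) f (idm u))) !cA.
Qed.
Lemma assoc_hat_ptens v w x x' y y' (f : hom (F v ⊗ x) x') (g : hom (F w ⊗ y) y') u :
  assoc x' y' u ∘ hat (ptens f g) u ∘ (F (v ⊗ w) ◁ assocV x y u)
  = hat f (y' ⊗ u) ∘ (F v ◁ ((x ◁ hat g u) ∘ bh w x (y ⊗ u)))
    ∘ nuh v w (x ⊗ y ⊗ u).
Proof.
rewrite /ptens (hatE _ u) !(tensmr hM) !cA (compL hC _ (nuh_hat _ _ _ _)) !cA nuh_nat.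
rewrite (compL hC _ (assocV_nat hM (idm (F v)) _ (idm u))) !cA.
rewrite (compL hC _ (hat_assoc hM _ _ _)) !cA (compKL hC _ (assocVK hM _ _ _)).
have e : assoc x y' u ∘ (((x ◁ g) ∘ bh w x y) ▷ u) ∘ assocV _ _ u ∘ (F w ◁ assocV x y u)
    = (x ◁ hat g u) ∘ bh w x (y ⊗ u).
  rewrite (tensmr hM) !cA bh_hatr (compL hC _ (assocV_nat hM _ _ _)) !cA.
  by rewrite (compKL hC _ (assocVK hM _ _ _)) hatE (tensml hM x) !cA.
by rewrite -e !(tensml hM (F v)) !cA.
Qed.
(** After [F] is split over the four factors, exchanging the two middle parameters becomes the
    half-braiding of [F t] at [F v]. This is the coherence behind the interchange law
    [pcomp_ptens]. *)
Lemma nuh_middle w v t s u :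
  (F w ◁ F v ◁ nuh t s u) ∘ nuh w v (F (t ⊗ s) ⊗ u) ∘ nuh (w ⊗ v) (t ⊗ s) u
    ∘ (fmap F (middle w s (braidV c v t)) ▷ u)
  = (F w ◁ bh t (F v) (F s ⊗ u)) ∘ nuh w t (F v ⊗ F s ⊗ u)
    ∘ (F (w ⊗ t) ◁ nuh v s u) ∘ nuh (w ⊗ t) (v ⊗ s) u.
Proof.
(* [X] is [middle] without the outer factor [w]. The claim for [X] is [nuh_braid] up to
   associativity; [w] is put back by [nuh_assoc]. *)
pose X := assoc v t s ∘ (braidV c v t ▷ s) ∘ assocV t v s.
have eX : (F v ◁ nuh t s u) ∘ nuh v (t ⊗ s) u ∘ (fmap F X ▷ u)
    = bh t (F v) (F s ⊗ u) ∘ (F t ◁ nuh v s u) ∘ nuh t (v ⊗ s) u.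
  rewrite /X !cfM !(tensmr hM) (compL3 hC _ (nuh_assoc _ _ _ _)) !cA.
  rewrite (compL hC _ (nuh_nat2 _ _ _)) cf1 !(tensm1 hM) !cA c1.
  rewrite (compL hC _ (nuh_braid _ _ _)) !cA; congr (_ ∘ _).
  apply: (cancelR hC (a := fmap F (assoc t v s) ▷ u) (aV := fmap F (assocV t v s) ▷ u)).
    by rewrite -(tensmr hM) -cfM (assocVK hV) cf1 (tensm1 hM).
  by rewrite !cA nuh_assoc -(tensmr hM) -cfM (assocK hV) cf1 (tensm1 hM) c2.
rewrite /middle -/X !cfM !(tensmr hM) (compL hC _ (esym (nuh_assoc w v (t ⊗ s) u))) !cA.
rewrite (compKL hC (a := fmap F (assoc w v (t ⊗ s)) ▷ u)); last first.
  by rewrite -(tensmr hM) -cfM (assocVK hV) cf1 (tensm1 hM).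
rewrite (compL hC _ (nuh_nat2 _ _ _)) cf1 (tensm1 hM) !cA c1.
rewrite (compL3 hC _ (wl3 hM _ eX)) !(tensml hM) !cA nuh_assoc.
by rewrite (compL hC _ (nuh_nat _ _ _)) !cA.
Qed.
(** The interchange law in parameter form; it becomes functoriality of the enriched tensor product
    in [canonical_etens]. *)
Lemma pcomp_ptens w v t s x x' x'' y y' y''
    (f' : hom (F w ⊗ x') x'') (f : hom (F v ⊗ x) x')
    (g' : hom (F t ⊗ y') y'') (g : hom (F s ⊗ y) y') :
  ptens (pcomp f' f) (pcomp g' g) ∘ (fmap F (middle w s (braidV c v t)) ▷ (x ⊗ y))
  = pcomp (ptens f' g') (ptens f g).
Proof.
(* The core of the computation: moving [F t] past [F v] and [x] before applying [f] agrees with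
   applying [f] and then moving [F t] past [x'], by [bh_hat]. *)
have inner : hat f y'' ∘ (F v ◁ ((x ◁ g') ∘ (x ◁ F t ◁ g) ∘ bh t x (F s ⊗ y)
      ∘ (F t ◁ bh s x y))) ∘ bh t (F v) (F s ⊗ x ⊗ y)
    = (x' ◁ g') ∘ bh t x' y' ∘ (F t ◁ (hat f y' ∘ (F v ◁ ((x ◁ g) ∘ bh s x y)))).
  rewrite !(tensml hM (F v)) !cA -bh_nat.
  rewrite (compL hC _ (hat_nat hM _ _)) !cA; congr (_ ∘ _).
  rewrite !(tensml hM (F t)) (compL hC _ (esym (bh_hat _ _ _))) !cA; congr (_ ∘ _).
  rewrite (compL hC _ (bh_nat _ _ _)) !cA.
  by rewrite !(compL hC _ (esym (tensml hM (F v) _ _))) (bh_nat t x).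
rewrite {1}/ptens hat_pcomp /pcomp !cA.
rewrite (tensml hM x g') (tensml hM x (F t ◁ g)) !cA bh_tens.
rewrite (compL hC _ (nuh_nat _ _ _)) !cA.
have split5 : (x ◁ g') ∘ (x ◁ F t ◁ g) ∘ bh t x (F s ⊗ y) ∘ (F t ◁ bh s x y) ∘ nuh t s (x ⊗ y)
  = ((x ◁ g') ∘ (x ◁ F t ◁ g) ∘ bh t x (F s ⊗ y) ∘ (F t ◁ bh s x y)) ∘ nuh t s (x ⊗ y).
  by rewrite !cA.
rewrite split5 (tensml hM (F v) _ (nuh _ _ _)) (tensml hM (F w) _ (F v ◁ nuh _ _ _)).
rewrite !cA nuh_middle.
rewrite (compL3 hC _ (wl3 hM (F w) inner)) !(tensml hM (F (w ⊗ t))) !(tensml hM (F w)) !cA.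
do ?[rewrite (compL hC _ (nuh_nat _ _ _)) !cA].
by rewrite !(tensml hM (F t)) !(tensml hM (F v)) !(tensml hM (F t)) !(tensml hM (F w)) !cA.
Qed.
Lemma ptensA w v t x x' y y' z z' (f : hom (F w ⊗ x) x') (g : hom (F v ⊗ y) y')
    (h : hom (F t ⊗ z) z') :
  assoc x' y' z' ∘ ptens (ptens f g) h
  = ptens f (ptens g h) ∘ (fmap F (assoc w v t) ⊠ assoc x y z).
Proof.
(* The hexagon makes the parameter of [h] cross [x ⊗ y] one factor at a time, as it does on the
   right-hand side. *)
have e : ((x ⊗ y) ◁ h) ∘ bh t (x ⊗ y) z
    = assocV x y z' ∘ (x ◁ y ◁ h) ∘ (x ◁ bh t y z) ∘ bh t x (y ⊗ z) ∘ (F t ◁ assoc x y z).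
  apply: (cancelL hC (assocK hM x y z')).
  by rewrite (compKL hC _ (assocVK hM _ _ _)) (compL hC _ (assoc_natl hM _ _ _)) !cA bh_hex.
rewrite {1}/ptens e !(tensml hM (F (w ⊗ v))) !cA.
rewrite (compL3 hC _ (assoc_hat_ptens _ _ _)) !cA.
do ?[rewrite (compL hC _ (nuh_nat _ _ _)) !cA].
rewrite (compL hC _ (esym (nuh_nat w v _))) !cA -(nuh_nat (w ⊗ v) t).
rewrite (compL hC _ (esym (nuh_assoc w v t _))) !cA (tensm_lr hM (fmap F _) (assoc x y z)).
have e2 : (x ◁ ptens g h) ∘ bh (v ⊗ t) x (y ⊗ z)
    = (x ◁ hat g z') ∘ bh v x (y ⊗ z') ∘ (F v ◁ x ◁ y ◁ h) ∘ (F v ◁ x ◁ bh t y z)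
      ∘ (F v ◁ bh t x (y ⊗ z)) ∘ nuh v t (x ⊗ y ⊗ z).
  rewrite /ptens !(tensml hM x) !cA bh_tens (tensml hM (F v)) (tensml hM x) !cA.
  by do 2![rewrite (compL hC _ (esym (bh_nat v x _))) !cA].
by rewrite e2 !(tensml hM (F w)) !cA.
Qed.
End CentralFunctor.

(** * Linear functors on semisimple categories are representable *)

Section LinearCategory.
Context (K : fieldType) (L : linear_monoidal K).
Let hL := lm_linear L.
Let hC := mon_is_cat (lm_monoidal L).
Let cA := compA hC.
Let c1 := comp1m hC.
Let c2 := compm1 hC.
Implicit Types x y z : L.

Lemma compDl x y z (f : hom x y) (g g' : hom y z) : (g + g') ∘ f = g ∘ f + g' ∘ f.
Proof. by have := comp_linl hL f 1 g g'; rewrite !scale1r. Qed.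
Lemma compDr x y z (g : hom y z) (f f' : hom x y) : g ∘ (f + f') = g ∘ f + g ∘ f'.
Proof. by have := comp_linr hL g 1 f f'; rewrite !scale1r. Qed.
Lemma comp0l x y z (f : hom x y) : (0 : hom y z) ∘ f = 0.
Proof. by apply: (addIr ((0 : hom y z) ∘ f)); rewrite -compDl !add0r. Qed.
Lemma comp0r x y z (g : hom y z) : g ∘ (0 : hom x y) = 0.
Proof. by apply: (addIr (g ∘ (0 : hom x y))); rewrite -compDr !add0r. Qed.
Lemma compZl x y z a (g : hom y z) (f : hom x y) : (a *: g) ∘ f = a *: (g ∘ f).
Proof. by have := comp_linl hL f a g 0; rewrite comp0l !addr0. Qed.
Lemma compZr x y z a (g : hom y z) (f : hom x y) : g ∘ (a *: f) = a *: (g ∘ f).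
Proof. by have := comp_linr hL g a f 0; rewrite comp0r !addr0. Qed.
Lemma compBl x y z (f : hom x y) (g g' : hom y z) : (g - g') ∘ f = g ∘ f - g' ∘ f.
Proof. by rewrite -scaleN1r compDl compZl scaleN1r. Qed.
Lemma compBr x y z (g : hom y z) (f f' : hom x y) : g ∘ (f - f') = g ∘ f - g ∘ f'.
Proof. by rewrite -scaleN1r compDr compZr scaleN1r. Qed.
Lemma comp_suml x y z I (r : seq I) (P : pred I) (G : I -> hom y z) (f : hom x y) :
  (\sum_(i <- r | P i) G i) ∘ f = \sum_(i <- r | P i) (G i ∘ f).
Proof. by apply: (big_morph (fun g => g ∘ f)) => [g g'|]; [exact: compDl|exact: comp0l]. Qed.
Lemma comp_sumr x y z I (r : seq I) (P : pred I) (F : I -> hom x y) (g : hom y z) :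
  g ∘ (\sum_(i <- r | P i) F i) = \sum_(i <- r | P i) (g ∘ F i).
Proof. by apply: (big_morph (comp g)) => [f f'|]; [exact: compDr|exact: comp0r]. Qed.
Lemma tensDl x x' y y' (g : hom y y') (f f' : hom x x') : (f + f') ⊠ g = f ⊠ g + f' ⊠ g.
Proof. by have := tensm_linl hL g 1 f f'; rewrite !scale1r. Qed.
Lemma tensDr x x' y y' (f : hom x x') (g g' : hom y y') : f ⊠ (g + g') = f ⊠ g + f ⊠ g'.
Proof. by have := tensm_linr hL f 1 g g'; rewrite !scale1r. Qed.
Lemma tens0l x x' y y' (g : hom y y') : (0 : hom x x') ⊠ g = 0.
Proof. by apply: (addIr ((0 : hom x x') ⊠ g)); rewrite -tensDl !add0r. Qed.
Lemma tens0r x x' y y' (f : hom x x') : f ⊠ (0 : hom y y') = 0.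
Proof. by apply: (addIr (f ⊠ (0 : hom y y'))); rewrite -tensDr !add0r. Qed.
Lemma tensZl x x' y y' a (f : hom x x') (g : hom y y') : (a *: f) ⊠ g = a *: (f ⊠ g).
Proof. by have := tensm_linl hL g a f 0; rewrite tens0l !addr0. Qed.
Lemma tensZr x x' y y' a (f : hom x x') (g : hom y y') : f ⊠ (a *: g) = a *: (f ⊠ g).
Proof. by have := tensm_linr hL f a g 0; rewrite tens0r !addr0. Qed.
Lemma tens_suml x x' y y' I (r : seq I) (P : pred I) (F : I -> hom x x') (g : hom y y') :
  (\sum_(i <- r | P i) F i) ⊠ g = \sum_(i <- r | P i) (F i ⊠ g).
Proof. by apply: (big_morph (fun f => f ⊠ g)) => [f f'|]; [exact: tensDl|exact: tens0l]. Qed.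
Lemma tens_sumr x x' y y' I (r : seq I) (P : pred I) (F : I -> hom y y') (g : hom x x') :
  g ⊠ (\sum_(i <- r | P i) F i) = \sum_(i <- r | P i) (g ⊠ F i).
Proof. by apply: (big_morph (fun f => g ⊠ f)) => [f f'|]; [exact: tensDr|exact: tens0r]. Qed.

Section DirectSum.
Context (n : nat) (x : 'I_n -> L) (s : L) (i : forall k, hom (x k) s) (p : forall k, hom s (x k)).
Hypothesis ds : is_direct_sum i p.
Lemma dsum_ext_in y (f g : hom s y) : (forall k, f ∘ i k = g ∘ i k) -> f = g.
Proof.
case: ds => _ _ e h; rewrite -(c2 f) -(c2 g) -e !comp_sumr.
by apply: eq_bigr => k _; rewrite -!cA h.
Qed.
Lemma dsum_ext_out y (f g : hom y s) : (forall k, p k ∘ f = p k ∘ g) -> f = g.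
Proof.
case: ds => _ _ e h; rewrite -(c1 f) -(c1 g) -e !comp_suml.
by apply: eq_bigr => k _; rewrite !cA h.
Qed.
Lemma dsum_in_neq k l : l != k -> p k ∘ i l = 0.
Proof. by case: ds => _ h _ /eqP n0; apply: h => e; apply: n0. Qed.
Lemma dsum_inK k : p k ∘ i k = idm (x k).
Proof. by case: ds. Qed.
Lemma dsum_copair y (f : forall k, hom (x k) y) l : (\sum_k (f k ∘ p k)) ∘ i l = f l.
Proof.
rewrite comp_suml (bigD1 l) //= cA dsum_inK c2 big1 ?addr0 // => k nk.
by rewrite cA dsum_in_neq 1?eq_sym // comp0r.
Qed.
End DirectSum.
End LinearCategory.

(** The characteristic polynomial of a matrix of [T] has a root in [K]; the vector [v0] ensures that
    the dimension, hence the degree, is positive. *)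
Lemma closed_eigenvector (K : closedFieldType) (V : vectType K) (T : V -> V) (v0 : V) :
  linear T -> v0 != 0 -> exists (a : K) (v : V), v != 0 /\ T v = a *: v.
Proof.
move=> lT nv0.
pose T' : {linear V -> V} := HB.pack T (GRing.isLinear.Build K V V _ T lT).
pose phi := linfun T'.
pose e := vbasis {:V}; have be : basis_of {:V} e := vbasisP _.
pose A := passmx.mxof e e phi.
have d0 : (0 < \dim {:V})%N.
  rewrite lt0n dimv_eq0; apply: contra nv0 => /eqP f0.
  by rewrite -memv0 -f0 memvf.
have /closed_rootP[a] : size (char_poly A) != 1%N by rewrite size_char_poly eqSS -lt0n.
rewrite -eigenvalue_root_char => /eigenvalueP[v Av nv].
exists a, (passmx.vecof e v); split; first by rewrite passmx.vecof_eq0.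
have := congr1 (passmx.vecof e) Av.
rewrite passmx.mul_mxof passmx.rVofK // lfunE /= => ->.
by rewrite /passmx.vecof scaler_sumr; apply: eq_bigr => k _; rewrite mxE scalerA.
Qed.

(** * Schur's lemma *)

Section Schur.
Context (K : closedFieldType) (L : linear_monoidal K) (hA : is_abelian L).
Let hC := mon_is_cat (lm_monoidal L).
Let cA := compA hC.
Let c1 := comp1m hC.
Let c2 := compm1 hC.

Lemma kernel_mono (x y k : L) (f : hom x y) (m : hom k x) : is_kernel f m -> is_mono m.
Proof.
move=> [fm u] w g g' e.
have [h [_ uh]] := u w (m ∘ g) (etrans (esym (cA _ _ _)) (etrans (congr1 (fun t => t ∘ g) fm) (comp0l _ _))).
by rewrite -(uh g) // -(uh g').
Qed.
(** The kernel of [f] is a subobject of the simple [x]. If it is all of [x], then [f] vanishes; if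
    it is zero, then [f] is mono, hence an isomorphism as [y] is simple and [x] nonzero. *)
Lemma schur (x y : L) (f : hom x y) : is_simple x -> is_simple y -> f = 0 \/ is_iso f.
Proof.
move=> [nx sx] [ny sy]; have [k [m hm]] := ab_kernel hA f.
have [zk|[mV [e1 e2]]] := sx k m (kernel_mono hm); last first.
  by left; rewrite -(c2 f) -e2 -cA hm.1 comp0l.
right; suff mf : is_mono f by case: (sy x f mf).
move=> w u v e.
have e0 : f ∘ (u - v) = 0 by rewrite compBr e subrr.
have [t [et _]] := hm.2 _ _ e0.
apply/eqP; rewrite -subr_eq0 -et; apply/eqP.
by rewrite -(c1 t) zk !(comp0l, comp0r).
Qed.
(** Composition with [f] on the endomorphisms of [s] has an eigenvalue [a]; then [f - a *: idm s]
    kills a nonzero [v], so it is not invertible and must vanish. *)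
Lemma schur_scalar (s : L) (f : hom s s) : is_simple s -> exists a, f = a *: idm s.
Proof.
move=> ss; have [ns _] := ss.
have [||a [v [nv ev]]] := @closed_eigenvector K (hom s s) (comp f) (idm s).
- by move=> a u v; exact: (comp_linr (lm_linear L)).
- by apply/eqP.
exists a; have [/eqP|[g [gf _]]] := schur (f - a *: idm s) ss ss.
  by rewrite subr_eq0 => /eqP.
case/eqP: nv; rewrite -(c1 v) -gf cA compBl ev compZl c1 subrr comp0r.
by [].
Qed.
Lemma simple_iso (x y : L) (f : hom x y) : is_iso f -> is_simple x -> is_simple y.
Proof.
move=> [g [gf fg]] [nx sx]; split=> [zy|z m mm].
  by apply: nx; rewrite /is_zero -gf -(c1 f) zy comp0l comp0r.
have [|//|[h [hm mh]]] := sx z (g ∘ m).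
- by move=> w u v; rewrite !cA => e; apply: mm; apply: (cancelL hC fg).
- by left.
- right; exists (h ∘ g); split; first by rewrite cA.
  by apply: (cancelL hC fg); rewrite cA in mh; rewrite (compL3 hC _ mh) c1 c2.
Qed.
Lemma iso_sym (x y : L) : isomorphic x y -> isomorphic y x.
Proof. by move=> [f [g [e1 e2]]]; exists g, f. Qed.
Lemma iso_trans (x y z : L) : isomorphic x y -> isomorphic y z -> isomorphic x z.
Proof.
move=> [f [g fg]] [f' [g' fg']]; exists (f' ∘ f), (g ∘ g').
exact: (invs_comp hC fg fg').
Qed.
End Schur.

(** * Representability of linear presheaves on a finite semisimple category *)

Section Representability.
Context (K : closedFieldType) (B : linear_monoidal K).
Context (hss : is_semisimple B) (hfin : finitely_many_simples B).
Let hA := hss.1.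
Let hC := mon_is_cat (lm_monoidal B).
Let cA := compA hC.
Let c1 := comp1m hC.
Let c2 := compm1 hC.
Context (F : B -> vectType K) (act : forall w w' : B, hom w w' -> F w' -> F w).
Hypothesis act1 : forall w (u : F w), act (idm w) u = u.
Hypothesis actM : forall w w' w'' (g : hom w' w'') (f : hom w w') u,
  act (g ∘ f) u = act f (act g u).
Hypothesis act_linl : forall w w' (u : F w') a (f f' : hom w w'),
  act (a *: f + f') u = a *: act f u + act f' u.
Hypothesis act_linr : forall w w' (f : hom w w') a u u',
  act f (a *: u + u') = a *: act f u + act f u'.

Lemma act_suml w w' (u : F w') I (r : seq I) (P : pred I) (G : I -> hom w w') :
  act (\sum_(i <- r | P i) G i) u = \sum_(i <- r | P i) act (G i) u.
Proof.
apply: (big_morph (fun f => act f u)) => [f f'|].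
  by have := act_linl u 1 f f'; rewrite !scale1r.
apply: (addIr (act (0 : hom w w') u)).
by have := act_linl u 1 (0 : hom w w') 0; rewrite !scale1r !add0r => <-.
Qed.
Lemma act_sumr w w' (f : hom w w') I (r : seq I) (P : pred I) (G : I -> F w') :
  act f (\sum_(i <- r | P i) G i) = \sum_(i <- r | P i) act f (G i).
Proof.
apply: (big_morph (act f)) => [u u'|].
  by have := act_linr f 1 u u'; rewrite !scale1r.
apply: (addIr (act f 0)).
by have := act_linr f 1 0 0; rewrite !scale1r !add0r => <-.
Qed.
Lemma actZl w w' (u : F w') a (f : hom w w') : act (a *: f) u = a *: act f u.
Proof.
have := act_linl u a f 0; rewrite !addr0 => ->.
(* The empty case of [act_suml] says that the zero morphism acts as zero. *)
have := act_suml u [::] predT (fun i : unit => f); rewrite !big_nil => ->.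
by rewrite addr0.
Qed.

(** By Yoneda [u] is a transformation from [Hom(-, h)] to [F]; here it is required to be bijective
    at the single object [w], so that simple [w] can be treated first. *)
Let represents h (u : F h) w := forall f : F w, exists! g : hom w h, act g u = f.

Lemma represents_dsum h (u : F h) n (t : 'I_n -> B) w i p :
  @is_direct_sum K B n t w i p -> (forall k, represents u (t k)) -> represents u w.
Proof.
move=> ds rep f.
have ex k : exists g : hom (t k) h, act g u = act (i k) f.
  by have [g [eg _]] := rep k (act (i k) f); exists g.
pose g k := sval (cid (ex k)); have hg k : act (g k) u = act (i k) f := svalP (cid (ex k)).
have [_ _ eds] := ds.
exists (\sum_k (g k ∘ p k)); split=> [|g' eg'].
  rewrite act_suml -[RHS]act1 -eds act_suml; apply: eq_bigr => k _.
  by rewrite !actM hg.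
apply: (dsum_ext_in ds) => l; rewrite (dsum_copair ds).
have [g0 [_ ug0]] := rep l (act (i l) f).
by rewrite -(ug0 (g l)) // -(ug0 (g' ∘ i l)) // actM eg'.
Qed.

Lemma represents_iso h (u : F h) w w' : isomorphic w w' -> represents u w -> represents u w'.
Proof.
move=> [a [b [ba ab]]] rep f; have [g [eg ug]] := rep (act a f).
exists (g ∘ b); split=> [|g' eg']; first by rewrite actM eg -actM ab act1.
by rewrite (ug (g' ∘ a)) ?cA ?ab ?c2 // actM eg'.
Qed.

(** Take for [h] the sum of [dim F(s)] copies of [s], and for [u] the sum of the pullbacks of a
    basis of [F s] along the projections. By Schur a morphism from [s] to [h] is a family of
    scalars, the coordinates of the corresponding vector of [F s]. *)
Lemma isotypic (s : B) : is_simple s -> exists h (u : F h), represents u s /\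
  forall x, is_simple x -> ~ isomorphic x s -> forall g : hom x h, g = 0.
Proof.
move=> ss; pose e := vbasis {: F s}.
have [h [i [p ds]]] := ab_sums hA (fun l : 'I_(\dim {: F s}) => s).
exists h, (\sum_l act (p l) e`_l); split=> [f|x sx nx g]; last first.
  apply: (dsum_ext_out ds) => l; rewrite comp0r.
  by have [//|isog] := schur hA (p l ∘ g) sx ss; case: nx; exists (p l ∘ g).
have actE g (c : 'I_(\dim {: F s}) -> K) : (forall l, p l ∘ g = c l *: idm s) ->
    act g (\sum_l act (p l) e`_l) = \sum_l c l *: e`_l.
  move=> eg; rewrite act_sumr; apply: eq_bigr => l _.
  by rewrite -actM eg actZl act1.
exists (\sum_l coord e l f *: i l); split=> [|g' eg'].
  rewrite (actE _ (fun l => coord e l f)) => [|l].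
    by rewrite -coord_vbasis // memvf.
  rewrite comp_sumr (bigD1 l) //= compZr (dsum_inK ds) big1 ?addr0 // => k nk.
  by rewrite compZr (dsum_in_neq ds) ?scaler0.
have ex l : exists c, p l ∘ g' = c *: idm s := schur_scalar hA _ ss.
pose c l := sval (cid (ex l)); have hc l : p l ∘ g' = c l *: idm s := svalP (cid (ex l)).
apply: (dsum_ext_out ds) => l; rewrite hc comp_sumr (bigD1 l) //= compZr (dsum_inK ds).
rewrite big1 ?addr0 => [|k nk]; last by rewrite compZr (dsum_in_neq ds) ?scaler0.
by rewrite -eg' (actE _ c hc) coord_sum_free // (basis_free (vbasisP _)).
Qed.

(** The representing object is the sum of the objects of [isotypic] over the isomorphism classes of
    simple objects; an arbitrary [w] is reached by decomposing it into simple ones. *)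
Theorem linear_functor_representable :
  exists h (u : F h), forall w (f : F w), exists! g : hom w h, act g u = f.
Proof.
have [n [s hs]] := hfin.
(* The list [s] may contain repetitions and objects that are not simple; [I] selects the first
   representative of each class of simple objects. *)
pose I (j : 'I_n) := `[< is_simple (s j) /\ forall k : 'I_n, (k < j)%N -> ~ isomorphic (s j) (s k) >].
have In j : I j -> is_simple (s j) by move=> /asboolP[].
have Ineq j k : I j -> I k -> j != k -> ~ isomorphic (s j) (s k).
  move=> /asboolP[_ h] /asboolP[_ h'] njk e.
  case: (ltngtP j k) => [lt|lt|/val_inj e']; [exact: h' lt (iso_sym e)|exact: h lt e|].
  by rewrite e' eqxx in njk.
have Iex x : is_simple x -> exists2 j, I j & isomorphic x (s j).
  move=> sx; have [k0 e0] := hs x sx.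
  have ex : exists j, (j < n)%N && `[< exists k : 'I_n, nat_of_ord k = j /\ isomorphic x (s k)>].
    by exists k0; rewrite ltn_ord; apply/asboolP; exists k0.
  case: (ex_minnP ex) => m /andP[_ /asboolP[k [ek ik]]] mmin.
  exists k => //; apply/asboolP; split=> [|l lk il].
    by have [f isf] := ik; exact: simple_iso isf sx.
  have := mmin l; rewrite -ek (leqNgt k) lk => h; suff: false by [].
  apply: h; rewrite ltn_ord; apply/asboolP; exists l; split=> //.
  exact: iso_trans ik il.
have ex j : exists hu : {h : B & F h}, (I j -> represents (tagged hu) (s j)) /\
    forall x, is_simple x -> (I j -> ~ isomorphic x (s j)) -> forall g : hom x (tag hu), g = 0.
  case Ij: (I j); last first.
    (* An index outside [I] contributes a zero object, the empty sum. *)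
    have [z [i [p ds]]] := ab_sums hA (fun k : 'I_0 => s j).
    exists (Tagged F (0 : F z)); split=> // x _ _ g.
    by apply: (dsum_ext_out ds) => -[].
  have [h [u [r0 r1]]] := isotypic (In j Ij).
  exists (Tagged F u); split=> // x sx nx; exact: r1 sx (nx isT).
pose hj j := tag (sval (cid (ex j))); pose uj j : F (hj j) := tagged (sval (cid (ex j))).
have rep j : I j -> represents (uj j) (s j) := (svalP (cid (ex j))).1.
have homj j k : I k -> k != j -> forall g : hom (s k) (hj j), g = 0.
  move=> Ik nkj; apply: (svalP (cid (ex j))).2 (In k Ik) _ => Ij.
  exact: Ineq Ik Ij nkj.
have [h [i [p ds]]] := ab_sums hA hj.
exists h, (\sum_j act (p j) (uj j)) => w.
have [m [y [a [b [sy dsy]]]]] := hss.2 w.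
apply: (represents_dsum dsy) => l; have [k Ik /iso_sym ik] := Iex _ (sy l).
apply: (represents_iso ik) => f.
(* On [s k] only the component of index [k] counts, as [homj] kills the others. *)
have actE (g : hom (s k) h) : act g (\sum_j act (p j) (uj j)) = act (p k ∘ g) (uj k).
  rewrite act_sumr (bigD1 k) //= -actM big1 ?addr0 // => j nj.
  rewrite -actM (homj j k Ik _ (p j ∘ g)) 1?eq_sym //.
  by have := act_suml (uj j) [::] predT (fun i : unit => p j ∘ g); rewrite !big_nil.
have [g [eg ug]] := rep k Ik f.
exists (i k ∘ g); split=> [|g' eg'].
  by rewrite actE -cA (dsum_inK ds) c1.
apply: (dsum_ext_out ds) => j; case: (eqVneq k j) => [<-|nkj].
  rewrite -cA (dsum_inK ds) c1; apply: ug.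
  by rewrite -actE.
by rewrite (homj j k Ik nkj (p j ∘ _)) [RHS](homj j k Ik nkj).
Qed.
End Representability.

(** * Enrichments whose hom objects are sums of copies of the unit *)

Section EnrichedNaturality.
Context (V : mon_data) (hV : is_monoidal V).
Let hC := mon_is_cat hV.
Let cA := compA hC.
Let c1 := comp1m hC.
Let c2 := compm1 hC.

Lemma post_elt (E : ecat_data V) (a : V) (w x y : E) (g : hom one (ehom x y))
    (h : hom a (ehom w x)) : post w g ∘ h = ecomp w x y ∘ (g ⊠ h) ∘ lunV a.
Proof. by rewrite /post !cA -(lunV_nat hV) (tensML hV) c2 c1. Qed.
Lemma pre_elt (E : ecat_data V) (a : V) (w x y : E) (f : hom one (ehom x y))
    (h : hom a (ehom y w)) : pre w f ∘ h = ecomp x y w ∘ (h ⊠ f) ∘ runV a.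
Proof. by rewrite /pre !cA -(runV_nat hV) (tensML hV) c2 c1. Qed.
Lemma post_under (E : ecat_data V) (w x y : underlying E) (g : hom x y) (f : hom w x) :
  post w g ∘ f = comp (c := underlying E) g f.
Proof. exact: post_elt. Qed.
Lemma pre_under (E : ecat_data V) (w x y : underlying E) (g : hom x y) (f : hom w x) :
  pre y f ∘ g = comp (c := underlying E) g f.
Proof. by rewrite pre_elt -(lunV_runV hV). Qed.

(** Ordinary naturality at [f] is the enriched square precomposed with [f], seen as a morphism from
    the unit to the hom object. *)
Lemma is_enatural_of_square (D E : ecat_data V) (F G : efunctor_data D E)
    (xi : forall x : D, hom one (ehom (F x) (G x))) :
  (forall x y : D, post (F x) (xi y) ∘ efhom F x y = pre (G y) (xi x) ∘ efhom G x y) ->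
  is_enatural xi.
Proof.
move=> sq; split=> // x y f; rewrite -post_under -pre_under /=.
by rewrite -!cA sq.
Qed.
End EnrichedNaturality.

(** * Testing morphisms on elements of sums of copies of the unit *)

Section Spanning.
Context (K : fieldType) (B : linear_monoidal K).
Let hM := lm_monoidal B.
Let hC := mon_is_cat hM.
Let cA := compA hC.
Let c1 := comp1m hC.
Let c2 := compm1 hC.

(** Joint epimorphy of [S] is witnessed by a decomposition of the identity of [a], a form that
    passes to tensor products ([spans_tens]). *)
Definition spans (x a : B) (S : hom x a -> Prop) :=
  exists (I : finType) (s : I -> hom x a) (q : I -> hom a x),
    (forall k, S (s k)) /\ \sum_k (s k ∘ q k) = idm a.
Lemma spans_ext (x a y : B) (S : hom x a -> Prop) (f g : hom a y) : spans S ->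
  (forall s, S s -> f ∘ s = g ∘ s) -> f = g.
Proof.
move=> [I [s [q [Ss e]]]] h; rewrite -(c2 f) -(c2 g) -e !comp_sumr.
by apply: eq_bigr => k _; rewrite -!cA h.
Qed.
Lemma spans_tens (x a y b : B) (S : hom x a -> Prop) (T : hom y b -> Prop) :
  spans S -> spans T -> spans (fun f => exists s t, [/\ S s, T t & f = s ⊠ t]).
Proof.
move=> [I [s [q [Ss es]]]] [J [t [r [Tt et]]]].
exists (I * J)%type, (fun k => s k.1 ⊠ t k.2), (fun k => q k.1 ⊠ r k.2); split.
  by move=> k; exists (s k.1), (t k.2).
rewrite -(tensm1 hM) -es -et tens_suml.
rewrite -(pair_bigA _ (fun i j => (s i ⊠ t j) ∘ (q i ⊠ r j))) /=.
apply: eq_bigr => i _; rewrite tens_sumr; apply: eq_bigr => j _.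
by rewrite (tensmM hM).
Qed.

Definition unital (h : B) := exists (n : nat) (i : 'I_n -> hom one h) (p : 'I_n -> hom h one),
  @is_direct_sum K B n (fun=> one) h i p.
Lemma unital_spans h : unital h -> spans (fun _ : hom one h => True).
Proof. by move=> [n [i [p [_ _ e]]]]; exists 'I_n, i, p. Qed.

Lemma elt_ext (h y : B) (f g : hom h y) : unital h ->
  (forall e : hom one h, f ∘ e = g ∘ e) -> f = g.
Proof. by move=> /unital_spans uh e; apply: (spans_ext uh) => s _. Qed.
Lemma elt_ext2 (h h' y : B) (f g : hom (h ⊗ h') y) : unital h -> unital h' ->
  (forall (e : hom one h) (e' : hom one h'), f ∘ (e ⊠ e') = g ∘ (e ⊠ e')) -> f = g.
Proof.
move=> /unital_spans uh /unital_spans uh' e.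
by apply: (spans_ext (spans_tens uh uh')) => _ [s [t [_ _ ->]]].
Qed.
Lemma elt_ext3 (h h' h'' y : B) (f g : hom ((h ⊗ h') ⊗ h'') y) :
  unital h -> unital h' -> unital h'' ->
  (forall (e : hom one h) (e' : hom one h') (e'' : hom one h''),
     f ∘ ((e ⊠ e') ⊠ e'') = g ∘ ((e ⊠ e') ⊠ e'')) -> f = g.
Proof.
move=> /unital_spans uh /unital_spans uh' /unital_spans uh'' e.
apply: (spans_ext (spans_tens (spans_tens uh uh') uh'')).
by move=> _ [_ [t [[s [s' [_ _ ->]]] _ ->]]].
Qed.
Lemma elt_ext4 (a b d e y : B) (f g : hom ((a ⊗ b) ⊗ (d ⊗ e)) y) :
  unital a -> unital b -> unital d -> unital e ->
  (forall (s : hom one a) (t : hom one b) (u : hom one d) (v : hom one e),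
     f ∘ ((s ⊠ t) ⊠ (u ⊠ v)) = g ∘ ((s ⊠ t) ⊠ (u ⊠ v))) -> f = g.
Proof.
move=> /unital_spans ua /unital_spans ub /unital_spans ud /unital_spans ue h.
apply: (spans_ext (spans_tens (spans_tens ua ub) (spans_tens ud ue))).
move=> _ [_ [_ [[s [t [_ _ ->]]] [u [v [_ _ ->]]] ->]]]; exact: h.
Qed.
End Spanning.

(** * Enriched laws deduced from those of the underlying category *)

Section Discrete.
Context (K : fieldType) (B : linear_braided K).
Let hV := lm_monoidal B.
Let hC := mon_is_cat hV.
Let cA := compA hC.
Let c1 := comp1m hC.
Let c2 := compm1 hC.
Let c := lb_braiding B.
Let hc := lb_braidingP B.

(** By naturality, braidings therefore act on pairs of elements as a plain exchange, and the
    braiding of [B] disappears from every law tested on elements. *)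
Lemma braid_one_one : braid c one one = idm _.
Proof. by rewrite (braid_oneE_l hV hc) (lun_run hV) (runK hV). Qed.
Lemma braidV_one_one : braidV c one one = idm _.
Proof. by have := braidK hc one one; rewrite -/c braid_one_one c2. Qed.
Lemma middle_ones : middle one one (braidV c one one) = idm _.
Proof.
rewrite /middle braidV_one_one (tensm1 hV) c1 (assocVK hV) (tensm1 hV) c1.
exact: (assocK hV).
Qed.
Lemma middle_elts (a b d e : B) (s : hom one a) (t : hom one b) (u : hom one d) (v : hom one e) :
  middle a e (braidV c d b) ∘ ((s ⊠ t) ⊠ (u ⊠ v)) = (s ⊠ u) ⊠ (t ⊠ v).
Proof. by rewrite (middle_nat hV hc) middle_ones c2. Qed.
Lemma braid_elts (a b : B) (s : hom one a) (t : hom one b) :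
  braid c a b ∘ (s ⊠ t) = t ⊠ s.
Proof. by rewrite (braid_nat hc) braid_one_one c2. Qed.
Section ECat.
Context (E : emon_data B) (hU : is_monoidal (underlying_mon E)).
Hypothesis un : forall x y : E, unital (ehom x y).
Let hUC := mon_is_cat hU.

Lemma ecomp_elts (x y z : E) (g : hom one (ehom y z)) (f : hom one (ehom x y)) :
  ecomp x y z ∘ (g ⊠ f) = (comp (c := underlying_mon E) g f : hom one (ehom x z)) ∘ lun one.
Proof. by rewrite /= !cA (lunK hV) c2. Qed.
Lemma etensh_elts (x x' y y' : E) (f : hom one (ehom x x')) (g : hom one (ehom y y')) :
  etensh x x' y y' ∘ (f ⊠ g)
  = (tensm (m := underlying_mon E) f g : hom one (ehom (etens x y) (etens x' y'))) ∘ lun one.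
Proof. by rewrite /= !cA (lunK hV) c2. Qed.

Lemma tens_scal_l (a b : B) (s : hom one a) (t : hom one b) :
  (s ∘ lun one) ⊠ t = (s ⊠ t) ∘ (lun one ▷ one).
Proof. by rewrite -(tensmM hV) c2. Qed.
Lemma tens_scal_r (a b : B) (s : hom one a) (t : hom one b) :
  s ⊠ (t ∘ lun one) = (s ⊠ t) ∘ (one ◁ lun one).
Proof. by rewrite -(tensmM hV) c2. Qed.
Lemma tens_scal2 (a b : B) (s : hom one a) (t : hom one b) :
  (s ∘ lun one) ⊠ (t ∘ lun one) = (s ⊠ t) ∘ (lun one ⊠ lun one).
Proof. exact: (tensmM hV). Qed.
Lemma scal_assoc : (one ◁ lun one) ∘ assoc one one one = lun (one : B) ▷ one.
Proof. by rewrite (triangle hV) -(lun_run hV). Qed.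

Lemma discrete_ecat : is_ecat E.
Proof.
split=> [x y z w|x y|x y].
- apply: elt_ext3 => // h g f; rewrite !cA -!(tensmM hV) c1 ecomp_elts.
  rewrite (assoc_nat hV) (tensML hV) c1 ecomp_elts tens_scal_l tens_scal_r.
  rewrite !cA scal_assoc -!(cA (ecomp _ _ _)) !ecomp_elts.
  by rewrite (compA hUC) !cA.
- apply: (cancelR hC (lunK hV _)); apply: elt_ext => // e.
  rewrite (lunVK hV) c1 !cA -(lunV_nat hV) (tensML hV) c1 c2.
  exact: (comp1m hUC).
- apply: (cancelR hC (runK hV _)); apply: elt_ext => // e.
  rewrite (runVK hV) c1 !cA -(runV_nat hV) (tensML hV) c1 c2 -(lunV_runV hV).
  exact: (compm1 hUC).
Qed.
(** Every enriched law is an equality of morphisms out of a tensor product of hom objects. Tested on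
    elements, it is the matching law of the underlying monoidal category, up to unit
    isomorphisms. *)
Lemma discrete_emonoidal : is_emonoidal c E.
Proof.
split.
- exact: discrete_ecat.
- split=> [[x y]|[x x'] [y y'] [z z']] /=.
    exact: (tensm1 hU).
  apply: elt_ext4 => // s t u v; rewrite (cA (etensh _ _ _ _)) (cA (_ ⊠ _)) middle_elts (cA (ecomp _ _ _)) -!(tensmM hV) !ecomp_elts !etensh_elts.
  rewrite !tens_scal2 -!(cA (etensh _ _ _ _)) -!(cA (ecomp _ _ _)) etensh_elts ecomp_elts.
  by rewrite (tensmM hU).
- apply: (is_enatural_of_square hV) => x y; apply: elt_ext => // e.
  by rewrite cA (fmap_ltens hV) (post_under hV) cA c1 (pre_under hV) (lun_nat hU).
- apply: (is_enatural_of_square hV) => x y; apply: elt_ext => // e.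
  by rewrite cA (fmap_rtens hV) (post_under hV) cA c1 (pre_under hV) (run_nat hU).
- apply: (is_enatural_of_square hV) => -[[x x'] x''] [[y y'] y'']; apply: elt_ext3 => // e e' e''.
  have eL : efhom (etens3l c E) (x, x', x'') (y, y', y'') ∘ ((e ⊠ e') ⊠ e'')
    = (tensm (m := underlying_mon E) (tensm (m := underlying_mon E) e e') e'' : hom one _)
      ∘ lun one ∘ (lun one ▷ one).
    rewrite /= (cA (etensh _ _ _ _)) -(tensmM hV) c1 etensh_elts tens_scal_l.
    by rewrite -(cA (etensh _ _ _ _)) etensh_elts cA.
  have eR : efhom (etens3r c E) (x, x', x'') (y, y', y'') ∘ ((e ⊠ e') ⊠ e'')
    = (tensm (m := underlying_mon E) e (tensm (m := underlying_mon E) e' e'') : hom one _)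
      ∘ lun one ∘ (lun one ▷ one).
    rewrite /= (cA (etensh _ _ _ _)) (cA (_ ⊠ _)) (assoc_nat hV) (tensML hV) c1 etensh_elts.
    rewrite tens_scal_r (cA (_ ⊠ _)) scal_assoc.
    by rewrite -(cA (etensh _ _ _ _)) etensh_elts cA.
  rewrite (cA (post _ _)) (cA (pre _ _)) eL eR -(cA (post _ _)) -(cA (pre _ _)).
  by rewrite (post_under hV) (pre_under hV) (Defs.assoc_nat hU).
- exact: hU.
Qed.
End ECat.

Lemma discrete_ebraided (E : ebraided_data B) :
  is_monoidal (underlying_mon E) -> is_braiding (underlying_braiding E) ->
  (forall x y : E, unital (ehom x y)) -> is_ebraided c E.
Proof.
move=> hU hb un; split=> //.
- exact: discrete_emonoidal.
- move=> [x x'] [y y']; apply: elt_ext2 => // e e' /=.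
  by rewrite !cA !braid_elts.
- apply: (is_enatural_of_square hV) => -[x x'] [y y']; apply: elt_ext2 => // e e'.
  have eR : efhom (erev (etens_functor c E)) (x, x') (y, y') ∘ (e ⊠ e')
    = (tensm (m := underlying_mon E) e' e : hom one _) ∘ lun one.
    by rewrite /= cA braid_elts etensh_elts.
  rewrite (cA (post _ _)) (cA (pre _ _)) eR etensh_elts -(cA (post _ _)) -(cA (pre _ _)).
  by rewrite (post_under hV) (pre_under hV) (braid_nat hb).
Qed.

Lemma discrete_emonfunctor (D E : emon_data B) (F : emonfunctor_data D E) :
  (forall x y : D, unital (ehom x y)) -> is_monfunctor (underlying_monfunctor F) ->
  is_emonfunctor c F.
Proof.
move=> un hF; split=> //.
- split=> [x|x y z]; first exact: (fmap1 (mf_is_functor hF)).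
  apply: elt_ext2 => // e e'; rewrite cA ecomp_elts [in RHS]cA -(tensmM hV) ecomp_elts -cA.
  by rewrite [efhom F _ _ ∘ _](fmapM (mf_is_functor hF) e e').
- apply: (is_enatural_of_square hV) => -[x x'] [y y']; apply: elt_ext2 => // e e'.
  rewrite (cA (post _ _)) (cA (pre _ _)) /= (cA (etensh _ _ _ _)) (cA (efhom _ _ _)).
  rewrite -(tensmM hV) !etensh_elts -!(cA (efhom _ _ _)) -(cA (post _ _)) -(cA (pre _ _)).
  rewrite (post_under hV) (pre_under hV).
  by congr (_ ∘ _); have := nu_nat hF e e'; rewrite /= -(cA (efhom F _ _) (etensh _ _ _ _)).
Qed.

(** The inverse is assembled from the preimages of the inclusions of the summands of [h']. *)
Lemma elt_iso (h h' : B) (f : hom h h') : unital h -> unital h' ->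
  bijective (comp f : hom one h -> hom one h') -> is_iso f.
Proof.
move=> uh uh' [g gK Kg]; have [n [i [p ds]]] := uh'.
have fg l : f ∘ (\sum_k (g (i k) ∘ p k)) ∘ i l = i l.
  by rewrite (dsum_copair ds (fun k => g (i k))) Kg.
have e1 : f ∘ (\sum_k (g (i k) ∘ p k)) = idm h'.
  by apply: (dsum_ext_in ds) => l; rewrite cA fg c1.
exists (\sum_k (g (i k) ∘ p k)); split=> //.
by apply: elt_ext => // e; apply: (can_inj gK); rewrite cA -cA -cA e1 !c1.
Qed.
End Discrete.

(** The morphisms satisfying [P] form a linear subfunctor of [Hom(-, h)], and a representing object
    is the largest subobject of [h] whose inclusion satisfies [P]. Equalizers and intersections are
    obtained in this way. *)
Lemma sieve_representable (K : closedFieldType) (B : linear_monoidal K) (hss : is_semisimple B)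
    (hfin : finitely_many_simples B) (h : B) (P : forall w, hom w h -> Prop) :
  (forall w, P w 0) ->
  (forall w a (f g : hom w h), P w f -> P w g -> P w (a *: f + g)) ->
  (forall w w' (f : hom w h) (r : hom w' w), P w f -> P w' (f ∘ r)) ->
  exists q (m : hom q h), P q m /\ forall w (f : hom w h), P w f -> exists! u, m ∘ u = f.
Proof.
move=> P0 PL Pc; have hC := mon_is_cat (lm_monoidal B).
pose S w := sval (cid (vspace_of_pred (P0 w) (PL w))).
have SP w f : f \in S w <-> P w f := svalP (cid (vspace_of_pred (P0 w) (PL w))) f.
have Pv w (f : subvs_of (S w)) : P w (vsval f) := (SP w _).1 (subvsP f).
pose act w w' (r : hom w w') (f : subvs_of (S w')) : subvs_of (S w) :=
  Subvs ((SP w _).2 (Pc _ _ _ r (Pv _ f))).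
have [||||q [m um]] := @linear_functor_representable K B hss hfin
   (fun w => subvs_of (S w) : vectType K) act.
- by move=> w u; apply: val_inj; exact: (compm1 hC).
- by move=> w w' w'' g f u; apply: val_inj; rewrite /= (compA hC).
- by move=> w w' u a f f'; apply: val_inj; rewrite /= compDr compZr.
- by move=> w w' f a u u'; apply: val_inj; rewrite /= compDl compZl.
exists q, (vsval m); split=> [|w f Pf]; first exact: Pv.
have [u [eu uu]] := um w (Subvs ((SP w f).2 Pf)).
exists u; split=> [|u' eu']; first exact: (congr1 vsval eu).
by apply: uu; apply: val_inj.
Qed.

(** * Transparency of the universal object *)

Section Transparency.
Context (V Z : mon_data) (hV : is_monoidal V) (hZ : is_monoidal Z).
Context (c : braiding V) (hc : is_braiding c) (d : braiding Z) (hd : is_braiding d).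
Context (psi : monfunctor_data V Z) (hpsi : is_monfunctor psi).
Hypothesis hpsi_br : preserves_braiding c d psi.
Let vC := mon_is_cat hV.
Let zC := mon_is_cat hZ.
Let zA := compA zC.
Let z2 := compm1 zC.
Let vA := compA vC.
Let hF := mf_is_functor hpsi.

Lemma double_braid_sym (M X : Z) : braid d X M ∘ braid d M X = idm _ ->
  braid d M X ∘ braid d X M = idm _.
Proof.
move=> e; apply: (cancelL zC (a := braid d X M) (aV := braidV d X M)).
  exact: braidK.
by rewrite (compKL zC _ e) z2.
Qed.
(** The hexagons split the loop of [M] around [H ⊗ X] into loops around [H] and around [X]; the
    latter is trivial by hypothesis. *)
Lemma double_braid_tens (M H X : Z) : braid d X M ∘ braid d M X = idm _ ->
  braid d (H ⊗ X) M ∘ braid d M (H ⊗ X)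
  = assoc M H X ∘ ((braid d H M ∘ braid d M H) ▷ X) ∘ assocV M H X.
Proof.
move=> e; apply: (cancelR zC (assocVK hZ M H X)).
rewrite (braid_tens hZ hd) /hb_tens !zA (hexagon1 hd).
rewrite (compKL zC _ (tensmlK hZ _ e)) (compKL zC _ (assocK hZ _ _ _)).
by rewrite (tensmr hZ) (assocK hZ) z2.
Qed.

Section Universal.
Context (h : V) (X Y : Z) (f : hom (psi h ⊗ X) Y).
Hypothesis hX : forall v, braid d X (psi v) ∘ braid d (psi v) X = idm _.
Hypothesis hY : forall v, braid d Y (psi v) ∘ braid d (psi v) Y = idm _.
Hypothesis f_inj : forall w (r r' : hom w h),
  f ∘ (fmap psi r ▷ X) = f ∘ (fmap psi r' ▷ X) -> r = r'.

Let Phi v (A : hom (v ⊗ h) (v ⊗ h)) : hom (psi (v ⊗ h) ⊗ X) (psi v ⊗ Y) :=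
  (psi v ◁ f) ∘ assoc _ _ _ ∘ ((nuV psi v h ∘ fmap psi A) ▷ X).
(** As [psi] is braided, the left side carries the double braiding of [psi v] with [psi h]. By [hX]
    this is the double braiding with [psi h ⊗ X], which naturality moves through [f] to [Y], where
    it is trivial by [hY]. *)
Lemma Phi_double v : Phi (braid c h v ∘ braid c v h) = Phi (idm _).
Proof.
have e : (psi v ◁ f) ∘ assoc _ _ _ ∘ ((braid d (psi h) (psi v) ∘ braid d (psi v) (psi h)) ▷ X)
   = (psi v ◁ f) ∘ assoc _ _ _.
  apply: (cancelR zC (assocK hZ (psi v) (psi h) X)); rewrite !zA -(double_braid_tens _ (hX v)).
  rewrite (compL zC _ (esym (braid_nat hd f (idm (psi v))))) !zA -(braid_nat hd (idm (psi v)) f).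
  by rewrite (compKL zC _ (hY v)) (assocVK hZ) z2.
have e2 : nuV psi v h ∘ fmap psi (braid c h v ∘ braid c v h)
   = (braid d (psi h) (psi v) ∘ braid d (psi v) (psi h)) ∘ nuV psi v h.
  apply: (cancelR zC (nuI hpsi v h).2); rewrite !zA (nuI hpsi v h).1 z2.
  rewrite (fmapM (mf_is_functor hpsi)) !zA hpsi_br (compL zC _ (hpsi_br _ _)) !zA.
  by rewrite (compKL zC _ (nuI hpsi v h).1).
by rewrite /Phi e2 (tensmr hZ) (compL3 zC _ e) !zA (fmap1 (mf_is_functor hpsi)) z2.
Qed.

(** The output [v] of [A] is contracted against [v']; the result is a morphism to [h], to which
    [f_inj] can be applied. *)
Let red v v' (t : hom (v' ⊗ v) one) (A : hom (v ⊗ h) (v ⊗ h)) : hom (v' ⊗ v ⊗ h) h :=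
  lun h ∘ (t ▷ h) ∘ assocV v' v h ∘ (v' ◁ A).
(** The point is that the right side depends on [A] only through [Phi A]. *)
Lemma red_Phi v v' (t : hom (v' ⊗ v) one) (A : hom (v ⊗ h) (v ⊗ h)) :
  f ∘ (fmap psi (red t A) ▷ X)
  = lun Y ∘ ((mu psi ∘ fmap psi t ∘ nu psi v' v) ▷ Y) ∘ assocV _ _ _
    ∘ (psi v' ◁ Phi A) ∘ assoc _ _ _ ∘ (nuV psi v' (v ⊗ h) ▷ X).
Proof.
set tau := (mu psi ∘ _).
have e : fmap psi (red t A) = lun (psi h) ∘ (tau ▷ psi h) ∘ assocV _ _ _
    ∘ (psi v' ◁ (nuV psi v h ∘ fmap psi A)) ∘ nuV psi v' (v ⊗ h).
  have e1 : fmap psi (lun h ∘ (t ▷ h))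
      = lun (psi h) ∘ ((mu psi ∘ fmap psi t) ▷ psi h) ∘ nuV psi (v' ⊗ v) h.
    rewrite (fmapM hF) -(monf_nuV_lun hZ hpsi) !zA.
    have := monf_nuV_nat hZ hpsi t (idm h); rewrite (fmap1 hF) => <-.
    by rewrite (tensmr hZ) !zA.
  have e3 : nuV psi (v' ⊗ v) h ∘ fmap psi (assocV v' v h)
      = (nu psi v' v ▷ psi h) ∘ assocV _ _ _ ∘ (psi v' ◁ nuV psi v h) ∘ nuV psi v' (v ⊗ h).
    apply: (cancelR zC (a := fmap psi (assoc v' v h)) (aV := fmap psi (assocV v' v h))).
      by rewrite -(fmapM hF) (assocVK hV) (fmap1 hF).
    rewrite !zA -(fmapM hF) (assocK hV) (fmap1 hF) z2 (monf_nuV_assoc hZ hpsi).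
    rewrite (compKL zC _ (assocK hZ _ _ _)).
    by rewrite (compKL zC _ (tensmrK hZ _ (nuI hpsi v' v).2)).
  have e4 := monf_nuV_nat hZ hpsi (idm v') A; rewrite (fmap1 hF) in e4.
  rewrite /red -(vA (lun h)) (fmapM hF) e1 (fmapM hF) !zA (compL zC _ e3) !zA -e4.
  by rewrite /tau (tensml hZ) !(tensmr hZ) !zA.
rewrite e /Phi; clearbody tau.
rewrite !(tensmr hZ) !(tensml hZ) !zA.
rewrite (compL zC _ (esym (assocV_natl hZ (psi v') (psi v) f))) !zA.
rewrite (compL zC _ (slide hZ tau f)) !zA (compL zC _ (lun_nat hZ f)) !zA; congr (_ ∘ _).
rewrite -(lun_tens hZ (psi h) X) !zA.
do 2![rewrite (compL zC _ (esym (assoc_nat hZ (idm (psi v')) _ (idm X)))) !zA].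
rewrite (compL3 zC _ (esym (pent3 hZ (psi v') (psi v) (psi h) X))) !zA.
rewrite (compL zC _ (esym (assoc_natr hZ (psi h) X tau))) !zA.
by rewrite !(tensmr hZ) !zA.
Qed.
(** The zigzag identity undoes the contraction, so [A] is determined by [red ev A]. By [redE] only
    the case of the identity has to be computed. *)
Lemma dual_red v v' ev coev (A : hom (v ⊗ h) (v ⊗ h)) :
  run v ∘ (v ◁ ev) ∘ assoc v v' v ∘ (coev ▷ v) ∘ lunV v = idm v ->
  (v ◁ red ev A) ∘ assoc v v' (v ⊗ h) ∘ (coev ▷ (v ⊗ h)) ∘ lunV (v ⊗ h) = A.
Proof.
have redE B : (v ◁ red ev B) = (v ◁ red ev (idm _)) ∘ (v ◁ v' ◁ B).
  by rewrite /red -(tensml hV) !vA (tensm1 hV) (comp1m vC).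
move=> zz; rewrite redE !vA.
rewrite (compL vC _ (esym (assoc_natl hV v v' A))) !vA.
rewrite (compL vC _ (esym (slide hV coev A))) !vA (lunV_nat hV).
suff e : (v ◁ red ev (idm _)) ∘ assoc v v' (v ⊗ h) ∘ (coev ▷ (v ⊗ h)) ∘ lunV (v ⊗ h) = idm _.
  by rewrite (compL4 vC _ e) (comp1m vC).
rewrite /red (tensm1 hV) (compm1 vC) !(tensml hV) !vA.
rewrite (compL vC _ (pent4 hV v v' v h)) !vA.
rewrite -(lunV_tens hV v h) (compL vC _ (esym (assocV_natr hV v h coev))) !vA (compKL vC _ (assocK hV _ _ _)).
rewrite (compL vC _ (esym (assoc_nat hV (idm v) ev (idm h)))) !vA (compL vC _ (triangle hV v h)).
by rewrite -!(tensmr hV) zz (tensm1 hV).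
Qed.

Theorem universal_transparent v v' (ev : hom (v' ⊗ v) one) (coev : hom one (v ⊗ v')) :
  run v ∘ (v ◁ ev) ∘ assoc v v' v ∘ (coev ▷ v) ∘ lunV v = idm v ->
  braid c h v ∘ braid c v h = idm (v ⊗ h).
Proof.
move=> zz; rewrite -(dual_red (braid c h v ∘ _) zz) -[RHS](dual_red _ zz).
suff -> : red ev (braid c h v ∘ braid c v h) = red ev (idm _) by [].
by apply: f_inj; rewrite !red_Phi Phi_double.
Qed.
End Universal.
End Transparency.

(** * Transparent objects of a nondegenerate category *)

Section Nondegenerate.
Context (K : fieldType) (B : linear_braided K).
Let hM := lm_monoidal B.
Let hC := mon_is_cat hM.
Let cA := compA hC.
Let c1 := comp1m hC.
Let c2 := compm1 hC.
Let hb := lb_braidingP B.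

Lemma transparent_retract (s h : B) (i : hom s h) (p : hom h s) :
  p ∘ i = idm s -> is_transparent h -> is_transparent s.
Proof.
move=> pi th v; rewrite /double_braiding_trivial.
have th' := th v; rewrite /double_braiding_trivial in th'.
apply: (cancelR hC (a := p ▷ v) (aV := i ▷ v)); first exact: tensmrK.
rewrite cA (braid_nat hb) (compL hC _ (braid_nat hb _ _)) !cA th'.
by rewrite c1 c2.
Qed.
(** Each simple summand is a retract of [h], hence transparent, hence isomorphic to the unit. *)
Lemma transparent_unital (h : B) : is_semisimple B -> is_nondegenerate B ->
  is_transparent h -> unital h.
Proof.
move=> hss [_ nd] th; have [n [s [i [p [ss ds]]]]] := hss.2 h.
have st k : isomorphic (s k) one.
  by apply: nd (ss k) _; apply: transparent_retract (dsum_inK ds k) th.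
pose a k := sval (cid (st k)); have ha k : is_iso (a k) := svalP (cid (st k)).
pose b k := sval (cid (ha k)); have hab k : inverses (a k) (b k) := svalP (cid (ha k)).
exists n, (fun k => i k ∘ b k), (fun k => a k ∘ p k); split=> [k|k l nkl|].
- by rewrite !cA (compKL hC _ (dsum_inK ds k)) (hab k).2.
- rewrite !cA (compL hC _ (dsum_in_neq ds (k := k) (l := l) _)) ?comp0l ?comp0r //.
  by rewrite eq_sym; apply/eqP.
- case: ds => _ _ <-; apply: eq_bigr => k _.
  by rewrite !cA (compKL hC _ (hab k).1).
Qed.
End Nondegenerate.

Lemma chooseP (T : Type) (x0 : T) (P : T -> Prop) : (exists x, P x) -> P (choose x0 P).
Proof. by move=> h; rewrite /choose; case: pselect => // h'; exact: (svalP (cid h')). Qed.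

(** * Equivalences with [vect_enriched] *)

Section VectEnriched.
Context (K : closedFieldType) (B : linear_braided K).
Context (hA : is_abelian B) (h1 : is_simple (one : B)).
Let hM := lm_monoidal B.
Let hC := mon_is_cat hM.
Let cA := compA hC.
Let c1 := comp1m hC.
Let c2 := compm1 hC.

Lemma idm_one_scale_inj (a b : K) : a *: idm (one : B) = b *: idm one -> a = b.
Proof.
move=> /eqP; rewrite -subr_eq0 -scalerBl scaler_eq0 subr_eq0 => /orP[/eqP //|/eqP z].
by case: h1.
Qed.

(** The values of [T] on the inclusions define [f]. By Schur each coordinate [p k ∘ e] is a scalar,
    so linearity gives the value at every [e]. *)
Lemma elt_map (h h' : B) (T : hom one h -> hom one h') : unital h -> linear T ->
  exists f : hom h h', forall e, f ∘ e = T e.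
Proof.
move=> [n [i [p ds]]] lT.
pose T' : {linear hom one h -> hom one h'} := HB.pack T (GRing.isLinear.Build K _ _ _ T lT).
exists (\sum_k (T (i k) ∘ p k)) => e.
have [_ _ eds] := ds; rewrite -[e in RHS]c1 -eds !comp_suml -[T]/(T' : _ -> _) linear_sum.
apply: eq_bigr => k _; rewrite !cA; have [a ->] := schur_scalar hA (p k ∘ e) h1.
by rewrite !compZr !c2 linearZ.
Qed.

Section Copower.
Context (U : vectType K).
Lemma copies_sum n : @is_direct_sum K B n (fun=> one) (projT1 (copies B n))
  (projT2 (copies B n)).1 (projT2 (copies B n)).2.
Proof.
have [s [i [p ds]]] := ab_sums hA (fun _ : 'I_n => (one : B)).
exact: (@chooseP (copies_data B n) _
  (fun s => @is_direct_sum K B n (fun=> one) (projT1 s) (projT2 s).1 (projT2 s).2)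
  (ex_intro _ (existT _ s (i, p)) ds)).
Qed.
Lemma copower_unital : unital (copower B U).
Proof. by exists (\dim {:U}), (@cop_in _ _ _), (@cop_out _ _ _); exact: copies_sum. Qed.
Lemma cop_outK (k : 'I_(\dim {:U})) u : cop_out B k ∘ cop_elt B u = coord (vbasis {:U}) k u *: idm one.
Proof.
have ds := copies_sum (\dim {:U}).
rewrite /cop_elt comp_sumr (bigD1 k) //= compZr [cop_out _ _ ∘ _](dsum_inK ds) big1 ?addr0 // => l nl.
by rewrite compZr [cop_out _ _ ∘ _](dsum_in_neq ds) ?scaler0.
Qed.
Lemma cop_elt_linear : linear (@cop_elt K B U).
Proof.
move=> a u v; rewrite /cop_elt scaler_sumr -big_split /=; apply: eq_bigr => k _.
by rewrite linearP scalerDl scalerA.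
Qed.
Lemma cop_elt_inj : injective (@cop_elt K B U).
Proof.
move=> u v e; rewrite (coord_vbasis (memvf u)) (coord_vbasis (memvf v)).
apply: eq_bigr => k _; congr (_ *: _); apply: idm_one_scale_inj.
by rewrite -!cop_outK e.
Qed.
Lemma cop_elt_surj (e : hom one (copower B U)) : exists u, cop_elt B u = e.
Proof.
have ex k : exists a, cop_out B k ∘ e = a *: idm one := schur_scalar hA _ h1.
exists (\sum_k sval (cid (ex k)) *: (vbasis {:U})`_k).
apply: (dsum_ext_out (copies_sum (\dim {:U}))) => k; rewrite [LHS]cop_outK.
rewrite coord_sum_free ?(basis_free (vbasisP _)) //.
exact: (esym (svalP (cid (ex k)))).
Qed.
(** The inverse of [cop_elt], identifying elements of [U 1] with vectors of [U]. With it the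
    underlying category of [vect_enriched B D] is seen to be [D]. *)
Definition celt (e : hom one (copower B U)) : U := sval (cid (cop_elt_surj e)).
Lemma celtK e : cop_elt B (celt e) = e.
Proof. exact: (svalP (cid (cop_elt_surj e))). Qed.
Lemma cop_eltK u : celt (cop_elt B u) = u.
Proof. by apply: cop_elt_inj; rewrite celtK. Qed.
Lemma celt_inj : injective celt.
Proof. exact: can_inj celtK. Qed.
End Copower.

(** Both sides are expanded in the chosen bases, with [cop_out] reading off the coordinates of [u]
    and [w]. *)
Lemma cop_bilinE (U W T : vectType K) (m : U -> W -> T) u w :
  (forall v a u u', m (a *: u + u') v = a *: m u v + m u' v) ->
  (forall u a v v', m u (a *: v + v') = a *: m u v + m u v') ->
  cop_bilin B m ∘ (cop_elt B u ⊠ cop_elt B w) ∘ lunV one = cop_elt B (m u w).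
Proof.
move=> ml mr; have lin (A A' : vectType K) (f : A -> A') : linear f ->
    forall v : A, f v = \sum_k coord (vbasis {:A}) k v *: f (vbasis {:A})`_k.
  move=> lf v; pose f' : {linear A -> A'} := HB.pack f (GRing.isLinear.Build K _ _ _ f lf).
  rewrite [v in LHS](coord_vbasis (memvf v)) -[f]/(f' : _ -> _) linear_sum.
  by apply: eq_bigr => k _; rewrite linearZ.
have -> : cop_elt B (m u w)
    = \sum_k coord (vbasis {:U}) k u *: cop_elt B (m (vbasis {:U})`_k w).
  by apply: (lin _ _ (fun v => cop_elt B (m v w))) => a v v'; rewrite ml cop_elt_linear.
rewrite /cop_bilin !comp_suml; apply: eq_bigr => k _.
have -> : cop_elt B (m (vbasis {:U})`_k w)
    = \sum_l coord (vbasis {:W}) l w *: cop_elt B (m (vbasis {:U})`_k (vbasis {:W})`_l).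
  by apply: (lin _ _ (fun v => cop_elt B (m _ v))) => a v v'; rewrite mr cop_elt_linear.
rewrite !comp_suml scaler_sumr; apply: eq_bigr => l _.
rewrite !cA (tensML hM) !cop_outK tensZl tensZr (tensm1 hM) !compZl c1 !compZr (lunVK hM) c2.
by rewrite scalerA.
Qed.

Context (D : linear_braided K).
Local Notation E := (vect_enriched B D).
Local Notation U := (underlying_mon E).
Let hD := lm_monoidal D.
Let lD := lm_linear D.
Lemma celt_comp (x y z : D) (g : @hom U y z) (f : @hom U x y) :
  celt (@comp U x y z g f) = celt g ∘ celt f.
Proof.
rewrite -[g in LHS]celtK -[f in LHS]celtK /= cop_bilinE ?cop_eltK //.
  by move=> v a u u'; exact: (comp_linl lD).
by move=> u a v v'; exact: (comp_linr lD).
Qed.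
Lemma celt_tens (x x' y y' : D) (f : @hom U x x') (g : @hom U y y') :
  celt (@tensm U x x' y y' f g) = celt f ⊠ celt g.
Proof.
rewrite -[g in LHS]celtK -[f in LHS]celtK /= cop_bilinE ?cop_eltK //.
  by move=> v a u u'; exact: (tensm_linl lD).
by move=> u a v v'; exact: (tensm_linr lD).
Qed.
Lemma celt_id (x : D) : celt (@idm U x) = idm x.
Proof. exact: cop_eltK. Qed.
Lemma vect_underlying : is_monoidal U.
Proof.
split; first split; move=> *; try split; apply: celt_inj.
- by rewrite !celt_comp; exact: (compA (mon_is_cat hD)).
- by rewrite celt_comp celt_id; exact: (comp1m (mon_is_cat hD)).
- by rewrite celt_comp celt_id; exact: (compm1 (mon_is_cat hD)).
- by rewrite celt_tens !celt_id; exact: (tensm1 hD).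
- by rewrite celt_comp !celt_tens !celt_comp; exact: (tensmM hD).
- by rewrite celt_comp !cop_eltK; exact: (assocI hD _ _ _).1.
- by rewrite celt_comp !cop_eltK; exact: (assocI hD _ _ _).2.
- by rewrite celt_comp !cop_eltK; exact: (lunI hD _).1.
- by rewrite celt_comp !cop_eltK; exact: (lunI hD _).2.
- by rewrite celt_comp !cop_eltK; exact: (runI hD _).1.
- by rewrite celt_comp !cop_eltK; exact: (runI hD _).2.
- by rewrite !celt_comp !celt_tens !cop_eltK; exact: (assoc_nat hD).
- by rewrite !celt_comp !celt_tens !cop_eltK; exact: (lun_nat hD).
- by rewrite !celt_comp !celt_tens !cop_eltK; exact: (run_nat hD).
- by rewrite !celt_comp !celt_tens !cop_eltK; exact: (pentagon hD).
- by rewrite !celt_comp !celt_tens !cop_eltK; exact: (triangle hD).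
Qed.
Lemma vect_braiding : is_braiding (underlying_braiding E).
Proof.
have hb := lb_braidingP D.
split; move=> *; try split; apply: celt_inj.
- by rewrite celt_comp !cop_eltK; exact: (braidI hb _ _).1.
- by rewrite celt_comp !cop_eltK; exact: (braidI hb _ _).2.
- by rewrite !celt_comp !celt_tens !cop_eltK; exact: (braid_nat hb).
- by rewrite !celt_comp !celt_tens !cop_eltK; exact: (hexagon1 hb).
- by rewrite !celt_comp !celt_tens !cop_eltK; exact: (hexagon2 hb).
Qed.
Lemma vect_ebraided : is_ebraided (lb_braiding B) E.
Proof.
apply: discrete_ebraided; [exact: vect_underlying|exact: vect_braiding|].
by move=> x y; exact: copower_unital.
Qed.

(** * Enriched equivalences from equivalences of underlying categories *)

Section Equivalence.
Context (A : ebraided_data B) (un : forall x y : A, unital (ehom x y)).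
Context (Phi : monfunctor_data (underlying_mon A) D) (hPhi : is_monfunctor Phi).
Let fm (x y : A) (a : hom one (ehom x y)) : hom (Phi x) (Phi y) := @fmap _ _ Phi x y a.
Hypothesis Phi_linear : forall x y, linear (@fm x y).
Let hPhi1 := mf_is_functor hPhi.

Lemma vect_hom_ex (x y : A) : exists f : hom (ehom x y) (copower B (hom (Phi x) (Phi y))),
  forall a, f ∘ a = cop_elt B (fm a).
Proof.
apply: elt_map => // a u v.
by rewrite Phi_linear cop_elt_linear.
Qed.
Definition vect_functor : emonfunctor_data A E :=
  @EMonFunctorData B A E
    (@EFunctorData B A E (fun x => Phi x) (fun x y => sval (cid (vect_hom_ex x y))))
    (cop_elt B (mu Phi)) (cop_elt B (muV Phi))
    (fun x y => cop_elt B (nu Phi x y)) (fun x y => cop_elt B (nuV Phi x y)).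
Local Notation UF := (underlying_monfunctor vect_functor).
Lemma vect_functorE (x y : A) (a : hom one (ehom x y)) :
  efhom vect_functor x y ∘ a = cop_elt B (fm a).
Proof. exact: (svalP (cid (vect_hom_ex x y))). Qed.
Lemma celt_fmap (x y : underlying_mon A) (a : hom x y) : celt (fmap UF a) = fmap Phi a.
Proof. by rewrite [fmap UF a]vect_functorE cop_eltK. Qed.
Lemma vect_functor_underlying : is_monfunctor UF.
Proof.
split; first split; move=> *; try split; apply: celt_inj;
  rewrite ?celt_comp ?celt_tens ?celt_fmap ?celt_comp ?cop_eltK.
- exact: (fmap1 hPhi1).
- exact: (fmapM hPhi1).
- exact: (muI hPhi).1.
- exact: (muI hPhi).2.
- exact: (nuI hPhi _ _).1.
- exact: (nuI hPhi _ _).2.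
- exact: (nu_nat hPhi).
- exact: (nu_assoc hPhi).
- exact: (nu_lun hPhi).
- exact: (nu_run hPhi).
Qed.

(** All hom objects are sums of copies of the unit, so the enriched functor and its laws are
    determined on elements by [Phi]; full faithfulness becomes invertibility on hom objects by
    [elt_iso]. *)
Theorem vect_equivalence :
  is_monoidal (underlying_mon A) -> is_braiding (underlying_braiding A) ->
  preserves_braiding (underlying_braiding A) (lb_braiding D) Phi ->
  fully_faithful Phi -> essentially_surjective Phi ->
  ebraided_equivalent (lb_braiding B) A E.
Proof.
move=> hA1 hbA pb ff es; split; [exact: discrete_ebraided|exact: vect_ebraided|].
exists vect_functor; split.
- exact: discrete_emonfunctor vect_functor_underlying.
- move=> x y; apply: celt_inj; rewrite !celt_comp celt_fmap !cop_eltK.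
  exact: pb.
- move=> x y; apply: elt_iso; [exact: un|exact: copower_unital|].
  have [g gK Kg] := ff x y.
  exists (fun e => g (celt e)) => e; first by rewrite vect_functorE cop_eltK gK.
  by rewrite vect_functorE [fm _]Kg celtK.
- move=> y; have [x [f [g [gf fg]]]] := es y.
  exists x, (cop_elt B f), (cop_elt B g).
  by split; apply: celt_inj; rewrite celt_comp !cop_eltK.
Qed.
End Equivalence.
End VectEnriched.

(** * The canonical construction and its center *)

Section CanonicalFunctor.
Context (K : fieldType) (B : linear_braided K) (C : linear_monoidal K).
Context (psi : monfunctor_data (rev_linear_braided B) (center C)).
Context (hpsi : is_monfunctor psi).
Hypothesis hpsi_br : preserves_braiding (lb_braiding (rev_linear_braided B))
       (lb_braiding (center C)) psi.

Definition phi_fun : monfunctor_data B C :=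
  @MonFunctorData B C (@FunctorData B C (phi psi) (@phim K B C psi)) (phi_mu psi)
    (chom_val (muV psi)) (fun w w' => chom_val (nu psi w w')) (@phi_nuV K B C psi).
Lemma phi_monfunctor : is_monfunctor phi_fun.
Proof.
have hF := mf_is_functor hpsi.
split; first split; move=> *.
- exact: (congr1 (@chom_val K C _ _) (fmap1 hF _)).
- exact: (congr1 (@chom_val K C _ _) (fmapM hF _ _)).
- by have [e1 e2] := muI hpsi; split;
    [exact: (congr1 (@chom_val K C _ _) e1)|exact: (congr1 (@chom_val K C _ _) e2)].
- by match goal with |- inverses (nu _ ?x ?y) _ => have [e1 e2] := nuI hpsi x y end; split;
    [exact: (congr1 (@chom_val K C _ _) e1)|exact: (congr1 (@chom_val K C _ _) e2)].
- exact: (congr1 (@chom_val K C _ _) (nu_nat hpsi _ _)).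
- exact: (congr1 (@chom_val K C _ _) (nu_assoc hpsi _ _ _)).
- exact: (congr1 (@chom_val K C _ _) (nu_lun hpsi _)).
- exact: (congr1 (@chom_val K C _ _) (nu_run hpsi _)).
Qed.
(** The definition is transparent so that [cf_hb] unfolds to the half-braiding of [psi w] that
    occurs in [canonical]. *)
Definition psi_central : central_functor C (lb_braiding B).
Proof.
refine (@CentralFunctor B C (lb_braiding B) phi_fun (fun w => hb (psi w)) (fun w => hbV (psi w))
  phi_monfunctor _ _ _ _ _).
- by move=> w; exact: hbP.
- by move=> w w' f; exact: chomP.
- exact: (chomP (mu psi)).
- by move=> w w'; exact: (chomP (nuV psi w w')).
- by move=> w w'; exact: (congr1 (@chom_val K C _ _) (hpsi_br w w')).
Defined.
End CanonicalFunctor.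

(** * The canonical construction through the internal hom adjunction *)

Section Canonical.
Context (K : closedFieldType) (B : linear_braided K) (C : linear_monoidal K).
Context (psi : monfunctor_data (rev_linear_braided B) (center C)).
Context (hpsi : is_monfunctor psi).
Context (hpsi_br : preserves_braiding (lb_braiding (rev_linear_braided B))
       (lb_braiding (center C)) psi).
Context (hpsi_lin : is_linear_functor psi) (hB : is_multifusion B).
Local Notation F := (psi_central hpsi hpsi_br).
Let hV := lm_monoidal B.
Let hM := lm_monoidal C.
Let hC := mon_is_cat hM.
Let cA := compA hC.
Let c1 := comp1m hC.
Let c2 := compm1 hC.
Let bA := compA (mon_is_cat hV).
Let b1 := comp1m (mon_is_cat hV).
Let b2 := compm1 (mon_is_cat hV).
Let hc := lb_braidingP B.
Implicit Types x y z : C.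

Lemma ihom_ex x y : exists h, @is_ihom K B C psi x y h.
Proof.
have [||||h [u hu]] := @linear_functor_representable K B (mfc_semisimple hB) (mfc_finite hB)
  (fun w => hom (phi psi w ⊗ x) y : vectType K) (fun w w' r f => f ∘ (phim psi r ▷ x)).
- by move=> w u; rewrite [phim _ _](cf1 F) (tensm1 hM) c2.
- by move=> w w' w'' g f u; rewrite [phim _ _](cfM F) (tensmr hM) !cA.
- move=> w w' u a f f'; have e : phim psi (a *: f + f') = a *: phim psi f + phim psi f'.
    exact: (congr1 vsval (hpsi_lin a f f')).
  by rewrite e (tensm_linl (lm_linear C)) compDr compZr.
- by move=> w w' f a u u'; rewrite compDl compZl.
by exists (existT _ h u) => w f; exact: hu.
Qed.
Lemma ihomP x y : is_ihom (ihom_choice psi x y).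
Proof. by apply: chooseP; exact: ihom_ex. Qed.

(** The adjunction bijection, inverse to [ihom_adj]. It turns composition and tensor product of the
    canonical construction into [pcomp] and [ptens]. *)
Definition pv (w : B) x y (a : hom w (ihom psi x y)) : hom (F w ⊗ x) y :=
  ihom_ev psi x y ∘ (fmap F a ▷ x).

Lemma pv_inj w x y (a b : hom w (ihom psi x y)) : pv a = pv b -> a = b.
Proof.
by move=> e; have [g [_ ug]] := ihomP (pv b); rewrite -(ug b) // -(ug a).
Qed.
Lemma pv_adj w x y (f : hom (F w ⊗ x) y) : pv (ihom_adj (psi := psi) (w := w) f) = f.
Proof.
have [g [eg _]] := ihomP (w := w) f.
exact: (@chooseP (hom w (ihom psi x y)) 0 (fun g => ihom_ev psi x y ∘ (phim psi g ⊠ idm x) = f)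
  (ex_intro _ g eg)).
Qed.
Lemma pv_comp w w' x y (a : hom w (ihom psi x y)) (r : hom w' w) :
  pv (a ∘ r) = pv a ∘ (fmap F r ▷ x).
Proof. by rewrite /pv (cfM F) (tensmr hM) !cA. Qed.
Local Notation E := (canonical psi).
Lemma pv_ecomp w v x y z (a : hom w (ihom psi y z)) (b : hom v (ihom psi x y)) :
  pv (ecomp (e := E) x y z ∘ (a ⊠ b)) = pcomp (F := F) (pv a) (pv b).
Proof.
rewrite pv_comp [X in X ∘ _]pv_adj /pv (pcomp_nat hM).
by rewrite /pcomp nuhE !cA.
Qed.
Lemma pv_etensh w v x x' y y' (a : hom w (ihom psi x x')) (b : hom v (ihom psi y y')) :
  pv (etensh (e := E) x x' y y' ∘ (a ⊠ b)) = ptens (F := F) (pv a) (pv b).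
Proof.
rewrite pv_comp [X in X ∘ _]pv_adj /pv (ptens_nat hM).
by rewrite (ptens_middle hM).
Qed.
Lemma pv_name x y (k : hom x y) : pv (canonical_name psi k) = punit F k.
Proof. by rewrite pv_adj. Qed.
Lemma pv_eid x : pv (eid (e := E) x) = punit F (idm x).
Proof. by rewrite pv_adj /punit c1. Qed.
Lemma pv_post w x y z (k : hom y z) (a : hom w (ihom psi x y)) :
  pv (post (E := E) x (canonical_name psi k) ∘ a) = k ∘ pv a.
Proof.
rewrite (post_elt hV) -bA pv_comp pv_ecomp pv_name (pcomp_unitl hM) !cA.
by rewrite -(tensmr hM) -(cfM F) (lunVK hV) cf1 (tensm1 hM) c2.
Qed.
Lemma pv_pre w x y z (k : hom x y) (a : hom w (ihom psi y z)) :
  pv (pre (E := E) z (canonical_name psi k) ∘ a) = pv a ∘ (F w ◁ k).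
Proof.
rewrite (pre_elt hV) -bA pv_comp pv_ecomp pv_name (pcomp_unitr hM) !cA.
by rewrite -(tensmr hM) -(cfM F) (runVK hV) cf1 (tensm1 hM) c2.
Qed.
Lemma pv_ltens w x y z (a : hom w (ihom psi y z)) :
  pv (efhom (ltens (E := E) x) y z ∘ a) = (x ◁ pv a) ∘ bh F w x y.
Proof.
rewrite /= !bA -(lunV_nat hV) (tensML hV) b1 b2 -bA pv_comp pv_etensh pv_eid.
rewrite (ptens_unitl hM) !cA -(tensmr hM) -(cfM F) (lunVK hV) cf1 (tensm1 hM) c2.
by [].
Qed.
Lemma pv_rtens w x y z (a : hom w (ihom psi y z)) :
  pv (efhom (rtens (E := E) x) y z ∘ a) = hat (pv a) x.
Proof.
rewrite /= !bA -(runV_nat hV) (tensML hV) b1 b2 -bA pv_comp pv_etensh pv_eid.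
rewrite (ptens_unitr hM) !cA -(tensmr hM) -(cfM F) (runVK hV) cf1 !(tensm1 hM) !c2.
by [].
Qed.

Let cmapK (w w' : B) (r : hom w w') (rV : hom w' w) x :
  r ∘ rV = idm w' -> (fmap F r ▷ x) ∘ (fmap F rV ▷ x) = idm _.
Proof. by move=> e; rewrite -(tensmr hM) -(cfM F) e cf1 (tensm1 hM). Qed.
Let pv_ecomp_id x y z :
  pv (ecomp (e := E) x y z) = pcomp (F := F) (pv (idm _)) (pv (idm _)).
Proof. by rewrite -pv_ecomp (tensm1 hV) b2. Qed.
Let pv_etensh_id x x' y y' :
  pv (etensh (e := E) x x' y y') = ptens (F := F) (pv (idm _)) (pv (idm _)).
Proof. by rewrite -pv_etensh (tensm1 hV) b2. Qed.

Lemma canonical_is_ecat : is_ecat E.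
Proof.
split=> [x y z w|x y|x y]; apply: pv_inj.
- rewrite pv_ecomp -bA pv_comp pv_ecomp !pv_ecomp_id.
  by rewrite (pcompA hM).
- by rewrite pv_ecomp pv_eid (pcomp_unitl hM) c1 -pv_comp b1.
- by rewrite pv_ecomp pv_eid (pcomp_unitr hM) (tensm1 hM) c1 -pv_comp b1.
Qed.
Lemma canonical_etens : is_efunctor (etens_functor (lb_braiding B) E).
Proof.
split=> [[x y]|[x x'] [y y'] [z z']]; apply: pv_inj.
- rewrite /= -bA pv_comp pv_etensh !pv_eid (ptens_unitl hM).
  rewrite /punit !c1 !cA (compL hC _ (bh_mu hM F x y)) !cA cmapK ?(lunVK hV) // c2.
  by [].
(* Unfolding the product category exposes [middle], after which the claim is [pcomp_ptens]. *)
- change (pv (etensh (e := E) x z x' z' ∘ (ecomp (e := E) x y z ⊠ ecomp (e := E) x' y' z')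
      ∘ middle _ _ (braidV (lb_braiding B) (ihom psi x y) (ihom psi y' z')))
    = pv (ecomp (e := E) _ _ _ ∘ (etensh (e := E) y z y' z' ⊠ etensh (e := E) x y x' y'))).
  rewrite -bA pv_comp pv_etensh !pv_ecomp_id.
  rewrite pv_ecomp !pv_etensh_id; exact: (pcomp_ptens hV hM (F := F)).
Qed.

(** The inverse of [canonical_name]; it identifies the underlying monoidal category with [C]. *)
Definition unname x y (a : hom one (ihom psi x y)) : hom x y :=
  locked (pv a ∘ (muV F ▷ x) ∘ lunV x).
Let muK := (muI (cf_monfunctor F)).1.
Let muVK := (muI (cf_monfunctor F)).2.
Lemma punit_inj x y (k k' : hom x y) : punit F k = punit F k' -> k = k'.
Proof.
rewrite /punit -!cA => /(cancelR hC (tensmrK hM x muVK)).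
exact: (cancelR hC (lunVK hM x)).
Qed.
Lemma pv_unname x y (a : hom one (ihom psi x y)) : pv a = punit F (unname a).
Proof.
rewrite /punit /unname -lock !cA (compKL hC _ (lunK hM x)).
by rewrite (tensmrK hM x muK) c2.
Qed.
Lemma unname_name x y (k : hom x y) : unname (canonical_name psi k) = k.
Proof. by apply: punit_inj; rewrite -pv_unname pv_name. Qed.
Lemma unname_inj x y (a b : hom one (ihom psi x y)) : unname a = unname b -> a = b.
Proof. by move=> e; apply: pv_inj; rewrite !pv_unname e. Qed.
Lemma unname_id x : unname (eid (e := E) x) = idm x.
Proof. by apply: punit_inj; rewrite -pv_unname pv_eid. Qed.

Local Notation U := (underlying_mon E).
Lemma unname_comp x y z (g : hom one (ihom psi y z)) (f : hom one (ihom psi x y)) :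
  unname (@comp U x y z g f) = unname g ∘ unname f.
Proof.
apply: punit_inj; rewrite -pv_unname /= -bA pv_comp pv_ecomp !pv_unname.
rewrite (pcomp_unitl hM) !cA cmapK ?(lunVK hV) // c2.
by rewrite /punit !cA.
Qed.
Lemma unname_tens x x' y y' (f : hom one (ihom psi x x')) (g : hom one (ihom psi y y')) :
  unname (@tensm U x x' y y' f g) = unname f ⊠ unname g.
Proof.
apply: punit_inj; rewrite -pv_unname /= -bA pv_comp pv_etensh !pv_unname.
rewrite (ptens_unitl hM) !cA cmapK ?(lunVK hV) // c2.
rewrite (tensm_lr hM) /punit (tensml hM x (unname g)) !cA (bh_mu hM).
by rewrite (tensm_lr hM (unname f) (unname g)) !cA.
Qed.
Lemma canonical_underlying : is_monoidal U.
Proof.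
split; first split; move=> *; try split; apply: unname_inj.
- by rewrite !unname_comp; exact: (compA hC).
- by rewrite unname_comp unname_id; exact: (comp1m hC).
- by rewrite unname_comp unname_id; exact: (compm1 hC).
- by rewrite unname_tens !unname_id; exact: (tensm1 hM).
- by rewrite unname_comp !unname_tens !unname_comp; exact: (tensmM hM).
- by rewrite unname_comp !unname_name unname_id; exact: (assocI hM _ _ _).1.
- by rewrite unname_comp !unname_name unname_id; exact: (assocI hM _ _ _).2.
- by rewrite unname_comp !unname_name unname_id; exact: (lunI hM _).1.
- by rewrite unname_comp !unname_name unname_id; exact: (lunI hM _).2.
- by rewrite unname_comp !unname_name unname_id; exact: (runI hM _).1.
- by rewrite unname_comp !unname_name unname_id; exact: (runI hM _).2.
- by rewrite !unname_comp !unname_tens !unname_name; exact: (assoc_nat hM).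
- by rewrite !unname_comp !unname_tens !unname_name unname_id; exact: (lun_nat hM).
- by rewrite !unname_comp !unname_tens !unname_name unname_id; exact: (run_nat hM).
- by rewrite !unname_comp !unname_tens !unname_name !unname_id; exact: (pentagon hM).
- by rewrite !unname_comp !unname_tens !unname_name !unname_id; exact: (triangle hM).
Qed.

Lemma canonical_emonoidal : is_emonoidal (lb_braiding B) E.
Proof.
split.
- exact: canonical_is_ecat.
- exact: canonical_etens.
- apply: (is_enatural_of_square hV) => x y; apply: pv_inj.
  rewrite pv_post pv_pre -[efhom (ltens _) _ _]b2 pv_ltens.
  by rewrite (compL hC _ (lun_nat hM _)) !cA (bh_one hM).
- apply: (is_enatural_of_square hV) => x y; apply: pv_inj.
  rewrite pv_post pv_pre -[efhom (rtens _) _ _]b2 pv_rtens hatE.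
  by rewrite (compL hC _ (run_nat hM _)) !cA (run_tensV hM).
- apply: (is_enatural_of_square hV) => -[[x x'] x''] [[y y'] y'']; apply: pv_inj.
  rewrite pv_post pv_pre.
  change (assoc y y' y'' ∘ pv (etensh (e := E) (x ⊗ x') (y ⊗ y') x'' y''
      ∘ (etensh (e := E) x y x' y' ⊠ idm (ihom psi x'' y'')))
    = pv (etensh (e := E) x y (x' ⊗ x'') (y' ⊗ y'')
      ∘ (idm (ihom psi x y) ⊠ etensh (e := E) x' y' x'' y'') ∘ assoc _ _ _)
      ∘ (F _ ◁ assoc x x' x'')).
  rewrite pv_etensh pv_etensh_id -bA pv_comp pv_etensh pv_etensh_id.
  by rewrite (ptensA hM) (tensm_lr hM (fmap F _)) !cA.
- exact: canonical_underlying.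
Qed.

Lemma name_unname x y (a : hom one (ihom psi x y)) : canonical_name psi (unname a) = a.
Proof. by apply: unname_inj; rewrite unname_name. Qed.

(** * Enriched half-braidings as objects of the centralizer *)

Section HalfBraiding.
Context (x : C).
Context (b : forall z, hom one (ihom psi (x ⊗ z) (z ⊗ x))).
Context (bV : forall z, hom one (ihom psi (z ⊗ x) (x ⊗ z))).
Lemma unname_half_braiding : @is_half_braiding U x b bV <->
  is_half_braiding (fun z => unname (b z)) (fun z => unname (bV z)).
Proof.
split=> h; split=> [z|z w f|z w].
- by have [e1 e2] := hbI h z; split; rewrite -unname_comp ?e1 ?e2 unname_id.
- have := congr1 (@unname _ _) (hb_nat h (canonical_name psi f)).
  by rewrite !unname_comp !unname_tens !unname_id unname_name.
- have := congr1 (@unname _ _) (hb_hexagon h z w).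
  by rewrite !unname_comp !unname_tens !unname_id !unname_name.
- by have [e1 e2] := hbI h z; split; apply: unname_inj; rewrite unname_comp unname_id.
- apply: unname_inj; rewrite !unname_comp !unname_tens !unname_id.
  exact: (hb_nat h).
- apply: unname_inj; rewrite !unname_comp !unname_tens !unname_id !unname_name.
  exact: (hb_hexagon h).
Qed.

Hypothesis hb : is_half_braiding (fun z => unname (b z)) (fun z => unname (bV z)).
Let beta z := unname (b z).
(** The hexagon at [F w ⊗ z] isolates the double braiding of [F w] with [x]. *)
Lemma hexagon_bh w z :
  assoc (F w) z x ∘ beta (F w ⊗ z) ∘ bh F w x z
  = (F w ◁ beta z) ∘ assoc _ _ _ ∘ ((beta (F w) ∘ cf_hb F w x) ▷ z) ∘ assocV _ _ _.
Proof.
rewrite bhE (compL3 hC _ (hb_hexagon hb (F w) z)) (tensmr hM) !cA.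
by [].
Qed.
(** Transposed by [pv], the two sides of the square at an element become, by naturality and the
    hexagon of [beta], the same morphism with and without the double braiding inserted. *)
Lemma centralizing_natural : (forall w, beta (F w) ∘ cf_hb F w x = idm _) <->
  (forall z z' : E, post (E := E) _ (b z') ∘ efhom (ltens (E := E) x) z z'
     = pre (E := E) _ (b z) ∘ efhom (rtens (E := E) x) z z').
Proof.
have elt w z z' (a : hom w (ihom psi z z')) :
    pv ((post (E := E) _ (b z') ∘ efhom (ltens (E := E) x) z z') ∘ a)
    = beta z' ∘ (x ◁ pv a) ∘ bh F w x z /\
    pv ((pre (E := E) _ (b z) ∘ efhom (rtens (E := E) x) z z') ∘ a)
    = hat (pv a) x ∘ (F w ◁ beta z).
  rewrite -(name_unname (b z)) -(name_unname (b z')).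
  by rewrite (bA (post _ _)) (bA (pre _ _)) pv_post pv_pre pv_ltens pv_rtens.
split=> [e z z'|e w].
  apply: pv_inj; rewrite -[post _ _ ∘ _]b2 -[pre _ _ ∘ _]b2.
  rewrite (elt _ z z' _).1 (elt _ z z' _).2.
  set f := pv _.
  rewrite (compL hC _ (hb_nat hb f)) !cA hatE !cA; congr (_ ∘ _).
  apply: (cancelL hC (assocK hM _ _ _)).
  rewrite (hexagon_bh _ z) e (tensm1 hM) c1 (assocVK hM) c2.
  by rewrite (compKL hC _ (assocVK hM _ _ _)).
(* by the hexagon, the square at this element is the condition at [w] tensored with [one] *)
pose a := ihom_adj (psi := psi) (w := w) (idm (F w ⊗ (one : C))).
have [h1 h2] := elt w one (F w ⊗ one) a.
rewrite e in h1; have := etrans (esym h1) h2.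
rewrite pv_adj (tensm1 hM) c1 hatE (tensm1 hM) c1.
move=> /(congr1 (comp (assoc _ _ _))); rewrite (hexagon_bh w one).
rewrite (compKL hC _ (assocVK hM _ _ _)) => h.
apply: (tensr_inj hM); rewrite (tensm1 hM).
have k : (F w ◁ unname (bV one)) ∘ (F w ◁ beta one) = idm _.
  exact: (tensmlK hM _ (hbI hb one).1).
have := congr1 (comp (F w ◁ unname (bV one))) h.
rewrite k (compKL hC _ k) => h'.
apply: (cancelL hC (assocK hM (F w) x one)).
by apply: (cancelR hC (assocK hM (F w) x one)); rewrite !cA ?c2 h' ?c1 (assocVK hM).
Qed.
End HalfBraiding.

(** Naturality extends triviality from the objects [psi w] to the essential image. The two braidings
    are composed here in the other order, which is equivalent since [hb X] is invertible. *)
Lemma centralizes_iff (X : half_braiding C) : centralizes psi X <->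
  forall w, hb X (F w) ∘ cf_hb F w (hb_ob X) = idm _.
Proof.
split=> [h w|h y [w [f [g [gf fg]]]]].
- have /(congr1 vsval) /= e := h (psi w) (ex_intro _ w (ex_intro _ _ (ex_intro _ _ (invs1 (lm_monoidal (center C)) _)))).
  apply: (cancelR hC (a := hb X (F w)) (aV := hbV X (F w))); first exact: (hbI (hbP X) _).2.
  by rewrite cA c1; rewrite [X in _ ∘ X]e c2.
- apply: val_inj => /=.
  apply: (cancelR hC (a := hb_ob X ◁ vsval f) (aV := hb_ob X ◁ vsval g)).
    exact: (tensmlK hM _ (congr1 vsval fg)).
  rewrite cA (hb_nat (hbP X)) (compL hC _ (esym (chomP f (hb_ob X)))) !cA.
  have e : cf_hb F w (hb_ob X) ∘ hb X (F w) = idm _.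
    apply: (cancelL hC (a := hb X (F w)) (aV := hbV X (F w))); first exact: (hbI (hbP X) _).1.
    by rewrite (compKL hC _ (h w)) c2.
  by rewrite [X in _ ∘ X]e c1 c2.
Qed.

Context (hE : is_emonoidal (lb_braiding B) E).
Definition uhb (X : ehalf_braiding E) : half_braiding C :=
  HalfBraiding ((unname_half_braiding (ehb X) (ehbV X)).1 (ehb_underlying (ehbP X))).
Lemma uhb_centralizes X : centralizes psi (uhb X).
Proof.
apply/centralizes_iff => w; apply: (centralizing_natural (hbP (uhb X))).2.
exact: (ehb_nat (ehbP X)).2.
Qed.
Lemma ehb_of_subproof (X : half_braiding C) : centralizes psi X ->
  @is_ehalf_braiding B E (hb_ob X) (fun z => canonical_name psi (hb X z))
    (fun z => canonical_name psi (hbV X z)).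
Proof.
move=> /centralizes_iff cX.
have e1 : (fun z => unname (canonical_name psi (hb X z))) = hb X.
  by apply: functional_extensionality_dep => z; rewrite unname_name.
have e2 : (fun z => unname (canonical_name psi (hbV X z))) = hbV X.
  by apply: functional_extensionality_dep => z; rewrite unname_name.
have hX : is_half_braiding (fun z => unname (canonical_name psi (hb X z)))
    (fun z => unname (canonical_name psi (hbV X z))) by rewrite e1 e2; exact: hbP.
split; last exact: (unname_half_braiding _ _).2.
apply: (is_enatural_of_square hV); apply: (centralizing_natural hX).1 => w.
by rewrite unname_name.
Qed.
Definition ehb_of (X : half_braiding C) (cX : centralizes psi X) : ehalf_braiding E :=
  EHalfBraidingOb (ehb_of_subproof cX).

(** * The hom objects of the enriched center *)

Section CenterHom.
Context (X Y : ehalf_braiding E).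
Local Notation x := (ehb_ob X).
Local Notation y := (ehb_ob Y).
Definition equalizes (w : B) (a : hom w (ihom psi x y)) :=
  forall z, center_left X Y z ∘ a = center_right X Y z ∘ a.
(** The transposes of [center_left] and [center_right] at [a] are, up to associativity, the two
    sides of centrality of [pv a] as a morphism out of [psi w ⊗ X]. *)
Lemma equalizes_central (w : B) (a : hom w (ihom psi x y)) : equalizes a <->
  central (hb_tens (cf_hb F w) (hb (uhb X))) (hb (uhb Y)) (pv a).
Proof.
have elt z : pv (center_left X Y z ∘ a) = (z ◁ pv a) ∘ bh F w z x ∘ (F w ◁ unname (ehb X z))
    /\ pv (center_right X Y z ∘ a) = unname (ehb Y z) ∘ hat (pv a) z.
  rewrite /center_left /center_right (bA (post _ _)) (bA (pre _ _)).
  rewrite -(name_unname (ehb X z)) -(name_unname (ehb Y z)).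
  by rewrite pv_post pv_pre pv_ltens pv_rtens !unname_name !cA.
have ct z : (z ◁ pv a) ∘ hb_tens (cf_hb F w) (hb (uhb X)) z
    = ((z ◁ pv a) ∘ bh F w z x ∘ (F w ◁ unname (ehb X z))) ∘ assoc _ _ _.
  by rewrite /hb_tens bhE !cA.
split=> [e z|cf z].
  rewrite ct -(elt z).1 e (elt z).2 hatE !cA (assocK hM) c2.
  by [].
apply: pv_inj; rewrite (elt z).1 (elt z).2.
apply: (cancelR hC (assocVK hM _ _ _)); rewrite -ct cf.
by rewrite hatE !cA (assocK hM) c2.
Qed.
(** Each equalizer represents the sieve of morphisms equalized at one [z], and the intersection the
    sieve of those equalized at all [z]. *)
Lemma center_hom_ex : exists q, @is_center_hom K B E X Y q.
Proof.
have zero_eq w z : center_left X Y z ∘ (0 : hom w (ihom psi x y)) = center_right X Y z ∘ (0 : hom w _).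
  by rewrite !comp0r.
have lin w (a : K) (f g : hom w (ihom psi x y)) z :
    center_left X Y z ∘ f = center_right X Y z ∘ f ->
    center_left X Y z ∘ g = center_right X Y z ∘ g ->
    center_left X Y z ∘ (a *: f + g) = center_right X Y z ∘ (a *: f + g).
  by move=> ef eg; rewrite !compDr !compZr ef eg.
have precomp w w' (f : hom w (ihom psi x y)) (r : hom w' w) z :
    center_left X Y z ∘ f = center_right X Y z ∘ f ->
    center_left X Y z ∘ (f ∘ r) = center_right X Y z ∘ (f ∘ r).
  by move=> ef; rewrite -!bA ef.
have exz z : exists q (m : hom q (ihom psi x y)),
    center_left X Y z ∘ m = center_right X Y z ∘ m /\
    forall w (f : hom w _), center_left X Y z ∘ f = center_right X Y z ∘ f -> exists! u, m ∘ u = f.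
  apply: (@sieve_representable K B (mfc_semisimple hB) (mfc_finite hB) (ihom psi x y)
    (fun w f => center_left X Y z ∘ f = center_right X Y z ∘ f)).
  - by move=> w; exact: zero_eq.
  - by move=> w a f g; exact: lin.
  - by move=> w w' f r; exact: precomp.
have [||| q [m [em um]]] := @sieve_representable K B (mfc_semisimple hB) (mfc_finite hB) (ihom psi x y)
    (fun w f => equalizes f).
- by move=> w z; exact: zero_eq.
- by move=> w a f g ef eg z; apply: lin; [exact: ef|exact: eg].
- by move=> w w' f r ef z; apply: precomp; exact: ef.
pose k z := sval (cid (exz z)).
pose s z : hom (k z) (ihom psi x y) := sval (cid (svalP (cid (exz z)))).
have hs z : is_equalizer (center_left X Y z) (center_right X Y z) (s z).
  exact: (svalP (cid (svalP (cid (exz z))))).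
exists (existT _ q m), k, s; split=> //; split=> [z|w f hf].
  by have [u [eu _]] := (hs z).2 _ m (em z); exists u.
by apply: um => z; have [u <-] := hf z; apply: precomp; exact: (hs z).1.
Qed.
Lemma center_hom_spec : equalizes (center_incl X Y) /\
  forall w (f : hom w (ihom psi x y)), equalizes f -> exists! u, center_incl X Y ∘ u = f.
Proof.
have [k [s [hs [h1 h2]]]] : is_center_hom (center_hom_choice X Y) := chooseP _ center_hom_ex.
split=> [z|w f ef].
  by have [u eu] := h1 z; rewrite -[center_incl X Y]eu -!bA (hs z).1.
apply: h2 => z; have [u [eu _]] := (hs z).2 _ f (ef z); by exists u.
Qed.
Lemma center_liftK w (f : hom w (ihom psi x y)) : equalizes f ->
  center_incl X Y ∘ center_lift (X := X) (Y := Y) f = f.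
Proof.
move=> /(center_hom_spec.2 _ _)[u [eu _]].
exact: (@chooseP (hom w (center_hom X Y)) 0 (fun u => center_incl X Y ∘ u = f) (ex_intro _ u eu)).
Qed.
Lemma center_incl_inj w (u v : hom w (center_hom X Y)) :
  center_incl X Y ∘ u = center_incl X Y ∘ v -> u = v.
Proof.
move=> e; have eq : equalizes (center_incl X Y ∘ v).
  by move=> z; rewrite -!bA (center_hom_spec.1 z).
have [t [_ ut]] := center_hom_spec.2 _ _ eq.
by rewrite -(ut u e); exact: ut.
Qed.
End CenterHom.

Context (h1 : is_simple (one : B)) (hnd : is_nondegenerate B).
Local Notation Z := (center C).

Lemma center_hom_unital (X Y : ehalf_braiding E) : unital (center_hom X Y).
Proof.
apply: (transparent_unital (mfc_semisimple hB) hnd) => v.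
have [[v' [ev [coev [zz _]]]] _] := mfc_rigid hB v.
have cf := (equalizes_central _).1 (center_hom_spec X Y).1.
pose f : @hom Z (psi (center_hom X Y) ⊗ (uhb X : Z)) (uhb Y) :=
  chom (X := Defs.hb_tens_ob (psi (center_hom X Y)) (uhb X)) cf.
have fr (w : B) (r r' : hom w (center_hom X Y)) :
    f ∘ (fmap psi r ▷ (uhb X : Z)) = f ∘ (fmap psi r' ▷ (uhb X : Z)) -> r = r'.
  move=> /(congr1 vsval) e; apply: (@center_incl_inj X Y); apply: pv_inj.
  by rewrite !pv_comp; exact: e.
have dZ (W : ehalf_braiding E) w : braid (lb_braiding Z) (uhb W : Z) (psi w)
    ∘ braid (lb_braiding Z) (psi w) (uhb W : Z) = idm _.
  apply: (double_braid_sym (lm_monoidal Z) (lb_braidingP Z)).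
  exact: uhb_centralizes W (psi w) (ex_intro _ w (ex_intro _ _ (ex_intro _ _ (invs1 (lm_monoidal Z) _)))).
have := @universal_transparent B Z hV (lm_monoidal Z) (lb_braiding (rev_linear_braided B))
  (lb_braiding Z) (lb_braidingP Z) psi hpsi hpsi_br (center_hom X Y) (uhb X) (uhb Y) f
  (dZ X) (dZ Y) fr v v' ev coev zz.
(* The equation [e] concerns the reverse braiding of [B]; composing with the braiding inverts it. *)
rewrite /= => e; apply: (double_braid_sym hV hc (M := v) (X := center_hom X Y)).
rewrite -[LHS]b2 -[X in _ ∘ X]e !bA (compKL (mon_is_cat hV) _ (braidVK hc _ _)).
exact: braidVK.
Qed.

Lemma central_ext x y (b b' : forall z, hom (x ⊗ z) (z ⊗ x)) (d d' : forall z, hom (y ⊗ z) (z ⊗ y))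
    (f : hom x y) : (forall z, b z = b' z) -> (forall z, d z = d' z) -> central b d f -> central b' d' f.
Proof. by move=> eb ed cf z; rewrite -eb -ed. Qed.

(** * The underlying category of the enriched center *)

Local Notation Ec := (ecenter hE).
Local Notation UZ := (underlying_mon Ec).
Definition un (X Y : ehalf_braiding E) (a : hom one (center_hom X Y)) :
    hom (ehb_ob X) (ehb_ob Y) := unname (center_incl X Y ∘ a).
Lemma un_inj X Y (a b : hom one (center_hom X Y)) : un a = un b -> a = b.
Proof. by move=> /unname_inj; exact: center_incl_inj. Qed.
(** [punit F k] is [k] preceded by an isomorphism that is itself central, by [cf_central_mu] and
    [central_lun]. *)
Lemma central_punit (X Y : half_braiding C) (k : hom (hb_ob X) (hb_ob Y)) :
  central (hb X) (hb Y) k <->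
  central (hb_tens (cf_hb F one) (hb X)) (hb Y) (punit F k).
Proof.
have cl := central_comp hM (central_tensm hM (cf_central_mu F) (central_idm hM (hb X)))
  (central_lun hM (hb X)).
have il : inverses (lun (hb_ob X) ∘ (mu F ▷ hb_ob X)) ((muV F ▷ hb_ob X) ∘ lunV (hb_ob X)).
  apply: (invs_comp hC) (lunI hM _).
  exact: (invs_tens hM (muI (cf_monfunctor F)) (invs1 hM _)).
split=> ck; first exact: (central_comp hM cl ck).
have -> : k = punit F k ∘ (muV F ▷ hb_ob X) ∘ lunV (hb_ob X).
  by rewrite /punit !cA (compKL hC _ (tensmrK hM _ muVK)) (lunVK hM) c2.
exact: (central_comp hM (central_inv hM il cl) ck).
Qed.
Lemma un_central X Y (a : hom one (center_hom X Y)) :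
  central (hb (uhb X)) (hb (uhb Y)) (un a).
Proof.
apply/central_punit; rewrite -pv_unname; apply/equalizes_central => z.
by rewrite -!bA (center_hom_spec X Y).1.
Qed.
Lemma un_lift (X Y : ehalf_braiding E) (k : hom (ehb_ob X) (ehb_ob Y)) :
  central (hb (uhb X)) (hb (uhb Y)) k ->
  un (center_lift (X := X) (Y := Y) (canonical_name psi k)) = k.
Proof.
move=> ck; rewrite /un center_liftK ?unname_name //.
by apply/equalizes_central; rewrite pv_name; apply/central_punit.
Qed.
Lemma equalizes_of_central (X Y : ehalf_braiding E) (a : hom one (ihom psi (ehb_ob X) (ehb_ob Y))) :
  central (hb (uhb X)) (hb (uhb Y)) (unname a) -> equalizes a.
Proof. by move=> ca; apply/equalizes_central; rewrite pv_unname; apply/central_punit. Qed.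

Lemma un_comp X Y W (g : @hom UZ Y W) (f : @hom UZ X Y) :
  un (@comp UZ X Y W g f) = un g ∘ un f.
Proof.
(* [center_lift] factors only morphisms that equalize. As the hom objects are sums of copies of the
   unit, this is tested on elements, where it is stability of central morphisms under
   composition. *)
have eq : equalizes (X := X) (Y := W)
    (ecomp (e := E) _ _ _ ∘ (center_incl Y W ⊠ center_incl X Y)).
  move=> z; apply: elt_ext2; [exact: center_hom_unital|exact: center_hom_unital|] => e e'.
  rewrite (bA (center_left X W z)) (bA (center_right X W z)) (bA (ecomp _ _ _)) -(tensmM hV).
  rewrite ecomp_elts -(bA (center_left X W z)) -(bA (center_right X W z)); congr (_ ∘ _).
  apply: (equalizes_of_central (X := X) (Y := W) _ z); rewrite unname_comp.
  exact: (central_comp hM (un_central e') (un_central e)).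
rewrite -unname_comp /un /= (compL (mon_is_cat hV) _ (center_liftK eq)) !bA.
by rewrite (tensML hV).
Qed.
Lemma uhb_tens X Y z :
  hb (uhb (ehb_tens_ob hE X Y)) z = hb_tens (hb (uhb X)) (hb (uhb Y)) z.
Proof. by rewrite /= /hb_tens !unname_comp !unname_tens !unname_id !unname_name. Qed.
Lemma uhb_one z : hb (uhb (ehb_one_ob hE)) z = hb_one z.
Proof. by rewrite /= /hb_one unname_comp !unname_name. Qed.
Lemma un_tens X X' Y Y' (f : @hom UZ X X') (g : @hom UZ Y Y') :
  un (@tensm UZ X X' Y Y' f g) = un f ⊠ un g.
Proof.
have eq : equalizes (X := ehb_tens_ob hE X Y) (Y := ehb_tens_ob hE X' Y')
    (etensh (e := E) _ _ _ _ ∘ (center_incl X X' ⊠ center_incl Y Y')).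
  move=> z; apply: elt_ext2; [exact: center_hom_unital|exact: center_hom_unital|] => e e'.
  set XY := ehb_tens_ob hE X Y; set XY' := ehb_tens_ob hE X' Y'.
  rewrite (bA (center_left XY XY' z)) (bA (center_right XY XY' z)) (bA (etensh _ _ _ _)) -(tensmM hV).
  rewrite etensh_elts -(bA (center_left XY XY' z)) -(bA (center_right XY XY' z)); congr (_ ∘ _).
  apply: (equalizes_of_central (X := ehb_tens_ob hE X Y) (Y := ehb_tens_ob hE X' Y') _ z).
  rewrite unname_tens.
  apply: (central_ext (fun z => esym (uhb_tens _ _ z)) (fun z => esym (uhb_tens _ _ z))).
  exact: (central_tensm hM (un_central e) (un_central e')).
rewrite -unname_tens /un /= (compL (mon_is_cat hV) _ (center_liftK eq)) !bA.
by rewrite (tensML hV).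
Qed.
Lemma un_id X : un (@idm UZ X) = idm (ehb_ob X).
Proof.
rewrite /un /= center_liftK ?unname_id //; apply: equalizes_of_central.
by rewrite unname_id; exact: (central_idm hM).
Qed.

Let uT2 X Y W z : hb (uhb (ehb_tens_ob hE (ehb_tens_ob hE X Y) W)) z
  = hb_tens (hb_tens (hb (uhb X)) (hb (uhb Y))) (hb (uhb W)) z.
Proof. by rewrite uhb_tens /hb_tens uhb_tens. Qed.
Let uT2' X Y W z : hb (uhb (ehb_tens_ob hE X (ehb_tens_ob hE Y W))) z
  = hb_tens (hb (uhb X)) (hb_tens (hb (uhb Y)) (hb (uhb W))) z.
Proof. by rewrite uhb_tens /hb_tens uhb_tens. Qed.
Let uL X z : hb (uhb (ehb_tens_ob hE (ehb_one_ob hE) X)) z = hb_tens hb_one (hb (uhb X)) z.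
Proof. by rewrite uhb_tens /hb_tens uhb_one. Qed.
Let uR X z : hb (uhb (ehb_tens_ob hE X (ehb_one_ob hE))) z = hb_tens (hb (uhb X)) hb_one z.
Proof. by rewrite uhb_tens /hb_tens uhb_one. Qed.

Lemma un_assoc X Y W : un (@assoc UZ X Y W) = assoc _ _ _.
Proof.
apply: un_lift; apply: central_ext (fun z => esym (uT2 X Y W z)) (fun z => esym (uT2' X Y W z)) _.
exact: central_assoc.
Qed.
Lemma un_assocV X Y W : un (@assocV UZ X Y W) = assocV _ _ _.
Proof.
apply: un_lift; apply: central_ext (fun z => esym (uT2' X Y W z)) (fun z => esym (uT2 X Y W z)) _.
exact: (central_inv hM (assocI hM _ _ _) (central_assoc hM _ _ _)).
Qed.
Lemma un_lun X : un (@lun UZ X) = lun _.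
Proof.
apply: un_lift; apply: central_ext (fun z => esym (uL X z)) (fun z => erefl _) _.
exact: (central_lun hM).
Qed.
Lemma un_lunV X : un (@lunV UZ X) = lunV _.
Proof.
apply: un_lift; apply: central_ext (fun z => erefl _) (fun z => esym (uL X z)) _.
exact: (central_inv hM (lunI hM _) (central_lun hM _)).
Qed.
Lemma un_run X : un (@run UZ X) = run _.
Proof.
apply: un_lift; apply: central_ext (fun z => esym (uR X z)) (fun z => erefl _) _.
exact: (central_run hM).
Qed.
Lemma un_runV X : un (@runV UZ X) = runV _.
Proof.
apply: un_lift; apply: central_ext (fun z => erefl _) (fun z => esym (uR X z)) _.
exact: (central_inv hM (runI hM _) (central_run hM _)).
Qed.
Lemma un_braid (X Y : Ec) : un (ebraid X Y) = hb (uhb X) (ehb_ob Y).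
Proof.
rewrite -[RHS](@un_lift (ehb_tens_ob hE X Y) (ehb_tens_ob hE Y X)).
  by congr un; congr center_lift; exact: esym (name_unname _).
apply: central_ext (fun z => esym (uhb_tens _ _ z)) (fun z => esym (uhb_tens _ _ z)) _.
exact: (central_braid hM _ (hbP (uhb X))).
Qed.
Lemma un_braidV (X Y : Ec) : un (ebraidV X Y) = hbV (uhb X) (ehb_ob Y).
Proof.
rewrite -[RHS](@un_lift (ehb_tens_ob hE Y X) (ehb_tens_ob hE X Y)).
  by congr un; congr center_lift; exact: esym (name_unname _).
apply: central_ext (fun z => esym (uhb_tens _ _ z)) (fun z => esym (uhb_tens _ _ z)) _.
exact: (central_inv hM (hbI (hbP (uhb X)) _) (central_braid hM _ (hbP (uhb X)))).
Qed.
Definition unE := (un_comp, un_tens, un_id, un_assoc, un_assocV, un_lun, un_lunV, un_run, un_runV).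

Lemma ecenter_underlying : is_monoidal UZ.
Proof.
split; first split; move=> *; try split; apply: un_inj; rewrite ?unE.
- exact: (compA hC).
- exact: (comp1m hC).
- exact: (compm1 hC).
- exact: (tensm1 hM).
- exact: (tensmM hM).
- exact: (assocI hM _ _ _).1.
- exact: (assocI hM _ _ _).2.
- exact: (lunI hM _).1.
- exact: (lunI hM _).2.
- exact: (runI hM _).1.
- exact: (runI hM _).2.
- exact: (assoc_nat hM).
- exact: (lun_nat hM).
- exact: (run_nat hM).
- exact: (pentagon hM).
- exact: (triangle hM).
Qed.
Lemma ecenter_braiding_underlying : is_braiding (underlying_braiding Ec).
Proof.
have bE (X Y : UZ) : un (braid (underlying_braiding Ec) X Y) = hb (uhb X) (ehb_ob Y) := un_braid X Y.
have bVE (X Y : UZ) : un (braidV (underlying_braiding Ec) X Y) = hbV (uhb X) (ehb_ob Y) := un_braidV X Y.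
split=> [X Y|X X' Y Y' f g|X Y W|X Y W]; try split; apply: un_inj; rewrite ?unE ?bE ?bVE.
- exact: (hbI (hbP (uhb X)) _).1.
- exact: (hbI (hbP (uhb X)) _).2.
- have cf := un_central f (ehb_ob Y').
  rewrite (tensm_lr hM (un f)) (compL hC _ (esym cf)) !cA.
  by rewrite (hb_nat (hbP (uhb X))) -!cA -(tensm_rl hM).
- exact: (hb_hexagon (hbP (uhb X))).
- rewrite uhb_tens /hb_tens !cA (compKL hC _ (assocK hM _ _ _)) (assocVK hM).
  by rewrite c2.
Qed.
Lemma un_linear X Y : linear (@un X Y).
Proof.
move=> a u v; rewrite /un compDr compZr.
have : forall x y (k l : hom one (ihom psi x y)), unname (a *: k + l) = a *: unname k + unname l.
  move=> x y k l; rewrite /unname -!lock /pv.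
  have e : phim psi (a *: k + l) = a *: phim psi k + phim psi l.
    exact: (congr1 vsval (hpsi_lin a k l)).
  rewrite [fmap F (a *: k + l)]e (tensm_linl (lm_linear C)) compDr compZr.
  by rewrite !compDl !compZl.
by move=> ->.
Qed.


(** * Comparison with the centralizer *)

Local Notation D := (centralizer psi).
Definition centralizer_ob (X : UZ) : D := exist _ (uhb X) (uhb_centralizes X).
Lemma central_idm_of x (b b' : forall z, hom (x ⊗ z) (z ⊗ x)) :
  (forall z, b z = b' z) -> central b b' (idm x).
Proof. by move=> e; exact: central_ext (fun z => erefl _) e (central_idm hM b). Qed.
(** The structure morphisms are identities of [C]: the half-braidings at both ends agree pointwise
    by [uhb_one] and [uhb_tens], which makes the identities central. *)
Definition ecenter_underlying_functor : monfunctor_data UZ D :=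
  @MonFunctorData UZ D
    (@FunctorData UZ D centralizer_ob (fun X Y a => chom (un_central a)))
    (chom (X := uhb (ehb_one_ob hE)) (Y := hb_unit_ob C) (central_idm_of uhb_one))
    (chom (X := hb_unit_ob C) (Y := uhb (ehb_one_ob hE)) (central_idm_of (fun z => esym (uhb_one z))))
    (fun X Y => chom (X := Defs.hb_tens_ob (uhb X) (uhb Y)) (Y := uhb (ehb_tens_ob hE X Y))
       (central_idm_of (fun z => esym (uhb_tens X Y z))))
    (fun X Y => chom (X := uhb (ehb_tens_ob hE X Y)) (Y := Defs.hb_tens_ob (uhb X) (uhb Y))
       (central_idm_of (uhb_tens X Y))).
Lemma ecenter_underlying_monfunctor : is_monfunctor ecenter_underlying_functor.
Proof.
split; first split.
- by move=> X; apply: val_inj; exact: un_id.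
- by move=> X Y W g f; apply: val_inj; exact: un_comp.
- by split; apply: val_inj; exact: c1.
- by move=> X Y; split; apply: val_inj; exact: c1.
- move=> X X' Y Y' f g; apply: val_inj; rewrite /= un_tens.
  by rewrite c1 c2.
- move=> X Y W; apply: val_inj; rewrite /= un_assoc !(tensm1 hM) !c1 !c2.
  by [].
- by move=> X; apply: val_inj; rewrite /= un_lun (tensm1 hM) !c2.
- by move=> X; apply: val_inj; rewrite /= un_run (tensm1 hM) !c2.
Qed.

Local Notation Phi := ecenter_underlying_functor.
Lemma ecenter_underlying_braided :
  preserves_braiding (underlying_braiding Ec) (lb_braiding D) Phi.
Proof.
move=> X Y.
pose S := subvs_of (central_space (Defs.hb_tens_ob (uhb X) (uhb Y)) (uhb (ehb_tens_ob hE Y X))).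
apply: (@val_inj _ _ S).
have eL : vsval (fmap Phi (braid (underlying_braiding Ec) X Y) ∘ nu Phi X Y : S)
  = un (ebraid X Y) ∘ idm _ by [].
have eR : vsval (nu Phi Y X ∘ braid (lb_braiding D) (Phi X) (Phi Y) : S)
  = idm _ ∘ hb (uhb X) (ehb_ob Y) by [].
apply: (etrans eL); apply: (etrans _ (esym eR)).
by rewrite c1 c2 un_braid.
Qed.
Lemma ecenter_underlying_linear (X Y : Ec) :
  linear (@fmap _ _ Phi X Y : hom one (ehom X Y) -> hom (Phi X) (Phi Y)).
Proof. by move=> a u v; apply: val_inj; exact: un_linear. Qed.
Lemma ecenter_underlying_fully_faithful : fully_faithful Phi.
Proof.
move=> X Y; exists (fun f => center_lift (X := X) (Y := Y) (canonical_name psi (vsval f))).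
  by move=> a; apply: un_inj; rewrite un_lift //; exact: un_central.
by move=> f; apply: val_inj; rewrite /= un_lift //; exact: chomP.
Qed.
(** The half-braiding of an object of the centralizer is enriched by [centralizing_natural], so the
    object lifts up to an identity of [C]. *)
Lemma ecenter_underlying_essentially_surjective : essentially_surjective Phi.
Proof.
move=> [X cX]; exists (ehb_of cX).
have e z : hb (uhb (ehb_of cX)) z = hb X z by exact: unname_name.
exists (chom (X := uhb (ehb_of cX)) (Y := X) (central_idm_of e)).
exists (chom (X := X) (Y := uhb (ehb_of cX)) (central_idm_of (fun z => esym (e z)))).
by split; apply: val_inj; exact: c1.
Qed.

Theorem ecenter_equivalence :
  ebraided_equivalent (lb_braiding B) Ec (vect_enriched B D).
Proof.
exact: (vect_equivalence (mfc_semisimple hB).1 h1 (A := Ec) center_hom_unital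
  ecenter_underlying_monfunctor ecenter_underlying_linear ecenter_underlying
  ecenter_braiding_underlying ecenter_underlying_braided
  ecenter_underlying_fully_faithful ecenter_underlying_essentially_surjective).
Qed.
End Canonical.

Local Close Scope cat_scope.

Theorem corollary5p4 (R : realType) (B : linear_braided R[i])
    (hB : is_fusion B) (hBnd : is_nondegenerate B)
    (C : linear_monoidal R[i])
    (hC : is_multifusion C) (hCind : is_indecomposable C)
    (psi : monfunctor_data (rev_linear_braided B) (center C))
    (hpsi : is_monfunctor psi)
    (hpsi_lin : is_linear_functor psi)
    (hpsi_br : preserves_braiding (lb_braiding (rev_linear_braided B))
       (lb_braiding (center C)) psi) :
  exists hE : is_emonoidal (lb_braiding B) (canonical psi),
    ebraided_equivalent (lb_braiding B) (ecenter hE)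
      (vect_enriched B (centralizer psi)).
Proof.
have [hBm h1] := hB.
exists (canonical_emonoidal hpsi hpsi_br hpsi_lin hBm).
exact: ecenter_equivalence hpsi hpsi_br hpsi_lin hBm _ h1 hBnd.
Qed.
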